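(* For every tree $T$ with $m$ edges there exists an integer $k_T$ such that every $k_T$-edge-connected graph $G$ whose number of edges $|E(G)|$ is divisible by $m$ has a $T$-decomposition.
   Context: All graphs are finite and simple. For a graph $H$, a graph $G$ has an $H$-decomposition if $E(G)$ can be partitioned into parts each of which induces a subgraph isomorphic to $H$. *)

(* Defs.v *)
From mathcomp Require Import all_boot.
Set Implicit Arguments. Unset Strict Implicit. Unset Printing Implicit Defensive.

Definition simple_graph (V : finType) (e : rel V) : Prop :=
  symmetric e /\ irreflexive e.

Definition edges (V : finType) (e : rel V) : {set {set V}} :=
  [set [set p.1; p.2] | p in [set q : V * V | e q.1 q.2]].

Definition rel_of (V : finType) (E : {set {set V}}) : rel V :=
  fun x y => [set x; y] \in E.

Definition connected_graph (V : finType) (e : rel V) : Prop :=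
  forall x y : V, connect e x y.

Definition acyclic (V : finType) (e : rel V) : Prop :=
  forall s : seq V, 3 <= size s -> uniq s -> ~~ cycle e s.

Definition is_tree (V : finType) (e : rel V) : Prop :=
  simple_graph e /\ 0 < #|V| /\ connected_graph e /\ acyclic e.

Definition k_edge_connected (k : nat) (V : finType) (e : rel V) : Prop :=
  forall F : {set {set V}}, F \subset edges e -> #|F| < k ->
    connected_graph (rel_of (edges e :\: F)).

(* an edge set H (edge-induced subgraph) is isomorphic to the graph (VT,eT):
   some injective vertex map carries the edges of T exactly onto H *)
Definition is_copy (VT : finType) (eT : rel VT) (V : finType)
    (H : {set {set V}}) : Prop :=
  exists f : VT -> V, injective f /\
    H = [set [set f p.1; f p.2] | p in [set q : VT * VT | eT q.1 q.2]].

Definition has_decomposition (VT : finType) (eT : rel VT) (V : finType)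
    (e : rel V) : Prop :=
  exists P : {set {set {set V}}}, partition P (edges e) /\
    forall H, H \in P -> is_copy eT H.

(* Main.v *)
Require Import Defs.
From mathcomp Require Import all_boot all_algebra zify.
Set Implicit Arguments. Unset Strict Implicit. Unset Printing Implicit Defensive.

(** Suppose that the edges xy of G are coloured by the ordered edges (s, t) of T so that
    (s, t) for xy means (t, s) for yx, and that every vertex x has the same number
    n_s(x) >= D of edges in each colour (s, t) at s. Then T-copies are grown leaf by leaf:
    each edge coloured (s, t) at x is attached to one of the n_s(x) partial copies having
    x in the role of s. These attachments are matchings; splitting the copies at x into
    groups of bounded size with many disjoint matchings each, a Rosenfeld-type counting
    argument chooses the matchings so that the copies stay injective and well spread.

    To find such a colouring, orient it from one side of the bipartition of T to the other:
    every vertex should have kappa_t q(x) out-arcs of colour t, and a number of in-arcs of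
    colour t divisible by kappa_t, where kappa_t is the degree of t. A maximum cut of G is
    highly edge-connected and its edges split (Rado's theorem for sums of graphic matroids)
    into many connected subgraphs. Those in one family are oriented by a theorem on
    orientations with prescribed out-degrees modulo m, those in the two others are lifted to
    cherries, which become the edges of highly connected auxiliary multigraphs on the two
    sides. Cherries of two colours, oriented modulo kappa_t, correct the in-degrees without
    changing the out-degrees, for which the remaining out-arcs are coloured at will. *)


(** * Packing connected subgraphs *)

(** Out-arcs are coloured at will at their common tail, so the difficulty lies in the in-arcs, whose
    colours are decided elsewhere. Two facts make their congruences attainable. The chosen side of T
    contains a leaf; its colour has kappa = 1, hence no congruence to satisfy, and serves as the
    second colour of the correcting cherries. And the total over one side of the cut, which a
    modular orientation has to respect, comes out right by itself: counted at the tails, it is fixed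
    by the prescribed out-degrees. Divisibility of |E(G)| by m is used once, for the corresponding
    total of the out-degrees modulo m. In the growth of the copies, D and the number q of matchings
    serve for all leaves, while the bound on coincidences increases with each leaf: a new bound k
    has to make q^k exceed, among other factors, the number 2^(2D) of subsets of a group, although q
    < D. With the bounds written as D / 2^T, the exponent T before a leaf is added is exponential in
    the one after it, hence the tower among the constants. *)

(** Rado's theorem on independent transversals, with the rank replaced by a monotone submodular [g].
    The value [g set0] may be positive, which covers the version with defect and is the reason for
    asking that the sets be nonempty. A set with two elements x, y can lose one of them: otherwise
    the index sets [J1], [J2] violated by the two removals uncross, since the union of the two
    reduced unions still covers everything for [J1 :|: J2], and their intersection everything for
    [J1 :&: J2] without [i0]. *)
Lemma rado (I O : finType) (g : {set O} -> nat) (D : {set I}) (F : I -> {set O}) :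
  (forall A B : {set O}, A \subset B -> g A <= g B) ->
  (forall A B : {set O}, g (A :|: B) + g (A :&: B) <= g A + g B) ->
  (forall i, i \in D -> F i != set0) ->
  (forall J : {set I}, J \subset D -> #|J| <= g (\bigcup_(i in J) F i)) ->
  exists F' : I -> {set O},
    (forall i, i \in D -> F' i \subset F i /\ #|F' i| = 1) /\
    (forall J : {set I}, J \subset D -> #|J| <= g (\bigcup_(i in J) F' i)).
Proof.
move=> gmono gsub.
have [n] := ubnP (\sum_(i in D) #|F i|); elim: n F => // n IHn F ltn Fn0 Fg.
have [/existsP[i0 /andP[i0D i0gt]]|] := boolP [exists i in D, 1 < #|F i|]; last first.
  rewrite negb_exists => /forallP F1; exists F; split=> // i iD; split=> //.
  by have := F1 i; rewrite iD /= -leqNgt => h; apply/eqP; rewrite eqn_leq h card_gt0 Fn0.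
have /card_gt1P [x [y [xF yF xy]]] := i0gt.
pose Fx z i := if i == i0 then F i0 :\ z else F i.
have Fx_sub z i : Fx z i \subset F i.
  by rewrite /Fx; case: eqP => [->|_]; rewrite ?subD1set.
have good z : z \in F i0 ->
    (forall J : {set I}, J \subset D -> #|J| <= g (\bigcup_(i in J) Fx z i)) ->
    exists F' : I -> {set O},
    (forall i, i \in D -> F' i \subset F i /\ #|F' i| = 1) /\
    (forall J : {set I}, J \subset D -> #|J| <= g (\bigcup_(i in J) F' i)).
  move=> zF Jz; have [||F' [F'1 F'2]] := IHn (Fx z) _ _ Jz.
  - apply: (@leq_trans (\sum_(i in D) #|F i|)) => //; rewrite (bigD1 i0) //= [in X in _ <= X](bigD1 i0) //=.
    rewrite -addSn leq_add //; first by rewrite /Fx eqxx [X in _ < X](cardsD1 z) zF.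
    by apply: leq_sum => i _; apply/subset_leq_card/Fx_sub.
  - move=> i iD; rewrite /Fx; case: (i =P i0) => [_|_]; last exact: Fn0.
    by rewrite -card_gt0 -(ltn_add2l (z \in F i0)) -cardsD1 zF.
  - exists F'; split=> // i iD; have [h ->] := F'1 i iD; split=> //.
    exact: subset_trans h (Fx_sub _ _).
have [/forallP Hx|] := boolP [forall J : {set I}, (J \subset D) ==> (#|J| <= g (\bigcup_(i in J) Fx x i))].
  by apply: (good x xF) => J JD; have /implyP := Hx J; apply.
have [/forallP Hy _|] := boolP [forall J : {set I}, (J \subset D) ==> (#|J| <= g (\bigcup_(i in J) Fx y i))].
  by apply: (good y yF) => J JD; have /implyP := Hy J; apply.
rewrite !negb_forall => /existsP[J2 ]; rewrite negb_imply -ltnNge => /andP[J2D J2g].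
move=> /existsP[J1 ]; rewrite negb_imply -ltnNge => /andP[J1D J1g].
have Fout z (J : {set I}) : i0 \notin J -> \bigcup_(i in J) Fx z i = \bigcup_(i in J) F i.
  move=> nJ; apply: eq_bigr => i iJ; rewrite /Fx; case: eqP => // ii.
  by rewrite ii in iJ; rewrite iJ in nJ.
have i0J1 : i0 \in J1.
  by apply: contraLR J1g => nJ; rewrite Fout // -leqNgt Fg.
have i0J2 : i0 \in J2.
  by apply: contraLR J2g => nJ; rewrite Fout // -leqNgt Fg.
set A1 := \bigcup_(i in J1) Fx x i in J1g; set A2 := \bigcup_(i in J2) Fx y i in J2g.
have U : \bigcup_(i in J1 :|: J2) F i \subset A1 :|: A2.
  apply/bigcupsP => i iJ; apply/subsetP => z zF.
  have [ii|ii] := eqVneq i i0.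
    subst i; have [zx|zx] := eqVneq z x.
      rewrite in_setU; apply/orP; right; apply/bigcupP; exists i0 => //.
      by rewrite /Fx eqxx !inE zF andbT zx.
    rewrite in_setU; apply/orP; left; apply/bigcupP; exists i0 => //.
    by rewrite /Fx eqxx !inE zF andbT zx.
  move: iJ; rewrite !in_setU => /orP[] iJ; apply/orP; [left|right];
  by apply/bigcupP; exists i => //; rewrite /Fx (negPf ii).
have Int : \bigcup_(i in (J1 :&: J2) :\ i0) F i \subset A1 :&: A2.
  apply/bigcupsP => i; rewrite !inE => /and3P[ii iJ1 iJ2]; apply/subsetP => z zF.
  by rewrite in_setI; apply/andP; split; apply/bigcupP; exists i => //; rewrite /Fx (negPf ii).
have h1 := leq_trans (Fg (J1 :|: J2) _) (gmono _ _ U).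
have h2 := leq_trans (Fg ((J1 :&: J2) :\ i0) _) (gmono _ _ Int).
have s1 : J1 :|: J2 \subset D by rewrite subUset J1D.
have s2 : (J1 :&: J2) :\ i0 \subset D.
  by apply: subset_trans (subD1set _ _) _; apply: subset_trans (subsetIl _ _) J1D.
have := leq_trans (leq_add (h1 s1) (h2 s2)) (gsub A1 A2).
have := cardsUI J1 J2.
have : #|J1 :&: J2| = 1 + #|(J1 :&: J2) :\ i0| by rewrite (cardsD1 i0) in_setI i0J1 i0J2.
move: J1g J2g; clear; lia.
Qed.

(** Edges are the elements of a finite type with two endpoint maps. Parallel edges are thus allowed,
    and lifting or contraction changes the maps while the type stays the same. *)
Definition crosses (V X : finType) (s t : X -> V) (S : {set V}) (e : X) : bool :=
  (s e \in S) (+) (t e \in S).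

Definition cut_connected (V X : finType) (s t : X -> V) (U : {set V}) (E : {set X}) : Prop :=
  forall S : {set V}, S \subset U -> S != set0 -> S != U ->
    exists2 e, e \in E & crosses s t S e.

(** * The rank function of the graphic matroid *)

Section EdgeRank.
Import GRing.Theory.
Local Open Scope ring_scope.
Variables (V X : finType) (s t : X -> V).

Definition unit_vec (x : V) : 'rV[rat]_#|V| := delta_mx 0 (enum_rank x).

(** The graphic matroid is represented over the rationals by the vectors x - y for the edges xy, so
    that submodularity of its rank is the dimension formula for subspaces. *)
Definition edge_span (Y : {set X}) : 'M[rat]_#|V| :=
  (\sum_(e in Y) <<unit_vec (s e) - unit_vec (t e)>>)%MS.

Definition edge_rank (Y : {set X}) : nat := \rank (edge_span Y).

Lemma edge_span_sub (A B : {set X}) : A \subset B -> (edge_span A <= edge_span B)%MS.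
Proof.
move=> /subsetP AB; apply/sumsmx_subP => e eA.
by rewrite (sumsmx_sup e) // AB.
Qed.

Lemma edge_rank_mono (A B : {set X}) : A \subset B -> (edge_rank A <= edge_rank B)%N.
Proof. by move=> AB; apply/mxrankS/edge_span_sub. Qed.

Lemma edge_rank_submod (A B : {set X}) :
  (edge_rank (A :|: B) + edge_rank (A :&: B) <= edge_rank A + edge_rank B)%N.
Proof.
rewrite /edge_rank -[X in (_ <= X)%N]mxrank_sum_cap; apply: leq_add; apply: mxrankS.
  apply/sumsmx_subP => e; rewrite in_setU => /orP[] eA.
    by apply: submx_trans (addsmxSl _ _); rewrite /edge_span (sumsmx_sup e).
  by apply: submx_trans (addsmxSr _ _); rewrite /edge_span (sumsmx_sup e).
by rewrite sub_capmx !edge_span_sub // ?subsetIl ?subsetIr.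
Qed.

(** If both ends of an edge st have the same representative, then s - t = (s - rep s) - (t - rep t),
    so the differences x - rep x at the moved points span. With two representatives, one on each
    side of an uncrossed cut, this shows that the rank is not full. *)
Lemma edge_rank_le_rep (U : {set V}) (rep : V -> V) (Y : {set X}) :
  (forall e, e \in Y -> s e \in U /\ t e \in U) ->
  (forall e, e \in Y -> rep (s e) = rep (t e)) ->
  (edge_rank Y <= #|[set x in U | rep x != x]|)%N.
Proof.
move=> YU Yrep; set R := [set _ in _ | _].
pose W := (\sum_(x in R) <<unit_vec x - unit_vec (rep x)>>)%MS.
have YW : (edge_span Y <= W)%MS.
  apply/sumsmx_subP => e eY; rewrite genmxE.
  have -> : unit_vec (s e) - unit_vec (t e) =
     (unit_vec (s e) - unit_vec (rep (s e))) - (unit_vec (t e) - unit_vec (rep (t e))).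
    by rewrite Yrep // opprB addrA subrK.
  have h x : x \in U -> (unit_vec x - unit_vec (rep x) <= W)%MS.
    move=> xU; have [->|xr] := eqVneq (rep x) x; first by rewrite subrr sub0mx.
    by rewrite (sumsmx_sup x) ?genmxE // inE xU.
  have [sU tU] := YU e eY.
  by rewrite addmx_sub ?h // eqmx_opp h.
apply: leq_trans (mxrankS YW) _.
apply: leq_trans (mxrank_sum_leqif _).1 _.
rewrite -sum1_card; apply: leq_sum => x _ /=.
by rewrite mxrank_gen rank_leq_row.
Qed.

(** The roots together with the differences x - root x span the whole space. *)
Lemma edge_rank_ge_roots (Y : {set X}) (root : V -> V) :
  (forall x, (unit_vec x - unit_vec (root x) <= edge_span Y)%MS) ->
  (#|V| <= edge_rank Y + #|[set root x | x : V]|)%N.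
Proof.
move=> rootY.
pose W := (\sum_(x in [set root x | x : V]) <<unit_vec x>>)%MS.
have : (1%:M <= edge_span Y + W)%MS.
  apply/row_subP => i; rewrite row1.
  have -> : delta_mx 0 i = unit_vec (enum_val i) by rewrite /unit_vec enum_valK.
  rewrite -[unit_vec _](subrK (unit_vec (root (enum_val i)))).
  apply: addmx_sub_adds; first exact: rootY.
  by rewrite (sumsmx_sup (root (enum_val i))) ?genmxE // imset_f.
move=> /mxrankS; rewrite mxrank1 => h; apply: leq_trans h _.
apply: leq_trans (mxrank_adds_leqif _ _).1 _; rewrite leq_add2l.
apply: leq_trans (mxrank_sum_leqif _).1 _.
rewrite -sum1_card; apply: leq_sum => x _ /=.
by rewrite mxrank_gen rank_leq_row.
Qed.

Lemma edge_span_connect (Y : {set X}) (x y : V) :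
  connect (fun x y => [exists e in Y, ((s e == x) && (t e == y)) || ((s e == y) && (t e == x))]) x y ->
  (unit_vec x - unit_vec y <= edge_span Y)%MS.
Proof.
move=> /connectP[p]; elim: p x => [|z p IHp] x /=; first by move=> _ ->; rewrite subrr sub0mx.
move=> /andP[/existsP[e /andP[eY exz]] zp] yl.
rewrite -[unit_vec x](subrK (unit_vec z)) -addrA addmx_sub ?IHp //.
rewrite (sumsmx_sup e) // genmxE.
by case/orP: exz => /andP[/eqP-> /eqP->] //; rewrite -eqmx_opp opprB.
Qed.

End EdgeRank.

Lemma card_le_fibers (X I : finType) (Z : {set X}) (D : {set I}) (f : X -> I) (M : nat) :
  (forall e, e \in Z -> f e \in D) ->
  (forall i, #|[set e in Z | f e == i]| <= M) -> #|Z| <= #|D| * M.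
Proof.
move=> ZD fM; rewrite -sum1_card (partition_big f (mem D)) //=.
rewrite -sum_nat_const; apply: leq_sum => i _; apply: leq_trans (fM i).
by rewrite -sum1_card; rewrite leq_eqVlt; apply/orP; left; apply/eqP/eq_bigl => e; rewrite inE.
Qed.

Section Packing.
(* [bnd] groups the edges into bundles; at most one edge of each bundle is used. *)
Variables (V X I : finType) (s t : X -> V) (U : {set V}) (E : {set X}) (bnd : X -> I).
Variables (r M K : nat).
Hypotheses (M_gt0 : 0 < M) (KrM : 2 * r * M <= K).
Hypothesis (EU : forall e, e \in E -> s e \in U /\ t e \in U).
Hypothesis (cutE : forall S : {set V}, S \subset U -> S != set0 -> S != U ->
  K <= #|[set e in E | crosses s t S e]|).
Hypothesis (bndM : forall i, #|[set e in E | bnd e == i]| <= M).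

(** Rado's condition with defect for the sum of [r] graphic matroids. Let P be the components of [U]
    under the edges [Y] of the bundles in [J]; the rank of [Y] is at least #|U| - #|P|. If there are
    at least two components, each is left by at least [K] edges, all outside [Y], and an edge leaves
    at most two components. A bundle holds at most [M] edges, so at least r #|P| bundles lie outside
    [J]. *)
Lemma packing_rank (J : {set I}) : J \subset bnd @: E ->
  #|J| + r * #|U|.-1 <= r * edge_rank s t [set e in E | bnd e \in J] + #|bnd @: E|.
Proof.
move=> JD; set D := bnd @: E; set Y := [set e in E | _].
pose adj := fun x y => [exists e in Y, ((s e == x) && (t e == y)) || ((s e == y) && (t e == x))].
have csym : connect_sym adj.
  apply: sym_connect_sym => x y; rewrite /adj.
  by apply: eq_existsb => e; rewrite orbC.
pose rt x := fingraph.root adj x.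
pose P := rt @: U.
have UP : #|U| <= edge_rank s t Y + #|P|.
  have h := @edge_rank_ge_roots V X s t Y rt _.
  have {}h : #|V| <= edge_rank s t Y + #|[set rt x | x : V]|.
    by apply: h => x; apply: edge_span_connect; apply: connect_root.
  have h2 : #|[set rt x | x : V]| <= #|P| + #|~: U|.
    apply: (@leq_trans #|P :|: rt @: (~: U)|).
      apply/subset_leq_card/subsetP => z /imsetP[x _ ->]; rewrite inE.
      case: (boolP (x \in U)) => xU; apply/orP; [left|right]; apply/imsetP; exists x => //.
      by rewrite inE.
    apply: leq_trans (leq_card_setU _ _) _; rewrite leq_add2l; exact: leq_imset_card.
  have := cardsC U; move: h h2; clear; lia.
have DJ : #|D| = #|J| + #|D :\: J| by rewrite -(cardsID J D) (setIidPr JD).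
have [p1|p2] := leqP #|P| 1.
  have : r * #|U|.-1 <= r * edge_rank s t Y.
    by rewrite leq_mul2l; apply/orP; right; move: UP p1; clear; lia.
  by move: DJ; clear; lia.
suff : r * #|P| <= #|D :\: J|.
  move=> h; have : r * #|U|.-1 <= r * edge_rank s t Y + r * #|P|.
    by rewrite -mulnDr leq_mul2l; apply/orP; right; move: UP; clear; lia.
  by move: h DJ; clear; lia.
rewrite -(leq_pmul2r M_gt0).
have ED : #|E :\: Y| <= #|D :\: J| * M.
  apply: (card_le_fibers (f := bnd)) => [e|i].
    rewrite !inE => /andP[h eE]; rewrite eE /= in h.
    by rewrite h /D imset_f.
  apply: leq_trans (bndM i); apply: subset_leq_card; apply/subsetP => e.
  by rewrite !inE => /andP[/andP[_ ->] ->].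
apply: leq_trans ED.
pose comp c := [set x in U | rt x == c].
have compK c : c \in P -> K <= #|[set e in E | crosses s t (comp c) e]|.
  move=> cP; apply: cutE.
  - by apply/subsetP => x; rewrite inE => /andP[].
  - by move/imsetP: cP => [x xU ->]; apply/set0Pn; exists x; rewrite inE xU eqxx.
  - apply/eqP => cU; have /card_gt1P[a [b [aP bP ab]]] := p2.
    have P1 d : d \in P -> d = c.
      by move=> /imsetP[x xU ->]; move: xU; rewrite -cU inE => /andP[_ /eqP].
    by rewrite (P1 a aP) (P1 b bP) eqxx in ab.
have lowb : #|P| * K <= \sum_(c in P) #|[set e in E | crosses s t (comp c) e]|.
  by rewrite -sum_nat_const; apply: leq_sum => c; apply: compK.
have upb : \sum_(c in P) #|[set e in E | crosses s t (comp c) e]| <= #|E :\: Y| * 2.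
  have -> : \sum_(c in P) #|[set e in E | crosses s t (comp c) e]| =
     \sum_(e in E) \sum_(c in P) (crosses s t (comp c) e : nat).
    rewrite exchange_big /=; apply: eq_bigr => c _.
    rewrite -sum1_card big_mkcond [RHS]big_mkcond; apply: eq_bigr => e _.
    by rewrite !inE; case: (e \in E); case: crosses.
  rewrite (bigID (mem Y)) /= big1 ?add0n; last first.
    move=> e /andP[eE eY]; apply: big1 => c _; apply/eqP; rewrite eqb0.
    have [sU tU] := EU eE.
    rewrite /crosses !inE sU tU /=; suff -> : rt (s e) = rt (t e) by rewrite addbb.
    apply/eqP; rewrite /rt (root_connect csym); apply: connect1; apply/existsP; exists e.
    by rewrite eY !eqxx.
  rewrite -sum_nat_const; apply: (@leq_trans (\sum_(i in E :\: Y) \sum_(c in P) (crosses s t (comp c) i : nat))).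
    by rewrite leq_eqVlt; apply/orP; left; apply/eqP/eq_bigl => e; rewrite !inE andbC.
  apply: leq_sum => e; rewrite inE => /andP[_ eE].
  apply: (@leq_trans (\sum_(c in P) ((c == rt (s e)) + (c == rt (t e))))).
    apply: leq_sum => c _; have [sU tU] := EU eE.
    rewrite /crosses !inE sU tU /= (eq_sym c) [c == rt (t e)]eq_sym.
    by case: (rt (s e) == c); case: (rt (t e) == c).
  rewrite big_split /=.
  have one z : \sum_(c in P) (c == z : nat) <= 1.
    have [zP|zP] := boolP (z \in P).
      rewrite (bigD1 z) //= eqxx big1 ?addn0 // => c /andP[_ /negPf->] //.
    by rewrite big1 // => c cP; case: eqP => // cz; rewrite cz (negPf zP) in cP.
  by rewrite -[2]/(1 + 1) leq_add.
have := leq_trans lowb upb; have : #|P| * (2 * r * M) <= #|P| * K by rewrite leq_mul2l KrM orbT.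
move=> h1 h2; have := leq_trans h1 h2.
have -> : #|P| * (2 * r * M) = (r * #|P| * M) * 2 by move: #|P|; clear; lia.
by rewrite leq_pmul2r.
Qed.

(* Rado's theorem for the sum of [r] graphic matroids on [X * 'I_r]. *)
Lemma packing : exists lab : X -> option 'I_r,
  [/\ forall e l, lab e = Some l -> e \in E,
      forall e e', lab e -> lab e' -> bnd e = bnd e' -> e = e' &
      forall l, cut_connected s t U [set e | lab e == Some l]].
Proof.
have [r0|] := posnP r.
  exists (fun=> None); split=> // -[l ll]; by move: ll; rewrite r0.
move=> r_gt0; have l0 : 'I_r by exists 0.
pose D := bnd @: E.
pose F i : {set X * 'I_r} := [set o | (o.1 \in E) && (bnd o.1 == i)].
pose sl (Q : {set X * 'I_r}) l := [set e | (e, l) \in Q].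
pose f Q := \sum_(l < r) edge_rank s t (sl Q l).
(* The defect: [d] bundles may contribute nothing, the others suffice for [r] spanning trees. The
   case [J = set0] of [packing_rank] shows that the subtraction is not truncated. *)
pose d := #|D| - r * #|U|.-1.
have fmono (A B : {set X * 'I_r}) : A \subset B -> f A <= f B.
  move=> /subsetP AB; apply: leq_sum => l _; apply: edge_rank_mono.
  by apply/subsetP => e; rewrite !inE => /AB.
have fsub (A B : {set X * 'I_r}) : f (A :|: B) + f (A :&: B) <= f A + f B.
  rewrite /f -!big_split /=; apply: leq_sum => l _.
  have -> : sl (A :|: B) l = sl A l :|: sl B l by apply/setP => e; rewrite !inE.
  have -> : sl (A :&: B) l = sl A l :&: sl B l by apply/setP => e; rewrite !inE.
  exact: edge_rank_submod.
have fJ (J : {set I}) : J \subset D ->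
   f (\bigcup_(i in J) F i) = r * edge_rank s t [set e in E | bnd e \in J].
  move=> JD; rewrite /f -[RHS]/(r * _) -[r in RHS]card_ord -sum_nat_const.
  apply: eq_bigr => l _; congr edge_rank; apply/setP => e; rewrite !inE.
  apply/bigcupP/andP => [[i iJ]|[eE eJ]]; first by rewrite inE /= => /andP[-> /eqP->].
  by exists (bnd e) => //; rewrite inE /= eE eqxx.
have dD : r * #|U|.-1 + d = #|D|.
  rewrite /d subnKC //; have := packing_rank (sub0set _); rewrite cards0 add0n => h.
  have := fJ set0 (sub0set _); rewrite big_set0 => fs0.
  have : f set0 = 0.
    rewrite /f big1 // => l _; rewrite /edge_rank /edge_span big1 ?mxrank0 //.
    by move=> e; rewrite inE in_set0.
  by move=> f0; move: h; rewrite -fs0 f0.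
have [||||F' [F'1 F'2]] := @rado I (X * 'I_r)%type (fun Q => f Q + d) D F.
- by move=> A B AB; rewrite leq_add2r fmono.
- by move=> A B; have := fsub A B; clear; lia.
- by move=> i /imsetP[e eE ->]; apply/set0Pn; exists (e, l0); rewrite inE /= eE eqxx.
- move=> J JD; rewrite fJ //; have := packing_rank JD; rewrite -/D -dD.
  by move: (r * _) (r * _); clear; lia.
pose Q := \bigcup_(i in D) F' i.
have Qprop e l : (e, l) \in Q -> e \in E.
  move=> /bigcupP[i iD eF]; have [/subsetP h _] := F'1 i iD.
  by have := h _ eF; rewrite inE => /andP[].
have Quniq e l e' l' : (e, l) \in Q -> (e', l') \in Q -> bnd e = bnd e' -> (e, l) = (e', l').
  move=> /bigcupP[i iD eF] /bigcupP[i' iD' eF'] bb.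
  have [/subsetP h c1] := F'1 i iD; have [/subsetP h' c1'] := F'1 i' iD'.
  have := h _ eF; rewrite inE => /andP[_ /eqP /= bi].
  have := h' _ eF'; rewrite inE => /andP[_ /eqP /= bi'].
  have ii : i = i' by rewrite -bi -bi'.
  subst i'; rewrite ii in eF; rewrite ii in c1; move/eqP: c1 => /cards1P[z zz].
  by move: eF eF'; rewrite zz !inE => /eqP-> /eqP->.
pose lab e := [pick l | (e, l) \in Q].
have labE e l : (lab e == Some l) = ((e, l) \in Q).
  rewrite /lab; case: pickP => [l' h|h]; last by rewrite h.
  apply/eqP/idP => [[<-]//|h']; by have [->] := Quniq _ _ _ _ h h' erefl.
exists lab; split.
- by move=> e l /eqP; rewrite labE; apply: Qprop.
- move=> e e'; case le : (lab e) => [l|] // _; case le' : (lab e') => [l'|] // _.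
  move/eqP: le; move/eqP: le'; rewrite !labE => h' h bb.
  by have [] := Quniq _ _ _ _ h h' bb.
move=> l S SU S0 SnU.
(* The transversal attains the largest rank that [r] layers can have together, so each layer has
   full rank #|U| - 1; an uncrossed cut in layer [l] would lower it. *)
have full : r * #|U|.-1 <= f Q.
  have := F'2 D (subxx _); rewrite -/Q -dD leq_add2r; exact.
have slQ l' : sl Q l' = [set e | lab e == Some l'] by apply/setP => e; rewrite !inE labE.
have U0 : U != set0.
  by apply: contra_neq S0 => U0; apply/eqP; rewrite -subset0 -U0.
have EUl l' e : e \in sl Q l' -> s e \in U /\ t e \in U.
  by rewrite inE => /Qprop; apply: EU.
have le l' : edge_rank s t (sl Q l') <= #|U|.-1.
  have /set0Pn[x0 x0U] := U0.
  apply: leq_trans (edge_rank_le_rep (U := U) (rep := fun=> x0) (EUl l') (fun _ _ => erefl)) _.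
  rewrite [X in _ <= X.-1](cardsD1 x0) x0U /=; apply: subset_leq_card; apply/subsetP => x.
  by rewrite !inE => /andP[-> h]; rewrite eq_sym h.
have [/existsP[e /andP[eQ ce]]|noc] := boolP [exists e in [set e | lab e == Some l], crosses s t S e].
  by exists e.
exfalso; have /set0Pn[x0 x0S] := S0.
have x0U : x0 \in U by apply: (subsetP SU).
have [x1 x1U x1S] : exists2 x1, x1 \in U & x1 \notin S.
  have : ~~ (U \subset S) by apply: contra SnU => US; rewrite eqEsubset SU.
  by move=> /subsetPn[x1 ? ?]; exists x1.
have lt : edge_rank s t (sl Q l) < #|U|.-1.
  pose rep x := if x \in S then x0 else x1.
  have h := edge_rank_le_rep (U := U) (rep := rep) (EUl l) _.
  apply: (leq_ltn_trans (h _)).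
    move=> e; rewrite slQ => eQ; rewrite /rep.
    move: noc; rewrite negb_exists => /forallP/(_ e); rewrite eQ /= /crosses.
    by case: (s e \in S); case: (t e \in S).
  have x01 : x0 != x1 by apply: contraNneq x1S => <-.
  rewrite [X in _ < X.-1](cardsD1 x0) x0U [X in _ < (_ + X).-1](cardsD1 x1) !inE x1U eq_sym x01 /= ltnS.
  apply: subset_leq_card; apply/subsetP => x; rewrite !inE /rep => /andP[-> xr].
  move: xr; case: ifP => xS; rewrite eq_sym => -> //=; rewrite ?andbT.
    by apply: contraNneq x1S => <-.
  by apply: contraFneq xS => ->.
have : f Q < r * #|U|.-1.
  rewrite /f (bigD1 l) //= -[X in _ < X * _]card_ord -sum_nat_const [X in _ < X](bigD1 l) //=.
  by rewrite -addSn leq_add // leq_sum.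
by move: full; clear; lia.
Qed.

End Packing.

(** * Lifting a bipartite graph to one of its sides *)

Definition cut_parity (V X : finType) (s t : X -> V) (Y : {set X}) (S : {set V}) : bool :=
  \big[addb/false]_(e in Y) crosses s t S e.

Lemma addb_bigID (X : finType) (A B : {set X}) (f : X -> bool) :
  \big[addb/false]_(e in (A :\: B) :|: (B :\: A)) f e =
  (\big[addb/false]_(e in A) f e) (+) (\big[addb/false]_(e in B) f e).
Proof.
rewrite !(big_mkcond (fun e => e \in _)) /= -big_split /=; apply: eq_bigr => e _.
by rewrite !inE; case: (e \in A); case: (e \in B); case: (f e).
Qed.

Lemma odd_card_addb (X : finType) (A : {set X}) : odd #|A| = \big[addb/false]_(e in A) true.
Proof. by rewrite -sum1_card (big_morph odd oddD (erefl : odd 0 = false)). Qed.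

Lemma addb_big1 (X : finType) (S : {set X}) (x : X) :
  \big[addb/false]_(v in S) (x == v) = (x \in S).
Proof.
have [xS|xS] := boolP (x \in S).
  by rewrite (bigD1 x) //= eqxx big1 // => v /andP[_ /negPf]; rewrite eq_sym.
by rewrite big1 // => v vS; apply: contraNF xS => /eqP->.
Qed.

Lemma cut_parity_vertices (V X : finType) (s t : X -> V) (Y : {set X}) (S : {set V}) :
  cut_parity s t Y S = \big[addb/false]_(v in S) cut_parity s t Y [set v].
Proof.
rewrite /cut_parity exchange_big /=; apply: eq_bigr => e _.
rewrite /crosses -(addb_big1 S (s e)) -(addb_big1 S (t e)) -big_split /=.
by apply: eq_bigr => v _; rewrite !inE.
Qed.

(** The relation [R x y], that some subset of [J] has odd degree exactly at x and y (nowhere if x =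
    y), propagates along the edges of [J] by symmetric differences and so holds throughout [U]. The
    vertices of [W] are then joined in pairs. *)
Lemma T_join (V X : finType) (s t : X -> V) (U : {set V}) (J : {set X}) (W : {set V}) :
  cut_connected s t U J -> (forall e, e \in J -> s e \in U /\ t e \in U) ->
  W \subset U -> ~~ odd #|W| ->
  exists2 J' : {set X}, J' \subset J & forall v, cut_parity s t J' [set v] = (v \in W).
Proof.
move=> conJ JU.
pose R x y := [exists J' : {set X}, (J' \subset J) &&
   [forall v, cut_parity s t J' [set v] == (v == x) (+) (v == y)]].
have RP x y : reflect (exists2 J' : {set X}, J' \subset J &
   forall v, cut_parity s t J' [set v] = (v == x) (+) (v == y)) (R x y).
  apply: (iffP existsP) => [[J' /andP[h1 /forallP h2]]|[J' h1 h2]]; exists J' => //.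
    by move=> v; apply/eqP.
  by rewrite h1; apply/forallP => v; rewrite h2.
have symd_sub (A B : {set X}) : A \subset J -> B \subset J -> (A :\: B) :|: (B :\: A) \subset J.
  move=> /subsetP AJ /subsetP BJ; apply/subsetP => e; rewrite !inE.
  by case/orP => /andP[_]; [apply: AJ|apply: BJ].
have allR x y : x \in U -> y \in U -> R x y.
  move=> xU yU; pose S := [set z in U | R x z].
  have xS : x \in S.
    rewrite inE xU; apply/RP; exists set0; first exact: sub0set.
    by move=> v; rewrite addbb /cut_parity big_set0.
  suff SU : S == U by have : y \in S; [rewrite (eqP SU)|rewrite inE => /andP[]].
  apply: contraT => SU.
  have [|||e eJ ce] := conJ S; first by apply/subsetP => z; rewrite inE => /andP[].
  - by apply/set0Pn; exists x.
  - by [].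
  have [sU tU] := JU e eJ.
  have step a b : R x a -> (forall v, cut_parity s t [set e] [set v] = (v == a) (+) (v == b)) -> R x b.
    move=> /RP[J' J'J h] hab; apply/RP; exists ((J' :\: [set e]) :|: ([set e] :\: J')).
      by apply: symd_sub => //; rewrite sub1set.
    move=> v; rewrite /cut_parity addb_bigID -!/(cut_parity _ _ _ _) h hab.
    by rewrite addbA; congr (_ (+) _); rewrite -addbA addbb addbF.
  have ce1 v : cut_parity s t [set e] [set v] = (v == s e) (+) (v == t e).
    by rewrite /cut_parity big_set1 /crosses !inE (eq_sym v) [v == t e]eq_sym.
  have ce2 v : cut_parity s t [set e] [set v] = (v == t e) (+) (v == s e).
    by rewrite ce1 addbC.
  move: ce; rewrite /crosses !inE sU tU /=.
  have [Rs|/negPf nRs] := boolP (R x (s e)); first by rewrite (step _ _ Rs ce1).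
  by have [Rt|//] := boolP (R x (t e)); rewrite -nRs (step _ _ Rt ce2).
have [n] := ubnP #|W|; elim: n W => // n IHn W leWn WU oddW.
have [->|/set0Pn[x xW]] := eqVneq W set0.
  by exists set0; rewrite ?sub0set // => v; rewrite /cut_parity big_set0 inE.
have [y] : exists y, y \in W :\ x.
  by apply/set0Pn/eqP => W0; move: oddW; rewrite (cardsD1 x) xW W0 cards0.
rewrite inE => /andP[yx yW]; rewrite inE in yx.
have c2 : #|W| = (#|W :\ x :\ y|).+2.
  by rewrite (cardsD1 x) xW (cardsD1 y (W :\ x)) !inE yW yx.
have [||| J1 J1J h1] := IHn (W :\ x :\ y).
- by move: leWn; rewrite c2; clear; lia.
- by apply: subset_trans WU; apply: subset_trans (subD1set _ _) (subD1set _ _).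
- by move: oddW; rewrite c2 /= negbK.
have /RP[J2 J2J h2] : R x y by apply: allR; apply: (subsetP WU).
exists ((J1 :\: J2) :|: (J2 :\: J1)); first exact: symd_sub.
move=> v; rewrite /cut_parity addb_bigID -!/(cut_parity _ _ _ _) h1 h2 !inE.
have [->|vy] := eqVneq v y; first by rewrite (negPf yx) yW.
by have [->|vx] := eqVneq v x; rewrite ?xW //= addbF.
Qed.

(** The vertices of odd degree in [S] are even in number, hence [J] contains a join of them.
    Evenness is recorded for all cuts because the liftings are controlled through cuts. *)
Lemma even_completion (V X : finType) (s t : X -> V) (U : {set V}) (S J : {set X}) :
  cut_connected s t U J -> (forall e, e \in S :|: J -> s e \in U /\ t e \in U) ->
  [disjoint S & J] ->
  exists2 J' : {set X}, J' \subset J & forall Y, cut_parity s t (S :|: J') Y = false.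
Proof.
move=> conJ SJU dis; pose W := [set v in U | cut_parity s t S [set v]].
have SU e : e \in S -> s e \in U /\ t e \in U by move=> h; apply: SJU; rewrite inE h.
have oddW : ~~ odd #|W|.
  rewrite odd_card_addb big_mkcond /=.
  rewrite (_ : \big[_/_]_v _ = cut_parity s t S U); last first.
    rewrite cut_parity_vertices [RHS]big_mkcond; apply: eq_bigr => v _.
    by rewrite inE; case: (v \in U) => //=; case: (cut_parity _ _ _ _).
  apply/negPf; apply: big1 => e eS; have [sU tU] := SU e eS.
  by rewrite /crosses sU tU.
have JU e : e \in J -> s e \in U /\ t e \in U by move=> h; apply: SJU; rewrite inE h orbT.
have WU : W \subset U by apply/subsetP => v; rewrite inE => /andP[].
have [J' J'J h] := T_join conJ JU WU oddW.
exists J' => // Y.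
have dis' : [disjoint S & J'].
  by rewrite disjoint_sym; apply: disjointWl J'J _; rewrite disjoint_sym.
have one v : cut_parity s t (S :|: J') [set v] = false.
  have -> : S :|: J' = (S :\: J') :|: (J' :\: S).
    by rewrite (setDidPl dis'); rewrite disjoint_sym in dis'; rewrite (setDidPl dis').
  rewrite /cut_parity addb_bigID -!/(cut_parity _ _ _ _) h inE.
  have [vU|vU] := boolP (v \in U); first by rewrite /= addbb.
  rewrite addbF; apply: big1 => e eS; have [sU tU] := SU e eS.
  by rewrite /crosses !inE !(negPf (contraNneq _ vU)) // => <-.
by rewrite cut_parity_vertices big1.
Qed.

(* A triple (a, b, b') stands for the path b - a - b'; lifting it yields the edge bb'. *)
Definition lift_left (V : finType) (c : V * V * V) : V := c.1.2.
Definition lift_right (V : finType) (c : V * V * V) : V := c.2.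

Definition cherry_uses (V : finType) (e : V * V) (c : V * V * V) : bool :=
  (e == (c.1.1, c.1.2)) || (e == (c.1.1, c.2)).

(** Splitting off at [a] in an Eulerian graph, where only connectivity between the vertices of [B]
    has to survive. By [par], the unlifted edges [E] and the lifted ones [C] together have even
    cuts. If two candidates av and aw both fail as partners of au, the sets that witness it meet in
    a set left by au alone, an odd cut. *)
Lemma lift_step (V : finType) (B : {set V}) (E : {set V * V}) (C : {set V * V * V}) (a u : V) :
  (forall e, e \in E -> e.1 \notin B /\ e.2 \in B) ->
  (forall c, c \in C -> c.1.2 \in B /\ c.2 \in B) ->
  (forall Y : {set V}, B :&: Y != set0 -> ~~ (B \subset Y) ->
     [exists e in E, crosses fst snd Y e] || [exists c in C, crosses (@lift_left V) (@lift_right V) Y c]) ->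
  (forall Y, cut_parity fst snd E Y = cut_parity (@lift_left V) (@lift_right V) C Y) ->
  (a, u) \in E ->
  exists v, [/\ v != u, (a, v) \in E &
   forall Y : {set V}, B :&: Y != set0 -> ~~ (B \subset Y) ->
     [|| [exists e in E :\ (a, u) :\ (a, v), crosses fst snd Y e],
      [exists c in C, crosses (@lift_left V) (@lift_right V) Y c] | (u \in Y) (+) (v \in Y)]].
Proof.
move=> EB CB con par auE.
have [aB uB] := EB _ auE; rewrite /= in aB uB.
have Cout c : c \in C -> c.1.2 != a /\ c.2 != a.
  by move=> /CB[c1 c2]; split; apply: contraNneq aB => <-.
have Eout e : e \in E -> e.2 != a.
  by move=> /EB[_ h]; apply: contraNneq aB => <-.
(* a failing pair (u, v) is separated from [a] by a set crossed by the two edges au, av only *)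
pose bad v (Y : {set V}) := [/\ u \in Y, v \in Y, a \notin Y, ~~ (B \subset Y) &
   (forall e, e \in E -> crosses fst snd Y e -> e = (a, u) \/ e = (a, v)) /\
   (forall c, c \in C -> ~~ crosses (@lift_left V) (@lift_right V) Y c)].
have badP v : (a, v) \in E ->
    (forall Y : {set V}, B :&: Y != set0 -> ~~ (B \subset Y) ->
     [|| [exists e in E :\ (a, u) :\ (a, v), crosses fst snd Y e],
      [exists c in C, crosses (@lift_left V) (@lift_right V) Y c] | (u \in Y) (+) (v \in Y)])
    \/ exists Y, bad v Y.
  move=> avE; have [_ vB] := EB _ avE; rewrite /= in vB.
  have [/forallP h|] := boolP [forall Y : {set V}, (B :&: Y != set0) ==> (~~ (B \subset Y)) ==>
     [|| [exists e in E :\ (a, u) :\ (a, v), crosses fst snd Y e],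
      [exists c in C, crosses (@lift_left V) (@lift_right V) Y c] | (u \in Y) (+) (v \in Y)]].
    by left=> Y Y0 YB; have := h Y; rewrite Y0 YB.
  rewrite negb_forall => /existsP[Y]; rewrite !negb_imply !negb_or => /and5P[Y0 YB nE nC uv].
  right.
  have E2 e : e \in E -> crosses fst snd Y e -> e = (a, u) \/ e = (a, v).
    move=> eE ce; have [->|eu] := eqVneq e (a, u); first by left.
    have [->|ev] := eqVneq e (a, v); first by right.
    by move: nE; rewrite negb_exists => /forallP/(_ e); rewrite !inE eE eu ev ce.
  have C2 c : c \in C -> ~~ crosses (@lift_left V) (@lift_right V) Y c.
    by move=> cC; move: nC; rewrite negb_exists => /forallP/(_ c); rewrite cC.
  have := con Y Y0 YB; case/orP => [/existsP[e /andP[eE ce]]|/existsP[c /andP[cC cc]]]; last first.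
    by have := C2 c cC; rewrite cc.
  have aY : (a \in Y) != (u \in Y).
    have := E2 e eE ce; move: ce uv; rewrite /crosses => ce uv [ee|ee]; move: ce; rewrite ee /=;
    by move: uv; case: (a \in Y); case: (u \in Y); case: (v \in Y).
  have [uY|uY] := boolP (u \in Y).
    exists Y; rewrite uY /= in uv aY; split=> //; first by move: uv; case: (v \in Y).
    by move: aY; case: (a \in Y).
  have cC Z (s t : Z -> V) z : (s z \in ~: Y) (+) (t z \in ~: Y) = (s z \in Y) (+) (t z \in Y).
    by rewrite !inE; case: (_ \in Y); case: (_ \in Y).
  rewrite (negPf uY) /= in uv aY.
  exists (~: Y); split; rewrite ?inE //.
  - by move: aY; case: (a \in Y).
  - apply/negP => /subsetP BY; move/set0Pn: Y0 => [b]; rewrite inE => /andP[bB bY].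
    by have := BY b bB; rewrite inE bY.
  split=> [e' e'E|c c'C]; rewrite /crosses cC; [exact: E2|exact: C2].
have auniq (Y : {set V}) : (forall e, e \in E -> crosses fst snd Y e -> e = (a, u)) ->
    crosses fst snd Y (a, u) -> 
    (forall c, c \in C -> ~~ crosses (@lift_left V) (@lift_right V) Y c) -> False.
  move=> h cau cC; have := par Y; rewrite /cut_parity (bigD1 (a, u)) //= cau.
  rewrite big1; last first.
    by move=> e /andP[eE ne]; apply: contraNF ne => ce; rewrite (h e).
  by rewrite big1 // => c h'; apply: negbTE; apply: cC.
have [v vu avE] : exists2 v, v != u & (a, v) \in E.
  have [/existsP[v /andP[h1 h2]]|no] := boolP [exists v, (v != u) && ((a, v) \in E)].
    by exists v.
  exfalso; apply: (auniq [set a]).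
  - move=> [a' v] eE; rewrite /crosses !inE /= (negPf (Eout _ eE)) addbF => /eqP aa; subst a'.
    move: no; rewrite negb_exists => /forallP/(_ v); rewrite eE andbT negbK => /eqP-> //.
  - by rewrite /crosses !inE /= eqxx (negPf (Eout _ auE)).
  - move=> c /Cout[c1 c2]; rewrite /crosses /lift_left /lift_right !inE.
    by rewrite (negPf c1) (negPf c2).
have [ok|[Y [uY vY aY BY [YE YC]]]] := badP v avE; first by exists v.
(* Only au and av leave [Y], and both lie inside [a |: Y]. What leaves the larger set must therefore
   be an edge from [a] to the outside. *)
have [w [awE wY]] : exists w, (a, w) \in E /\ w \notin Y.
  have h1 : B :&: (a |: Y) != set0 by apply/set0Pn; exists u; rewrite !inE uB uY orbT.
  have h2 : ~~ (B \subset a |: Y).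
    move/subsetPn: BY => [b bB bY]; apply/subsetPn; exists b => //; rewrite !inE negb_or bY andbT.
    by apply: contraNneq aB => <-.
  case/orP: (con _ h1 h2) => [/existsP[[a' w] /andP[eE ce]]|/existsP[c /andP[cC cc]]]; last first.
    have := YC c cC; have [c1 c2] := Cout c cC; move: cc; rewrite /crosses /lift_left /lift_right !inE.
    by rewrite (negPf c1) (negPf c2) /= => ->.
  move: ce; rewrite /crosses !inE /= (negPf (Eout _ eE)) /=.
  have [aa|aa] := eqVneq a' a.
    by subst a' => /= h; exists w; split.
  move=> /= h; case: (YE _ eE h) => [[h1' _]|[h1' _]]; by rewrite h1' eqxx in aa.
have wu : w != u by apply: contraNneq wY => ->.
have [ok|[Y2 [uY2 wY2 aY2 BY2 [Y2E Y2C]]]] := badP w awE; first by exists w.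
have vw : v != w by apply: contraNneq wY => <-.
have vY2 : v \notin Y2.
  apply/negP => vY2; have : crosses fst snd Y2 (a, v) by rewrite /crosses /= vY2 (negPf aY2).
  case/(Y2E _ avE) => [[h]|[h]]; first by rewrite h eqxx in vu.
  by rewrite h eqxx in vw.
(* The edge av does not enter the intersection since [v] lies outside [Y2], nor does aw since [w]
   lies outside [Y]. *)
exfalso; apply: (auniq (Y :&: Y2)).
- move=> e eE; rewrite /crosses !inE => ce.
  have : crosses fst snd Y e || crosses fst snd Y2 e.
    by move: ce; rewrite /crosses; case: (e.1 \in Y); case: (e.2 \in Y); case: (e.1 \in Y2); case: (e.2 \in Y2).
  case/orP => h.
    case: (YE _ eE h) => // ee; subst e; move: ce => /=.
    by rewrite (negPf aY) (negPf vY2) andbF.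
  case: (Y2E _ eE h) => // ee; subst e; move: ce => /=.
  by rewrite (negPf aY) (negPf wY).
- by rewrite /crosses !inE /= (negPf aY) uY uY2.
- move=> c cC; move: (YC c cC) (Y2C c cC); rewrite /crosses !inE.
  by case: (_ \in Y); case: (_ \in Y); case: (_ \in Y2); case: (_ \in Y2).
Qed.

(** The invariant of [lift_step] is carried along until no edge is left, so that the edge crossing a
    separating set must be a lifted one. *)
Lemma lift_all (V : finType) (B : {set V}) (E : {set V * V}) (C : {set V * V * V}) :
  (forall e, e \in E -> e.1 \notin B /\ e.2 \in B) ->
  (forall c, c \in C -> c.1.2 \in B /\ c.2 \in B) ->
  (forall c e, c \in C -> e \in E -> ~~ cherry_uses e c) ->
  (forall Y : {set V}, B :&: Y != set0 -> ~~ (B \subset Y) ->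
     [exists e in E, crosses fst snd Y e] || [exists c in C, crosses (@lift_left V) (@lift_right V) Y c]) ->
  (forall Y, cut_parity fst snd E Y = cut_parity (@lift_left V) (@lift_right V) C Y) ->
  exists C' : {set V * V * V},
   [/\ C \subset C',
       forall c, c \in C' :\: C -> [/\ (c.1.1, c.1.2) \in E, (c.1.1, c.2) \in E & c.1.2 != c.2],
       forall e, e \in E -> #|[set c in C' :\: C | cherry_uses e c]| = 1 &
       forall Y : {set V}, B :&: Y != set0 -> ~~ (B \subset Y) ->
         [exists c in C', crosses (@lift_left V) (@lift_right V) Y c]].
Proof.
have [n] := ubnP #|E|; elim: n E C => // n IHn E C leEn EB CB CE con par.
have [E0|/set0Pn[[a u] auE]] := eqVneq E set0.
  exists C; split=> //.
  - by move=> c; rewrite setDv inE.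
  - by move=> e; rewrite E0 inE.
  move=> Y Y0 YB; have /orP[] := con Y Y0 YB => // /existsP[e].
  by rewrite E0 inE.
have [v [vu avE con']] := lift_step EB CB con par auE.
have auv : (a, v) \in E :\ (a, u) by rewrite !inE avE andbT; apply: contraNneq vu => -[->].
set E1 := E :\ (a, u) :\ (a, v) in con'.
have E1E e : e \in E1 -> e \in E by rewrite !inE => /and3P[].
have cau : ~~ ((a, u, v) \in C).
  by apply/negP => cC; have := CE _ _ cC auE; rewrite /cherry_uses /= eqxx.
have [||||||C' [CC' C'E C'1 C'con]] := IHn E1 ((a, u, v) |: C).
- move: leEn; rewrite (cardsD1 (a, u) E) auE (cardsD1 (a, v) (E :\ _)) auv -/E1 !add1n ltnS; apply: ltnW.
- by move=> e /E1E; apply: EB.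
- move=> c; rewrite !inE => /orP[/eqP->|/CB//] /=.
  by have [_ ?] := EB _ auE; have [_ ?] := EB _ avE.
- move=> c e; rewrite in_setU1 => /orP[/eqP->|cC] eE1; last exact: CE cC (E1E _ eE1).
  by move: eE1; rewrite /cherry_uses /= !inE negb_or => /and3P[-> ->].
- move=> Y Y0 YB; have /or3P[->//|/existsP[c /andP[cC cc]]|uv] := con' Y Y0 YB;
  apply/orP; right; apply/existsP.
    by exists c; rewrite in_setU1 cC orbT.
  by exists (a, u, v); rewrite in_setU1 eqxx.
- move=> Y; have parY := par Y; rewrite /cut_parity in parY *.
  rewrite (big_setU1 _ cau) /= -parY (big_setD1 (a, u) auE) /= (big_setD1 (a, v) auv) /= -/E1.
  rewrite /crosses /lift_left /lift_right /=.
  by case: (a \in Y); case: (u \in Y); case: (v \in Y); case: (\big[_/_]_(_ in _) _).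
have auvC' : (a, u, v) \in C' by apply: (subsetP CC'); apply: setU11.
have C'D : C' :\: C = (a, u, v) |: (C' :\: ((a, u, v) |: C)).
  apply/setP => c; rewrite !inE; have [->|_] := eqVneq c (a, u, v) => //=.
  by rewrite auvC' cau.
have new c : c \in C' :\: ((a, u, v) |: C) -> ~~ cherry_uses (a, u) c /\ ~~ cherry_uses (a, v) c.
  by move=> /C'E[h1 h2 _]; move: h1 h2; rewrite /cherry_uses !inE
    => /and3P[/negPf h1 /negPf h2 _] /and3P[/negPf h3 /negPf h4 _]; rewrite !(eq_sym (a, _)) h1 h2 h3 h4.
exists C'; split=> //.
- by apply: subset_trans CC'; apply: subsetUr.
- move=> c; rewrite C'D in_setU1 => /orP[/eqP->|cC] /=; first by rewrite eq_sym.
  by have [h1 h2 h3] := C'E c cC; split=> //; apply: E1E.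
move=> e eE.
have split1 : [set c in C' :\: C | cherry_uses e c] =
  [set c in [set (a, u, v)] | cherry_uses e c] :|: [set c in C' :\: ((a, u, v) |: C) | cherry_uses e c].
  by apply/setP => c; rewrite C'D !inE andb_orl.
have [eau|eau] := boolP ((e == (a, u)) || (e == (a, v))).
  rewrite split1 (_ : [set c in C' :\: _ | _] = set0) ?setU0; last first.
    apply/setP => c; rewrite [LHS]inE in_set0; apply/negP => /andP[/new[/negPf h1 /negPf h2]].
    by case/orP: eau => /eqP->; rewrite ?h1 ?h2.
  rewrite (_ : [set c in _ | _] = [set (a, u, v)]) ?cards1 //.
  apply/setP => c; rewrite !inE; have [->|//] := eqVneq c (a, u, v).
  by rewrite /cherry_uses /= eau.
have eE1 : e \in E1 by move: eau; rewrite negb_or !inE eE => /andP[-> ->].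
rewrite -(C'1 e eE1) split1 (_ : [set c in [set _] | _] = set0) ?set0U //.
apply/setP => c; rewrite !inE; have [->|//] := eqVneq c (a, u, v).
by rewrite /cherry_uses /= (negPf eau).
Qed.

(** Each pair [S i], [J i] yields one connected family on [B]: a part of [J i] makes the degrees of
    [S i] even, and all the edges obtained are lifted. As [S i] reaches all vertices, each [a]
    outside [B] is the centre of some cherry. The pairs being disjoint, the contributions of the [r]
    families add up. *)
Lemma cherries (V : finType) (B : {set V}) (E : {set V * V}) (r : nat) (S J : 'I_r -> {set V * V}) :
  B != set0 ->
  (forall e, e \in E -> e.1 \notin B /\ e.2 \in B) ->
  (forall i, S i \subset E) -> (forall i, J i \subset E) ->
  (forall i j, [disjoint S i & J j]) ->
  (forall i j, i != j -> [disjoint S i & S j] && [disjoint J i & J j]) ->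
  (forall i, cut_connected fst snd setT (S i)) -> (forall i, cut_connected fst snd setT (J i)) ->
  exists C : {set V * V * V},
   [/\ forall c, c \in C -> [/\ (c.1.1, c.1.2) \in E, (c.1.1, c.2) \in E & c.1.2 != c.2],
       forall e c c', c \in C -> c' \in C -> cherry_uses e c -> cherry_uses e c' -> c = c',
       forall Y : {set V}, Y \subset B -> Y != set0 -> Y != B ->
         r <= #|[set c in C | crosses (@lift_left V) (@lift_right V) Y c]| &
       forall a, a \notin B -> r <= #|[set c in C | c.1.1 == a]|].
Proof.
move=> B0 EB SE JE SJ dis Scon Jcon.
have fam i : exists C : {set V * V * V},
   [/\ forall c, c \in C -> [/\ (c.1.1, c.1.2) \in S i :|: J i, (c.1.1, c.2) \in S i :|: J i & c.1.2 != c.2],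
       forall e c c', c \in C -> c' \in C -> cherry_uses e c -> cherry_uses e c' -> c = c',
       forall Y : {set V}, Y \subset B -> Y != set0 -> Y != B ->
         exists2 c, c \in C & crosses (@lift_left V) (@lift_right V) Y c &
       forall a, a \notin B -> exists2 c, c \in C & c.1.1 == a].
  have [J' J'J par] := even_completion (Jcon i) (fun _ _ => conj (in_setT _) (in_setT _)) (SJ i i).
  have SJE : S i :|: J' \subset E by rewrite subUset SE (subset_trans J'J).
  have [|||||C' [_ C'E C'1 C'con]] := @lift_all V B (S i :|: J') set0.
  - by move=> e /(subsetP SJE); apply: EB.
  - by move=> c; rewrite inE.
  - by move=> c e; rewrite inE.
  - move=> Y Y0 YB; apply/orP; left; apply/existsP.
    have [||e eS ce] := Scon i Y (subsetT _).
    - by apply: contra_neq Y0 => ->; rewrite setI0.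
    - by apply: contraNneq YB => ->; apply: subsetT.
    by exists e; rewrite ce inE eS.
  - by move=> Y; rewrite par /cut_parity big_set0.
  rewrite setD0 in C'E C'1.
  have S'SJ e : e \in S i :|: J' -> e \in S i :|: J i.
    by rewrite !inE => /orP[->//|/(subsetP J'J) ->]; rewrite orbT.
  exists C'; split.
  - by move=> c /C'E[h1 h2 h3]; split=> //; apply: S'SJ.
  - move=> e c c' cC cC' uc uc'.
    have eSJ : e \in S i :|: J'.
      by have [h1 h2 _] := C'E c cC; case/orP: uc => /eqP->.
    have /eqP/cards1P[z zz] := C'1 e eSJ.
    have : c \in [set z] by rewrite -zz inE cC.
    have : c' \in [set z] by rewrite -zz inE cC'.
    by rewrite !inE => /eqP-> /eqP->.
  - move=> Y YB Y0 YnB.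
    have [||c /andP[cC cc]] := existsP (C'con Y _ _); last by exists c.
      by rewrite (setIidPr YB).
    by apply: contra YnB => BY; rewrite eqEsubset YB.
  - move=> a aB; have /set0Pn[b bB] := B0.
    have [||e eS ce] := Scon i [set a] (subsetT _).
    - by apply/set0Pn; exists a; rewrite inE.
    - by apply: contraNneq aB => aT; have : b \in [set a]; [rewrite aT inE|rewrite inE => /eqP<-].
    have eS' : e \in S i :|: J' by rewrite inE eS.
    have [e1 e2] := EB _ (subsetP SJE _ eS').
    have /eqP/cards1P[c cz] := C'1 e eS'.
    have : c \in [set c] by rewrite inE.
    rewrite -cz inE => /andP[cC uc]; exists c => //.
    have e2a : e.2 != a by apply: contraNneq aB => <-.
    move: ce; rewrite /crosses !inE (negPf e2a) addbF => /eqP <-.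
    by case/orP: uc => /eqP->.
have {}fam : exists Cf : 'I_r -> {set V * V * V}, forall i,
   [/\ forall c, c \in Cf i -> [/\ (c.1.1, c.1.2) \in S i :|: J i, (c.1.1, c.2) \in S i :|: J i & c.1.2 != c.2],
       forall e c c', c \in Cf i -> c' \in Cf i -> cherry_uses e c -> cherry_uses e c' -> c = c',
       forall Y : {set V}, Y \subset B -> Y != set0 -> Y != B ->
         exists2 c, c \in Cf i & crosses (@lift_left V) (@lift_right V) Y c &
       forall a, a \notin B -> exists2 c, c \in Cf i & c.1.1 == a].
  by have := fin_all_exists fam.
case: fam => Cf CfP.
have SJdis i j e : e \in S i :|: J i -> e \in S j :|: J j -> i = j.
  have [//|ij] := eqVneq i j; have /andP[d1 d2] := dis i j ij.
  rewrite !inE => /orP[] h1 /orP[] h2; exfalso.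
  - by have := disjointFr d1 h1; rewrite h2.
  - by have := disjointFr (SJ i j) h1; rewrite h2.
  - by have := disjointFr (SJ j i) h2; rewrite h1.
  - by have := disjointFr d2 h1; rewrite h2.
have Cdis i j c : c \in Cf i -> c \in Cf j -> i = j.
  have [h _ _ _] := CfP i; have [h' _ _ _] := CfP j.
  by move=> /h[k _ _] /h'[k' _ _]; apply: SJdis k k'.
have count (P : pred (V * V * V)) : (forall i, exists2 c, c \in Cf i & P c) ->
    r <= #|[set c in \bigcup_i Cf i | P c]|.
  move=> h; have {}h i : exists c, (c \in Cf i) && P c by have [c c1 c2] := h i; exists c; rewrite c1.
  have [f fP] := fin_all_exists h.
  have finj : injective f.
    move=> i j fij; have /andP[h1 _] := fP i; have /andP[h2 _] := fP j.
    by rewrite fij in h1; apply: Cdis h1 h2.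
  rewrite -[r in X in X <= _]card_ord -(card_imset predT finj).
  apply: subset_leq_card; apply/subsetP => c /imsetP[i _ ->]; rewrite inE.
  by have /andP[h1 ->] := fP i; rewrite andbT; apply/bigcupP; exists i.
exists (\bigcup_i Cf i); split.
- move=> c /bigcupP[i _ cC]; have [h _ _ _] := CfP i; have [h1 h2 h3] := h c cC.
  split=> //; [move: h1|move: h2]; rewrite inE => /orP[];
  by [apply: (subsetP (SE i))|apply: (subsetP (JE i))].
- move=> e c c' /bigcupP[i _ cC] /bigcupP[j _ cC'] uc uc'.
  have [hi hu _ _] := CfP i; have [hj _ _ _] := CfP j.
  have [h1 h2 _] := hi c cC; have [h1' h2' _] := hj c' cC'.
  have ij : i = j.
    apply: (SJdis _ _ e).
      by case/orP: uc => /eqP->.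
    by case/orP: uc' => /eqP->.
  by subst j; apply: hu uc uc'.
- move=> Y YB Y0 YnB; apply: count => i; have [_ _ h _] := CfP i; exact: h.
- move=> a aB; apply: count => i; have [_ _ _ h] := CfP i; exact: h.
Qed.

(** * Orientations with out-degrees prescribed modulo k *)

Lemma exists_residue (k c a b : nat) : 0 < k ->
  exists2 p, c <= p < c + k & p + a = b %[mod k].
Proof.
move=> k0; exists (c + (b + (k - (a + c) %% k)) %% k).
  by rewrite leq_addr ltn_add2l ltn_mod.
rewrite addnAC modnDmr addnA [c + a + b]addnC -addnA -modnDmr.
have -> : c + a + (k - (a + c) %% k) = k * ((a + c) %/ k).+1.
  rewrite addnC (addnC c) {2}(divn_eq (a + c) k).
  have := ltn_pmod (a + c) k0; move: ((a + c) %% k) ((a + c) %/ k) => u v uk.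
  by rewrite addnC -addnA subnKC ?(ltnW uk) // mulnS mulnC addnC.
by rewrite modnMr addn0.
Qed.

Section Orientation.
Variables (V X : finType).
Implicit Types (s t : X -> V) (U A : {set V}) (E : {set X}) (o : X -> bool).

Definition out_degree s t o E x : nat := \sum_(e in E) ((if o e then s e else t e) == x).
Definition cut_size s t E A : nat := \sum_(e in E) crosses s t A e.

Definition orientable (k : nat) s t U E (ho po : V -> nat) : Prop :=
  exists o, forall x, x \in U -> ho x + out_degree s t o E x = po x %[mod k].

(* [ho x] and [hi x] count arcs from [x] to, resp. into [x] from, a vertex that has been
   removed after its edges were oriented; [po] and [pi] are the target degrees, those arcs included. *)
Definition admissible (c k M : nat) s t U E (ho hi po pi : V -> nat) : Prop :=
  [/\ forall e, e \in E -> [/\ s e \in U, t e \in U & s e != t e],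
      forall x, x \in U -> [/\ po x + pi x = cut_size s t E [set x] + ho x + hi x, c <= po x & c <= pi x],
      forall A, A \subset U -> 1 < #|A| -> A != U ->
        2 * c + k <= cut_size s t E A + \sum_(x in A) (ho x + hi x),
      \sum_(x in U) (ho x + hi x) <= M &
      \sum_(x in U) po x = #|E| + \sum_(x in U) ho x %[mod k]].

Lemma sum_eq_mem A (z : V) : \sum_(x in A) (z == x) = (z \in A) :> nat.
Proof.
have [zA|zA] := boolP (z \in A).
  by rewrite (bigD1 z) //= eqxx big1 ?addn0 // => x /andP[_ /negPf]; rewrite eq_sym => ->.
by rewrite big1 // => x xA; case: eqP => // zx; rewrite zx xA in zA.
Qed.

Lemma cut_size1 s t E x : (forall e, e \in E -> s e != t e) ->
  cut_size s t E [set x] = \sum_(e in E) ((s e == x) + (t e == x)).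
Proof.
move=> nl; apply: eq_bigr => e eE; rewrite /crosses !inE.
by have ne := nl e eE; case: (s e =P x) => sx; case: (t e =P x) => tx //; rewrite sx tx eqxx in ne.
Qed.

Lemma out_degree_flip s t o E x : (forall e, e \in E -> s e != t e) ->
  out_degree s t (fun e => ~~ o e) E x + out_degree s t o E x = cut_size s t E [set x].
Proof.
move=> nl; rewrite (cut_size1 _ nl) -big_split; apply: eq_bigr => e _ /=.
by case: (o e) => //=; rewrite addnC.
Qed.

Lemma sum_out_degree s t o E U : (forall e, e \in E -> s e \in U /\ t e \in U) ->
  \sum_(x in U) out_degree s t o E x = #|E|.
Proof.
move=> EU; rewrite exchange_big /= -sum1_card; apply: eq_bigr => e eE.
by rewrite sum_eq_mem; have [h1 h2] := EU e eE; case: (o e); rewrite ?h1 ?h2.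
Qed.

Lemma sum_cut_size s t E U : (forall e, e \in E -> [/\ s e \in U, t e \in U & s e != t e]) ->
  \sum_(x in U) cut_size s t E [set x] = #|E| + #|E|.
Proof.
move=> EU; rewrite -{1}(@sum_out_degree s t (fun=> true) E U); last by move=> e /EU[].
rewrite -(@sum_out_degree s t (fun=> false) E U) -?big_split; last by move=> e /EU[].
by apply: eq_bigr => x _; rewrite -(@out_degree_flip s t (fun=> false)) // => e /EU[].
Qed.

(** Reversal of all arcs. The congruence for the in-degrees follows because the two totals together
    count each edge twice and each old arc once. *)
Lemma admissible_swap c k M s t U E ho hi po pi :
  admissible c k M s t U E ho hi po pi -> admissible c k M s t U E hi ho pi po.
Proof.
case=> EU deg big hM tot; split=> //.
- by move=> x xU; have [h1 h2 h3] := deg x xU; split=> //; rewrite addnC h1 addnAC.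
- by move=> A AU A1 AnU; rewrite (eq_bigr (fun x => ho x + hi x)) ?big // => x _; rewrite addnC.
- by rewrite (eq_bigr (fun x => ho x + hi x)) // => x _; rewrite addnC.
have key : \sum_(x in U) po x + \sum_(x in U) pi x =
    #|E| + #|E| + (\sum_(x in U) ho x + \sum_(x in U) hi x).
  rewrite -(sum_cut_size EU) -!big_split; apply: eq_bigr => x xU /=.
  by have [-> _ _] := deg x xU; rewrite addnA.
apply/eqP; rewrite -(eqn_modDl (\sum_(x in U) po x)) key -[in X in _ == X]modnDml tot modnDml.
by apply/eqP; congr (_ %% _); clear; lia.
Qed.

Lemma orientable_swap c k M s t U E ho hi po pi :
  admissible c k M s t U E ho hi po pi ->
  orientable k s t U E hi pi -> orientable k s t U E ho po.
Proof.
case=> EU deg _ _ _ [o oP]; exists (fun e => ~~ o e) => x xU.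
have [dx _ _] := deg x xU; have ox := oP x xU.
apply/eqP; rewrite -(eqn_modDr (pi x)) dx -modnDmr -ox modnDmr -(@out_degree_flip s t o E x).
  by apply/eqP; congr (_ %% _); clear; lia.
by move=> e /EU[].
Qed.

Lemma card_subset_eq (Y : finType) (E : {set Y}) n : n <= #|E| ->
  exists2 D : {set Y}, D \subset E & #|D| = n.
Proof.
move=> nE; exists [set x in take n (enum E)].
  by apply/subsetP => x; rewrite inE => /mem_take; rewrite mem_enum.
rewrite cardsE (card_uniqP _) ?take_uniq ?enum_uniq // size_take -cardE.
by case: ltngtP nE.
Qed.

(** Any number [j < k] of edges can be made to leave x, since there are at least [k] of them; the
    residue at y is then forced by the total. *)
Lemma orientable_two k s t U E ho po : 0 < k ->
  #|U| = 2 -> k <= #|E| -> (forall e, e \in E -> [/\ s e \in U, t e \in U & s e != t e]) ->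
  \sum_(x in U) po x = #|E| + \sum_(x in U) ho x %[mod k] ->
  orientable k s t U E ho po.
Proof.
move=> k0 /eqP/cards2P[x [y [xy ->]]] kE EU tot.
have [j /andP[_ jk] jP] := exists_residue 0 (ho x) (po x) k0; rewrite add0n in jk.
have [D DE Dj] := card_subset_eq (leq_trans (ltnW jk) kE).
pose o e := (s e == x) == (e \in D).
have tail e : e \in E -> (if o e then s e else t e) = if e \in D then x else y.
  move=> eE; have [] := EU e eE; rewrite /o !inE.
  case: (s e =P x) => [->|sx] /=; case: (t e =P x) => [->|tx] //=; rewrite ?eqxx //.
  - by move=> _ /eqP-> _; case: (e \in D).
  - by move=> /eqP-> _ _; case: (e \in D).
  - by move=> /eqP-> /eqP->; rewrite eqxx.
have ox : out_degree s t o E x = j.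
  rewrite /out_degree -Dj -sum1_card big_mkcond [RHS]big_mkcond; apply: eq_bigr => e _.
  have [eD|eD] := boolP (e \in D); first by rewrite (subsetP DE) // tail ?(subsetP DE) // eD eqxx.
  by case: ifP => // eE; rewrite tail // (negPf eD) eq_sym (negPf xy).
have ohx : ho x + out_degree s t o E x = po x %[mod k] by rewrite ox addnC.
exists o => z; rewrite !inE => /orP[/eqP->//|/eqP->].
move/eqP: tot; rewrite !big_setU1 ?inE //= !big_set1 -(@sum_out_degree s t o E [set x; y]); last first.
  by move=> e /EU[].
rewrite big_setU1 ?inE //= big_set1 -modnDml -ohx modnDml => h.
apply/esym/eqP; rewrite -(eqn_modDl (ho x + out_degree s t o E x)).
by move: h; congr (_ == _ %[mod _]); clear; lia.
Qed.

End Orientation.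

(** * Contraction of a set and elimination of a vertex *)

Section Contraction.
Variables (V X : finType) (c k M : nat) (s t : X -> V) (U : {set V}) (E : {set X}).
Variables (ho hi po pi : V -> nat) (A : {set V}).
Hypotheses (k_gt0 : 0 < k) (adm : admissible c k M s t U E ho hi po pi).
Hypotheses (AU : A \subset U) (A1 : 1 < #|A|) (AnU : A != U).

Let EA := [set e in E | (s e \in A) && (t e \in A)].

Hypothesis outer : forall (s' t' : X -> V) (U' : {set V}) (E' : {set X}) (ho' hi' po' pi' : V -> nat),
  admissible c k M s' t' U' E' ho' hi' po' pi' -> 1 < #|U'| -> #|U'| + #|E'| < #|U| + #|E| ->
  orientable k s' t' U' E' ho' po'.

Hypothesis inner : forall ho' hi' : V -> nat,
  (forall Y : {set V}, Y \subset A -> cut_size s t EA Y + \sum_(x in Y) (ho' x + hi' x) =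
     cut_size s t E Y + \sum_(x in Y) (ho x + hi x)) ->
  \sum_(x in A) po x = #|EA| + \sum_(x in A) ho' x %[mod k] ->
  orientable k s t A EA ho' po.

(** The contraction of [A] to a vertex [a] is oriented by [outer], which is the induction
    hypothesis. How the inside is then oriented is left to [inner], because contraction serves two
    cases: sets with a small cut and pairs of vertices joined by many edges. *)
Lemma orientable_contract : orientable k s t U E ho po.
Proof.
case: (adm) => EU deg big hM tot.
have [a aA] : exists a, a \in A by apply/card_gt0P; apply: ltn_trans A1.
have aU : a \in U := subsetP AU a aA.
pose cs v := if v \in A then a else v.
pose E1 := E :\: EA.
pose U1 := a |: (U :\: A).
pose up (Y : {set V}) := if a \in Y then Y :|: A else Y.
pose coll (h : V -> nat) x := if x == a then \sum_(y in A) h y else h x.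
have EAE : EA \subset E by apply/subsetP => e; rewrite inE => /andP[].
have aUA : a \notin U :\: A by rewrite inE aA.
have upU (Y : {set V}) : Y \subset U1 -> up Y \subset U.
  move=> /subsetP YU1; have YU : Y \subset U.
    by apply/subsetP => x /YU1; rewrite !inE => /orP[/eqP->//|/andP[]].
  by rewrite /up; case: ifP => // _; rewrite subUset YU.
have memcs (Y : {set V}) v : Y \subset U1 -> v \in U -> (cs v \in Y) = (v \in up Y).
  move=> /subsetP YU1 vU; rewrite /cs /up; have [vA|vA] := boolP (v \in A).
    case: ifP => aY; first by rewrite inE vA orbT.
    apply/esym/negbTE; apply: contraFN aY => vY.
    by have := YU1 v vY; rewrite !inE vA /= orbF => /eqP <-.
  by case: ifP => // _; rewrite inE (negPf vA) orbF.
have sumcoll (h : V -> nat) (Y : {set V}) : Y \subset U1 -> \sum_(x in Y) coll h x = \sum_(x in up Y) h x.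
  move=> /subsetP YU1; have nA x : x \in Y -> x != a -> x \notin A.
    by move=> /YU1; rewrite !inE => /orP[/eqP->|/andP[]//]; rewrite eqxx.
  rewrite /up; have [aY|aY] := boolP (a \in Y).
    rewrite (bigID (mem A)) /= (bigD1 a) /=; last by rewrite aY aA.
    rewrite big1 ?addn0; last first.
      by move=> x /andP[/andP[xY xA] xa]; have := nA x xY xa; rewrite xA.
    rewrite /coll eqxx [RHS](bigID (mem A)) /=; congr (_ + _).
      apply: eq_bigl => x; rewrite inE; case: (x \in A); rewrite ?orbT ?andbF //.
    rewrite (eq_bigl (fun x => (x \in Y :|: A) && (x \notin A))); last first.
      by move=> x; rewrite inE; case: (x \in A); rewrite ?orbF ?andbF.
    by apply: eq_bigr => x /andP[_ xA]; case: eqP => // xa; rewrite xa aA in xA.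
  by apply: eq_bigr => x xY; rewrite /coll; case: eqP => // xa; rewrite -xa xY in aY.
have cutcs (Y : {set V}) : Y \subset U1 -> cut_size (cs \o s) (cs \o t) E1 Y = cut_size s t E (up Y).
  move=> YU1; rewrite /cut_size [RHS](bigID (mem EA)) /= [in RHS]big1 ?add0n; last first.
    move=> e /andP[eE]; rewrite inE => /and3P[_ sA tA]; have [sU tU _] := EU e eE.
    by rewrite /crosses -!memcs // /cs sA tA addbb.
  rewrite (eq_bigl (fun e => (e \in E) && (e \notin EA))); last by move=> e; rewrite inE andbC.
  by apply: eq_bigr => e /andP[eE _]; have [sU tU _] := EU e eE; rewrite /crosses /= !memcs.
have U1U : U1 \subset U.
  by apply/subsetP => x; rewrite !inE => /orP[/eqP->//|/andP[]].
have upa : up [set a] = A by rewrite /up inE eqxx; apply/setUidPr; rewrite sub1set.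
have upx x : x != a -> up [set x] = [set x] by rewrite /up inE eq_sym => /negPf->.
have upU1 : up U1 = U.
  rewrite /up !inE eqxx /=; apply/setP => x; rewrite !inE.
  have [->|_] := eqVneq x a; first by rewrite aU.
  by case: (boolP (x \in A)) => xA /=; [rewrite (subsetP AU)|rewrite orbF].
have collD x : coll (fun x => ho x + hi x) x = coll ho x + coll hi x.
  by rewrite /coll; case: eqP => // _; rewrite big_split.
(* The total over [A] determines the target of [a] modulo [k]. Taken with c <= pa < c + k, it leaves
   an in-degree of at least [c], as the cut with its old arcs has size at least 2c + k: this is the
   origin of that bound in [admissible]. *)
have [pa /andP[pac pack] paP] := exists_residue c #|EA| (\sum_(x in A) po x) k_gt0.
have bigA := big A AU A1 AnU.
set dA := cut_size s t E A + _ in bigA.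
pose po1 x := if x == a then pa else po x.
pose pi1 x := if x == a then dA - pa else pi x.
have cEA : #|E| = #|EA| + #|E1| by rewrite -(cardsID EA E) (setIidPr EAE).
have po1U : \sum_(x in U1) po1 x = pa + \sum_(x in U :\: A) po x.
  rewrite /U1 big_setU1 //= /po1 eqxx; congr (_ + _); apply: eq_bigr => x xUA.
  by case: eqP => // xa; rewrite -xa xUA in aUA.
have sumUA (h : V -> nat) : \sum_(x in U) h x = \sum_(x in A) h x + \sum_(x in U :\: A) h x.
  rewrite (bigID (mem A)) /=; congr (_ + _); apply: eq_bigl => x; last by rewrite inE andbC.
  by case: (boolP (x \in A)) => xA; rewrite ?andbF // (subsetP AU).
have adm1 : admissible c k M (cs \o s) (cs \o t) U1 E1 (coll ho) (coll hi) po1 pi1.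
  split.
  - move=> e; rewrite !inE => /andP[nEA eE]; rewrite eE /= in nEA.
    have [sU tU st] := EU e eE; rewrite /= /cs.
    move: nEA; case: (boolP (s e \in A)) => sA; case: (boolP (t e \in A)) => tA //= _;
      rewrite ?eqxx ?sU ?tU ?sA ?tA ?orbT; split=> //.
    + by apply: contraNneq tA => <-.
    + by apply: contraNneq sA => ->.
  - move=> x; rewrite in_setU1 => /orP[/eqP->|xUA].
      rewrite /po1 /pi1 eqxx cutcs ?sub1set ?setU11 // upa /coll eqxx -addnA -big_split /=.
      by rewrite -/dA; split=> //; [rewrite subnKC //|]; move: bigA pac pack; clear; lia.
    have xa : x != a by apply: contraNneq aUA => <-.
    have [xA xU] : x \notin A /\ x \in U by move: xUA; rewrite inE => /andP[].
    have [h1 h2 h3] := deg x xU.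
    by rewrite /po1 /pi1 (negPf xa) cutcs ?upx // /coll ?(negPf xa) // sub1set !inE xA xU orbT.
  - move=> Y YU1 Y1 YnU1; rewrite cutcs // (eq_bigr (coll (fun x => ho x + hi x))); last first.
      by move=> x _; rewrite collD.
    rewrite sumcoll //; apply: big; first exact: upU.
      by apply: leq_trans Y1 _; apply: subset_leq_card; rewrite /up; case: ifP => _ //; apply: subsetUl.
    apply: contra YnU1 => /eqP upYU; rewrite eqEsubset YU1; apply/subsetP => x xU1.
    have := memcs Y x YU1 (subsetP U1U x xU1); rewrite upYU (subsetP U1U) //.
    rewrite /cs; case: (boolP (x \in A)) => xA xY; last by rewrite xY.
    by move: xU1; rewrite !inE xA orbF => /eqP->; rewrite xY.
  - rewrite (eq_bigr (coll (fun x => ho x + hi x))); last by move=> x _; rewrite collD.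
    by rewrite sumcoll // upU1.
  - rewrite sumcoll // upU1; apply/eqP; rewrite -(eqn_modDr #|EA|) po1U.
    rewrite addnAC -modnDml paP modnDml -sumUA tot cEA.
    by apply/eqP; congr (_ %% _); clear; lia.
have U1card : #|U1| < #|U| /\ 1 < #|U1|.
  rewrite cardsU1 aUA; have := cardsID A U; rewrite (setIidPr AU).
  have : 0 < #|U :\: A|.
    rewrite card_gt0; apply: contra AnU => /eqP h; rewrite eqEsubset AU.
    by rewrite /= -setD_eq0 h eqxx.
  by move: A1; clear; rewrite /=; move: #|U :\: A| #|A| #|U| => x y z; lia.
have [o1 o1P] : orientable k (cs \o s) (cs \o t) U1 E1 (coll ho) po1.
  case: U1card => c1 c2; apply: outer adm1 c2 _.
  by rewrite cEA; move: c1; clear; move: #|U1| #|U| => x y; lia.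
(* Seen from inside [A], the edges of the boundary, now oriented, are old arcs at their inner
   ends. *)
pose ho2 x := ho x + out_degree s t o1 E1 x.
pose hi2 x := hi x + out_degree s t (fun e => ~~ o1 e) E1 x.
have E1P e : e \in E1 -> [/\ e \in E, s e \in U, t e \in U, s e != t e & ~~ ((s e \in A) && (t e \in A))].
  by rewrite !inE => /andP[h eE]; have [h1 h2 h3] := EU e eE; rewrite eE in h.
have E1nl e : e \in E1 -> s e != t e by move=> /E1P[].
have inY (Y : {set V}) : Y \subset A -> cut_size s t EA Y + \sum_(x in Y) (ho2 x + hi2 x) =
     cut_size s t E Y + \sum_(x in Y) (ho x + hi x).
  move=> YA; rewrite [X in _ = X + _](_ : _ = cut_size s t EA Y + cut_size s t E1 Y); last first.
    rewrite /cut_size (bigID (mem EA)) /=; congr (_ + _); apply: eq_bigl => e; last by rewrite !inE andbC.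
    by case: (boolP (e \in EA)) => eA; rewrite ?andbF // (subsetP EAE).
  rewrite -addnA; congr (_ + _).
  rewrite (eq_bigr (fun x => (ho x + hi x) + cut_size s t E1 [set x])); last first.
    by move=> x _; rewrite -(out_degree_flip o1 x E1nl) /ho2 /hi2; clear; lia.
  rewrite big_split /= addnC; congr (_ + _).
  rewrite exchange_big /=; apply: eq_bigr => e eE1.
  have [_ _ _ st nA] := E1P e eE1.
  rewrite (eq_bigr (fun x => (s e == x) + (t e == x))); last first.
    move=> x _; rewrite /crosses !inE; case: (s e =P x) => sx; case: (t e =P x) => tx //.
    by rewrite sx tx eqxx in st.
  rewrite big_split /= !sum_eq_mem /crosses.
  case: (boolP (s e \in Y)) => sY; case: (boolP (t e \in Y)) => tY //.
  by move: nA; rewrite !(subsetP YA).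
have [o2 o2P] : orientable k s t A EA ho2 po.
  apply: (inner inY).
  have := o1P a (setU11 _ _); rewrite /po1 /coll eqxx => o1a.
  rewrite -paP -modnDml -o1a modnDml.
  suff -> : \sum_(x in A) ho2 x = \sum_(x in A) ho x + out_degree (cs \o s) (cs \o t) o1 E1 a.
    by congr (_ %% _); rewrite addnC.
  rewrite big_split /=; congr (_ + _).
  rewrite exchange_big /=; apply: eq_bigr => e eE1; have [_ _ _ _ nA] := E1P e eE1.
  rewrite sum_eq_mem /= /cs.
  by case: (o1 e); [case: ifP|case: ifP] => h; rewrite ?eqxx //; case: eqP => // h'; rewrite -h' in aA; rewrite aA in h.
exists (fun e => if e \in EA then o2 e else o1 e) => x xU.
have outE : out_degree s t (fun e => if e \in EA then o2 e else o1 e) E x =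
    out_degree s t o2 EA x + out_degree s t o1 E1 x.
  rewrite /out_degree (bigID (mem EA)) /=; congr (_ + _).
    rewrite (eq_bigl (mem EA)); last first.
      by move=> e /=; case: (boolP (e \in EA)) => eA; rewrite ?andbF // (subsetP EAE).
    by apply: eq_bigr => e eA; have -> : e \in EA by [].
  rewrite (eq_bigl (mem E1)); last by move=> e; rewrite /= !inE andbC.
  by apply: eq_bigr => e eE1; have : e \in E1 by []; rewrite inE => /andP[/negPf->].
rewrite outE; have [xA|xA] := boolP (x \in A).
  by rewrite -o2P // /ho2; congr (_ %% _); clear; lia.
have xa : x != a by apply: contraNneq xA => ->.
have := o1P x; rewrite /coll /po1 (negPf xa) => <-; last by rewrite !inE xA xU orbT.
congr (_ %% _); congr (_ + _).
rewrite /out_degree [X in X + _]big1 ?add0n; last first.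
  move=> e; rewrite inE => /and3P[_ sA tA]; case: (o2 e); case: eqP => // h.
    by rewrite h (negPf xA) in sA.
  by rewrite h (negPf xA) in tA.
apply: eq_bigr => e _ /=; rewrite /cs.
by case: (o1 e); case: ifP => // h; rewrite ![a == x]eq_sym (negPf xa); case: eqP => // h'; move: h; rewrite h' (negPf xA).
Qed.

End Contraction.

(* [lia] with every bigop abstracted *)
Ltac slia := clear; rewrite /=;
  repeat match goal with |- context [@bigop.body ?R ?I ?i ?r ?F] =>
    generalize (@bigop.body R I i r F); intro end; lia.

Lemma sum_setD1 (X : finType) (E : {set X}) (e : X) (F : X -> nat) : e \in E ->
  \sum_(i in E) F i = F e + \sum_(i in E :\ e) F i.
Proof. exact: big_setD1. Qed.

Lemma big_set_filter (X : finType) (E : {set X}) (P : pred X) (F : X -> nat) :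
  \sum_(e in [set e in E | P e]) F e = \sum_(e in E) P e * F e.
Proof.
rewrite big_mkcond [RHS]big_mkcond; apply: eq_bigr => e _; rewrite inE.
by case: (e \in E) => //=; case: (P e); rewrite ?mul1n.
Qed.

Lemma card_set_filter (X : finType) (E : {set X}) (P : pred X) :
  #|[set e in E | P e]| = \sum_(e in E) P e.
Proof. by rewrite -sum1_card big_set_filter; apply: eq_bigr => e _; rewrite muln1. Qed.

Section LiftVertex.
Variables (V X : finType).
Implicit Types (s t : X -> V) (U A : {set V}) (E : {set X}) (o : X -> bool).

(** The outcome of lifting all ends at [x] in pairs. By the last clause each orientation of the new
    graph comes from one of the old graph in which [x] has out-degree exactly [r], old arcs
    included. In the third clause the edges at [x] are given up, since nothing is known about how
    they were paired. *)
Definition lifted r s t U E (ho hi : V -> nat) x s' t' E' (ho' hi' : V -> nat) : Prop :=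
  [/\ forall e, e \in E' -> [/\ s' e \in U :\ x, t' e \in U :\ x & s' e != t' e],
      forall y, y \in U :\ x -> cut_size s' t' E' [set y] + ho' y + hi' y =
        cut_size s t E [set y] + ho y + hi y,
      forall A, A \subset U :\ x ->
        cut_size s t [set e in E | s e != x] A + \sum_(y in A) (ho y + hi y) <=
        cut_size s' t' E' A + \sum_(y in A) (ho' y + hi' y),
      [/\ \sum_(y in U :\ x) (ho' y + hi' y) = \sum_(y in U) (ho y + hi y),
          #|E'| + \sum_(y in U :\ x) ho' y + r = #|E| + \sum_(y in U) ho y & #|E'| <= #|E|] &
      forall o', exists2 o, ho x + out_degree s t o E x = r &
        forall y, y \in U :\ x ->
          ho y + out_degree s t o E y = ho' y + out_degree s' t' o' E' y].

(** Each step merges two edges xu, xw with u different from w into uw, or an edge xu with an old arc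
    at [x], which becomes an old arc at u; either way one arc leaves [x] and one enters. Neither the
    old arcs nor the edges to a single neighbour exceed half of the degree. This is maintained by
    using an old arc exactly when the old arcs make up half, and otherwise an edge to the most
    frequent neighbour. *)
Lemma lift_vertex r s t U E ho hi x : x \in U ->
  (forall e, e \in E -> [/\ s e \in U, t e \in U & s e != t e]) ->
  (forall e, e \in E -> t e != x) ->
  \sum_(e in E) (s e == x) + ho x + hi x = 2 * r -> ho x + hi x <= r ->
  (forall y, #|[set e in E | (s e == x) && (t e == y)]| <= r) ->
  exists s' t' E' ho' hi', lifted r s t U E ho hi x s' t' E' ho' hi'.
Proof.
move=> xU; elim: r s t E ho hi => [|r IHr] s t E ho hi EU tx deg hr mult.
  have hx0 : ho x = 0 /\ hi x = 0 by move: hr; clear; lia.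
  have sx e : e \in E -> s e != x.
    move=> eE; apply/negP => sx; move: deg.
    by rewrite (sum_setD1 _ eE) sx; clear; lia.
  have Ex : [set e in E | s e != x] = E.
    by apply/setP => e; rewrite inE; case: (boolP (e \in E)) => //= /sx.
  have dU (h : V -> nat) : h x = 0 -> \sum_(y in U) h y = \sum_(y in U :\ x) h y.
    by move=> h0; rewrite (big_setD1 x) //= h0.
  exists s, t, E, ho, hi; split=> //.
  - by move=> e eE; have [h1 h2 h3] := EU e eE; rewrite !inE h1 h2 sx // tx.
  - by move=> A AU; rewrite Ex.
  - by case: hx0 => h1 h2; split=> //; rewrite [in RHS]dU ?h1 ?h2 ?addn0.
  move=> o'; exists o' => //; rewrite /out_degree big1; first by case: hx0 => ->.
  by move=> e eE; case: (o' e); rewrite ?(negPf (sx _ eE)) ?(negPf (tx _ eE)).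
pose Ex := [set e in E | s e == x].
have cEx : #|Ex| + ho x + hi x = 2 * r.+1.
  by rewrite -deg; congr (_ + _ + _); rewrite -sum1_card big_mkcond [RHS]big_mkcond;
  apply: eq_bigr => e _; rewrite inE; case: (e \in E) => //=; case: (s e == x).
have sumU (h : V -> nat) : \sum_(y in U) h y = h x + \sum_(y in U :\ x) h y by rewrite (big_setD1 x).
have nx y : y \in U :\ x -> (x == y) = false /\ (y == x) = false.
  by rewrite !inE => /andP[/negPf h _]; rewrite [x == y]eq_sym h.
have [hr1|hr1] := eqVneq (ho x + hi x) r.+1.
  have cr : #|Ex| = r.+1 by move: cEx hr1; clear; lia.
  have [e eEx] : exists e, e \in Ex by apply/card_gt0P; rewrite cr.
  have [eE sx] : e \in E /\ s e = x by move: eEx; rewrite inE => /andP[-> /eqP->].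
  have [_ uU xu] := EU e eE; set u := t e in uU xu; rewrite sx in xu.
  have uUx : u \in U :\ x by rewrite !inE uU eq_sym xu.
  have E2E f : f \in E :\ e -> f \in E by rewrite inE => /andP[].
  (* Hands one old arc of [x] over to [u]. *)
  pose up (h : V -> nat) y := h y + (y == u) - (y == x).
  have upx (h : V -> nat) : (up h x).+1 = (h x).-1.+1 by rewrite /up eqxx (negPf xu) addn0 subn1.
  have upy (h : V -> nat) y : y \in U :\ x -> up h y = h y + (y == u).
    by move=> /nx[_ h2]; rewrite /up h2 subn0.
  have upU (h : V -> nat) : \sum_(y in U :\ x) up h y = (\sum_(y in U :\ x) h y).+1.
    rewrite (eq_bigr (fun y => h y + (u == y))); last by move=> y yU; rewrite upy // eq_sym.
    by rewrite big_split /= sum_eq_mem uUx addn1.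
  have deg2 : \sum_(f in E :\ e) (s f == x) + (ho x + hi x) = (2 * r).+1.
    by move: deg; rewrite (sum_setD1 _ eE) sx eqxx; clear; lia.
  have mult2 y : #|[set f in E :\ e | (s f == x) && (t f == y)]| <= r.
    rewrite -ltnS -cr (cardsD1 e Ex) eEx add1n ltnS; apply: subset_leq_card; apply/subsetP => f.
    by rewrite !inE => /andP[/andP[-> ->] /andP[-> _]].
  have cutE (A : {set V}) : x \notin A -> cut_size s t E A = cut_size s t (E :\ e) A + (u \in A).
    by move=> xA; rewrite /cut_size (sum_setD1 _ eE) /crosses sx (negPf xA) addnC.
  have cutnx (A : {set V}) :
      cut_size s t [set f in E :\ e | s f != x] A = cut_size s t [set f in E | s f != x] A.
    apply: eq_bigl => f; rewrite !inE; case: (eqVneq f e) => [->|//].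
    by rewrite sx eqxx !andbF.
  have cE : #|E| = #|E :\ e|.+1 by rewrite (cardsD1 e) eE.
  (* An old out-arc of [x] prolongs an arc from [u] to [x], so [e] is directed away from [u]; an old
     in-arc, in the second case, is prolonged from [x] to [u]. *)
  have [ho0|ho0] := posnP (ho x); last first.
    have [|||||s' [t' [E' [ho' [hi' [L1 L2 L3 [L4 L5 L5'] L6]]]]]] := IHr s t (E :\ e) (up ho) hi.
    - by move=> f /E2E; apply: EU.
    - by move=> f /E2E; apply: tx.
    - by have := upx ho; move: ho0 deg2 hr1; clear; lia.
    - by have := upx ho; move: ho0 hr1; clear; lia.
    - exact: mult2.
    exists s', t', E', ho', hi'; split=> //.
    - move=> y yU; rewrite L2 // upy // cutE; last by rewrite inE; have [-> _] := nx y yU.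
      by rewrite inE [u == y]eq_sym; clear; lia.
    - move=> A AU; apply: leq_trans (L3 A AU); rewrite cutnx leq_add2l; apply: leq_sum => y yA.
      by rewrite leq_add2r upy ?leq_addr // (subsetP AU).
    - split; last by rewrite cE leqW.
        rewrite L4 !sumU; have := upx ho.
        rewrite !big_split /= upU; move: ho0; clear; lia.
      move: L5; rewrite cE !sumU upU; have := upx ho; move: ho0; clear; lia.
    move=> o'; have [o o1 o2] := L6 o'.
    exists (fun f => if f == e then false else o f).
      rewrite /out_degree (sum_setD1 _ eE) eqxx -/u [u == x]eq_sym (negPf xu) add0n.
      rewrite (eq_bigr (fun f => ((if o f then s f else t f) == x : nat))); last first.
        by move=> f; rewrite !inE => /andP[/negPf-> _].
      by move: o1; rewrite /out_degree; have := upx ho; move: ho0; clear; lia.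
    move=> y yU; rewrite -o2 // upy // /out_degree (sum_setD1 _ eE) eqxx -/u.
    rewrite (eq_bigr (fun f => ((if o f then s f else t f) == y : nat))); last first.
      by move=> f; rewrite !inE => /andP[/negPf-> _].
    by rewrite [u == y]eq_sym addnA.
  have hi0 : 0 < hi x by move: hr1; rewrite ho0 add0n => ->.
  have [|||||s' [t' [E' [ho' [hi' [L1 L2 L3 [L4 L5 L5'] L6]]]]]] := IHr s t (E :\ e) ho (up hi).
  - by move=> f /E2E; apply: EU.
  - by move=> f /E2E; apply: tx.
  - by have := upx hi; move: hi0 deg2 hr1; clear; lia.
  - by have := upx hi; move: hi0 hr1; clear; lia.
  - exact: mult2.
  exists s', t', E', ho', hi'; split=> //.
  - move=> y yU; rewrite L2 // upy // cutE; last by rewrite inE; have [-> _] := nx y yU.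
    by rewrite inE [u == y]eq_sym; clear; lia.
  - move=> A AU; apply: leq_trans (L3 A AU); rewrite cutnx leq_add2l; apply: leq_sum => y yA.
    by rewrite leq_add2l upy ?leq_addr // (subsetP AU).
  - split; last by rewrite cE leqW.
      rewrite L4 !sumU; have := upx hi.
      rewrite !big_split /= upU; move: hi0; clear; lia.
    move: L5; rewrite cE !sumU; clear; lia.
  move=> o'; have [o o1 o2] := L6 o'.
  exists (fun f => if f == e then true else o f).
    rewrite /out_degree (sum_setD1 _ eE) eqxx sx eqxx.
    rewrite (eq_bigr (fun f => ((if o f then s f else t f) == x : nat))); last first.
      by move=> f; rewrite !inE => /andP[/negPf-> _].
    by move: o1; rewrite /out_degree; clear; lia.
  move=> y yU; rewrite -o2 // /out_degree (sum_setD1 _ eE) eqxx sx.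
  rewrite (eq_bigr (fun f => ((if o f then s f else t f) == y : nat))); last first.
    by move=> f; rewrite !inE => /andP[/negPf-> _].
  by have [-> _] := nx y yU.
have hr2 : ho x + hi x <= r by move: hr hr1; clear; lia.
have Exgt : r.+1 < #|Ex| by move: cEx hr2; clear; lia.
pose m y := #|[set e in E | (s e == x) && (t e == y)]|.
have [e0 e0Ex] : exists e, e \in Ex by apply/card_gt0P; apply: leq_ltn_trans Exgt.
have [e1 e1Ex e1max] : exists2 e1, e1 \in Ex & forall e, e \in Ex -> m (t e) <= m (t e1).
  by case: (arg_maxnP (fun e => m (t e)) e0Ex) => e1 h1 h2; exists e1.
have [e1E se1] : e1 \in E /\ s e1 = x by move: e1Ex; rewrite inE => /andP[-> /eqP->].
set u := t e1 in e1max.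
have [e2 e2Ex e2u] : exists2 e2, e2 \in Ex & t e2 != u.
  have [/existsP[e2 /andP[h1 h2]]|no] := boolP [exists e in Ex, t e != u]; first by exists e2.
  exfalso; move: Exgt; rewrite ltnNge; apply/negP/negPn; apply: leq_trans (mult u).
  apply: subset_leq_card; apply/subsetP => e eEx; move: no; rewrite negb_exists => /forallP/(_ e).
  by rewrite eEx /= negbK => teu; move: eEx; rewrite !inE teu andbT.
have [e2E se2] : e2 \in E /\ s e2 = x by move: e2Ex; rewrite inE => /andP[-> /eqP->].
set w := t e2 in e2u.
have e12 : e1 != e2 by apply: contraNneq e2u => h; rewrite /w -h.
have [_ uU xu] := EU e1 e1E; rewrite se1 -/u in uU xu.
have [_ wU xw] := EU e2 e2E; rewrite se2 -/w in wU xw.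
have e1E2 : e1 \in E :\ e2 by rewrite !inE e12 e1E.
pose s2 e := if e == e1 then u else s e.
pose t2 e := if e == e1 then w else t e.
have E3E f : f \in E :\ e2 :\ e1 -> [/\ f \in E, (f == e1) = false & (f == e2) = false].
  by rewrite !inE => /and3P[/negPf-> /negPf-> ->].
have splitE (F : X -> nat) : \sum_(e in E) F e = F e2 + (F e1 + \sum_(e in E :\ e2 :\ e1) F e).
  by rewrite (sum_setD1 _ e2E) (sum_setD1 _ e1E2).
have st2 f : f \in E :\ e2 :\ e1 -> s2 f = s f /\ t2 f = t f.
  by move=> /E3E[_ h _]; rewrite /s2 /t2 h.
have s21 : s2 e1 = u by rewrite /s2 eqxx.
have t21 : t2 e1 = w by rewrite /t2 eqxx.
have degx : \sum_(e in E :\ e2) (s2 e == x) + ho x + hi x = 2 * r.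
  move: deg; rewrite splitE (sum_setD1 _ e1E2) s21 se1 se2 eqxx [u == x]eq_sym (negPf xu).
  rewrite (eq_bigr (fun e => s2 e == x : nat)); last by move=> f /st2[-> _].
  by slia.
have mE (y : V) : #|[set e in E :\ e2 | (s2 e == x) && (t2 e == y)]| + (y == u) + (y == w) <= m y.
  rewrite /m !card_set_filter splitE (sum_setD1 _ e1E2) s21 se1 se2 eqxx [u == x]eq_sym (negPf xu) /= -/u -/w.
  rewrite (eq_bigr (fun e => (s e == x) && (t e == y) : nat)); last by move=> f /st2[-> ->].
  by rewrite [u == y]eq_sym [w == y]eq_sym; clear; lia.
have [|||||s' [t' [E' [ho' [hi' [L1 L2 L3 [L4 L5 L5'] L6]]]]]] := IHr s2 t2 (E :\ e2) ho hi.
- move=> f fE; have [->|fe1] := eqVneq f e1; first by rewrite s21 t21 eq_sym.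
  by have [|-> ->] := st2 f; [rewrite in_setD1 fe1|apply: EU; move: fE; rewrite inE => /andP[]].
- move=> f fE; have [->|fe1] := eqVneq f e1; first by rewrite t21 eq_sym.
  by have [|_ ->] := st2 f; [rewrite in_setD1 fe1|apply: tx; move: fE; rewrite inE => /andP[]].
- exact: degx.
- exact: hr2.
- move=> y; have my := mE y; have multy := mult y; rewrite -/(m y) in multy.
  have [yu|yu] := eqVneq y u; first by move: my multy; rewrite yu eqxx; clear; lia.
  have [yw|yw] := eqVneq y w; first by move: my multy; rewrite yw eqxx; clear; lia.
  suff : m y <= r by move: my; clear; lia.
  have [->//|m0] := posnP (m y).
  have /card_gt0P[e] := m0; rewrite inE => /and3P[eE sex /eqP tey].
  have := e1max e; rewrite !inE eE sex tey => /(_ isT) myu.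
  (* The edges to [y], those to [u] and [e2] are distinct, and at most 2r + 2 edges meet [x].
     Together with m y <= m u this gives m y <= r. *)
  have : m y + m u + 1 <= #|Ex|.
    rewrite /m /Ex !card_set_filter (sum_setD1 _ e2E) [X in _ + X + _ <= _](sum_setD1 _ e2E).
    rewrite [X in _ <= X](sum_setD1 _ e2E) se2 eqxx /= -/w [w == y]eq_sym (negPf yw) (negPf e2u) !add0n.
    rewrite addnC leq_add2l -big_split /=; apply: leq_sum => f _.
    by case: (s f == x) => //=; case: (t f =P y) => [->|_]; [rewrite (negPf yu)|case: (t f == u)].
  by move: cEx myu; clear; lia.
have cutA (A : {set V}) : x \notin A ->
    cut_size s2 t2 (E :\ e2) A + 2 * ((u \in A) && (w \in A)) = cut_size s t E A.
  move=> xA; rewrite /cut_size splitE (sum_setD1 _ e1E2) /crosses s21 t21 se1 se2 -/u -/w (negPf xA) /=.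
  rewrite (eq_bigr (fun e => (s e \in A) (+) (t e \in A) : nat)); last by move=> f /st2[-> ->].
  by case: (u \in A); case: (w \in A); clear; lia.
have cE : #|E| = #|E :\ e2|.+1 by rewrite (cardsD1 e2) e2E.
exists s', t', E', ho', hi'; split=> //.
- move=> y yU; rewrite L2 // -cutA ?inE; last by have [-> _] := nx y yU.
  case: (u =P y) => uy; case: (w =P y) => wy; rewrite /= ?muln0 ?addn0 //.
  by move: e2u; rewrite -/w wy uy eqxx.
- move=> A AU; apply: leq_trans (L3 A AU); rewrite leq_add2r.
  have xA : x \notin A by apply/negP => /(subsetP AU); rewrite !inE eqxx.
  rewrite /cut_size !big_set_filter splitE (sum_setD1 _ e1E2) se1 se2 eqxx /= !add0n.
  apply: leq_trans (leq_addl _ _); rewrite leq_eqVlt; apply/orP; left; apply/eqP/eq_bigr => f f3.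
  by have [h1 h2] := st2 f f3; rewrite /crosses h1 h2.
- by split; [rewrite L4|move: L5; rewrite cE; clear; lia|rewrite cE leqW].
move=> o'; have [o o1 o2] := L6 o'.
exists (fun f => if f == e1 then ~~ o e1 else if f == e2 then o e1 else o f).
  move: o1; rewrite /out_degree splitE (sum_setD1 _ e1E2) !eqxx s21 t21 se1 se2 [e2 == e1]eq_sym (negPf e12) -/u -/w.
  rewrite (eq_bigr (fun f => ((if o f then s f else t f) == x : nat))); last first.
    by move=> f f3; have [h1 h2] := st2 f f3; rewrite h1 h2.
  rewrite [X in _ -> _ + (_ + (_ + X)) = _](eq_bigr (fun f => ((if o f then s f else t f) == x : nat))); last first.
    by move=> f /E3E[_ -> ->].
  rewrite ![_ == x]eq_sym.
  by case: (o e1); rewrite /= ?eqxx ?(negPf xu) ?(negPf xw); clear; lia.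
move=> y yU; rewrite -o2 //; congr (_ + _).
have [xy _] := nx y yU.
rewrite /out_degree splitE (sum_setD1 _ e1E2) !eqxx s21 t21 se1 se2 [e2 == e1]eq_sym (negPf e12) -/u -/w.
rewrite (eq_bigr (fun f => ((if o f then s f else t f) == y : nat))); last first.
  by move=> f /E3E[_ -> ->].
rewrite [in RHS](eq_bigr (fun f => ((if o f then s f else t f) == y : nat))); last first.
  by move=> f f3; have [h1 h2] := st2 f f3; rewrite h1 h2.
by case: (o e1); rewrite /= xy; clear; lia.
Qed.
End LiftVertex.

Section Elimination.
Variables (V X : finType) (c k M : nat) (s t : X -> V) (U : {set V}) (E : {set X}).
Variables (ho hi po pi : V -> nat) (x : V).
Hypothesis adm : admissible c k M s t U E ho hi po pi.
Hypotheses (xU : x \in U) (U3 : 2 < #|U|) (M_large : 3 * (2 * c + k) <= 2 * M + 2).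
Hypothesis tx : forall e, e \in E -> t e != x.
Hypothesis large : forall A : {set V}, A \subset U -> 1 < #|A| -> A != U ->
  M < cut_size s t E A + \sum_(y in A) (ho y + hi y).
Hypothesis outer : forall (s' t' : X -> V) (U' : {set V}) (E' : {set X}) (ho' hi' po' pi' : V -> nat),
  admissible c k M s' t' U' E' ho' hi' po' pi' -> 1 < #|U'| -> #|U'| + #|E'| < #|U| + #|E| ->
  orientable k s' t' U' E' ho' po'.

Let Ex := [set e in E | s e == x].

(** The edges of [D] are directed into [x], which costs each of their distinct other ends one
    out-arc, and the remaining ends at [x] are lifted in pairs, so that [r] arcs leave. If [b]
    holds, the old arcs at [x] stay out of the pairing. A set [A] avoiding [x] may lose all its
    edges to [x]; but the cuts of [A] and of [x |: A] both exceed [M] and share at most 2c + k ends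
    at [x], so twice the remaining cut is at least 2M + 2 - (2c + k). *)
Lemma orientable_eliminate (D : {set X}) (b : bool) r :
  D \subset Ex -> {in D &, injective t} ->
  #|Ex| + (if b then 0 else ho x + hi x) = #|D| + 2 * r ->
  (if b then 0 else ho x + hi x) <= r ->
  r + (if b then ho x else 0) = po x %[mod k] ->
  (forall e, e \in D -> c < po (t e)) ->
  (forall y, #|[set e in E | (s e == x) && (t e == y)]| <= r) ->
  po x + pi x <= 2 * c + k ->
  orientable k s t U E ho po.
Proof.
move=> DEx tinj degx hr por Dpo mult dx; case: (adm) => EU deg big hM tot.
have DE e : e \in D -> e \in E /\ s e = x by move=> /(subsetP DEx); rewrite inE => /andP[-> /eqP].
pose E1 := E :\: D.
pose ho1 y := if b && (y == x) then 0 else ho y.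
pose hi1 y := if b && (y == x) then 0 else hi y.
have E1E e : e \in E1 -> e \in E by rewrite inE => /andP[].
have sumE (F : X -> nat) : \sum_(e in E) F e = \sum_(e in D) F e + \sum_(e in E1) F e.
  rewrite (bigID (mem D)) /=; congr (_ + _); apply: eq_bigl => e; last by rewrite inE andbC.
  by case: (boolP (e \in D)) => [/DE[-> _]|_]; rewrite ?andbF.
have sumU (h : V -> nat) : \sum_(y in U) h y = h x + \sum_(y in U :\ x) h y by rewrite (big_setD1 x).
have nx y : y \in U :\ x -> (x == y) = false /\ (y == x) = false.
  by rewrite !inE => /andP[/negPf h _]; rewrite [x == y]eq_sym h.
have ho1y y : y != x -> ho1 y = ho y by rewrite /ho1 => /negPf->; rewrite andbF.
have hi1y y : y != x -> hi1 y = hi y by rewrite /hi1 => /negPf->; rewrite andbF.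
have sumD : \sum_(e in D) (s e == x) = #|D|.
  by rewrite -sum1_card; apply: eq_bigr => e /DE[_ ->]; rewrite eqxx.
have cEx : #|Ex| = \sum_(e in E) (s e == x) by rewrite card_set_filter.
have hx1 : ho1 x + hi1 x = if b then 0 else ho x + hi x.
  by rewrite /ho1 /hi1 eqxx andbT; case: (b).
have [|||||s' [t' [E' [ho' [hi' [L1 L2 L3 [L4 L5 L5'] L6]]]]]] :=
  @lift_vertex V X r s t U E1 ho1 hi1 x xU.
- by move=> e /E1E; apply: EU.
- by move=> e /E1E; apply: tx.
- by move: degx; rewrite cEx sumE sumD -hx1; slia.
- by rewrite hx1.
- move=> y; apply: leq_trans (mult y); apply: subset_leq_card; apply/subsetP => e.
  by rewrite !inE => /andP[/andP[_ ->]].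
pose cnt y := \sum_(e in D) (t e == y).
have cnt1 y : cnt y <= 1.
  have [/existsP[e /andP[eD /eqP ty]]|no] := boolP [exists e in D, t e == y]; last first.
    rewrite /cnt big1 // => e eD; move: no; rewrite negb_exists => /forallP/(_ e).
    by rewrite eD /= => /negPf->.
  rewrite /cnt (sum_setD1 _ eD) ty eqxx big1 ?addn0 // => f; rewrite inE => /andP[fe fD].
  by case: eqP => // tf; move: fe; rewrite inE (tinj f e fD eD) ?eqxx // tf ty.
have cntpo y : y \in U -> c + cnt y <= po y.
  move=> yU; have [_ h _] := deg y yU.
  have [/existsP[e /andP[eD /eqP ty]]|no] := boolP [exists e in D, t e == y].
    by have := Dpo e eD; rewrite ty; move: (cnt1 y); clear; lia.
  rewrite /cnt big1 ?addn0 // => e eD; move: no; rewrite negb_exists => /forallP/(_ e).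
  by rewrite eD /= => /negPf->.
pose po1 y := po y - cnt y.
have po1E y : y \in U -> po1 y + cnt y = po y.
  by move=> /cntpo h; rewrite /po1 subnK //; apply: leq_trans h; apply: leq_addl.
have cutD y : y \in U :\ x -> cut_size s t E [set y] = cut_size s t E1 [set y] + cnt y.
  move=> yU; have [xy _] := nx y yU; rewrite /cut_size sumE addnC; congr (_ + _).
  by apply: eq_bigr => e /DE[_ sx]; rewrite /crosses !inE sx xy.
have UxU y : y \in U :\ x -> y \in U by rewrite inE => /andP[].
have hle : \sum_(y in U) (ho1 y + hi1 y) <= \sum_(y in U) (ho y + hi y).
  by apply: leq_sum => y _; rewrite /ho1 /hi1; case: ifP.
have cutnx : [set e in E1 | s e != x] = [set e in E | s e != x].
  apply/setP => e; rewrite !inE; case: (boolP (e \in D)) => //= /DE[_ ->].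
  by rewrite eqxx andbF.
have big1' (A : {set V}) : A \subset U :\ x -> 1 < #|A| -> A != U :\ x ->
    2 * c + k <= cut_size s' t' E' A + \sum_(y in A) (ho' y + hi' y).
  move=> AU A1 AnU; apply: leq_trans (L3 A AU); rewrite cutnx.
  have xA : x \notin A by apply/negP => /(subsetP AU); rewrite !inE eqxx.
  rewrite (eq_bigr (fun y => ho y + hi y)); last first.
    by move=> y yA; have [_ h] := nx y (subsetP AU y yA); rewrite ho1y ?h // hi1y ?h.
  set q := cut_size s t [set e in E | s e != x] A.
  pose a := \sum_(e in Ex) (t e \in A).
  pose a' := \sum_(e in Ex) (t e \notin A).
  have aa : a + a' = #|Ex|.
    by rewrite -sum1_card -big_split; apply: eq_bigr => e _; case: (t e \in A).
  have split_cut (B : {set V}) : cut_size s t E B = cut_size s t [set e in E | s e != x] B + cut_size s t Ex B.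
    rewrite /cut_size !big_set_filter -big_split; apply: eq_bigr => e _ /=.
    by case: (s e == x); rewrite ?mul0n ?mul1n ?addn0 ?add0n.
  have d1 : cut_size s t E A = q + a.
    rewrite split_cut; congr (_ + _); apply: eq_bigr => e; rewrite inE => /andP[_ /eqP sx].
    by rewrite /crosses sx (negPf xA).
  have d2 : cut_size s t E (x |: A) = q + a'.
    rewrite split_cut; congr (_ + _); apply: eq_bigr => e; rewrite inE.
      by move=> /andP[eE /negPf sx]; rewrite /crosses !inE (negPf (tx eE)) sx.
    move=> /andP[eE /eqP sx]; by rewrite /crosses !inE (negPf (tx eE)) sx eqxx.
  have AU' : A \subset U by apply: subset_trans AU (subD1set _ _).
  have xAU : x |: A \subset U by rewrite subUset sub1set xU.
  have AnU' : A != U by apply: contraNneq xA => ->.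
  have xAnU : x |: A != U.
    apply: contra AnU => /eqP h; apply/eqP/setP => y; rewrite -h !inE.
    by case: eqP => // ->; rewrite (negPf xA).
  have xA1 : 1 < #|x |: A| by rewrite cardsU1 xA ltnW.
  have := large AU' A1 AnU'; have := large xAU xA1 xAnU.
  rewrite d1 d2 big_setU1 //=.
  have [h _ _] := deg x xU; rewrite (cut_size1 _) in h; last by move=> e /EU[].
  have hEx : \sum_(e in E) ((s e == x) + (t e == x)) = #|Ex|.
    by rewrite cEx; apply: eq_bigr => e eE; rewrite (negPf (tx eE)) addn0.
  rewrite hEx in h; move: h dx aa M_large; clearbody q a a'; move: (\sum_(_ in A) _) #|Ex|; clear; lia.
have tot1 : \sum_(y in U :\ x) po1 y = #|E'| + \sum_(y in U :\ x) ho' y %[mod k].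
  have e1 : \sum_(y in U :\ x) po y = \sum_(y in U :\ x) po1 y + #|D|.
    rewrite (eq_bigr (fun y => po1 y + cnt y)); last by move=> y yU; rewrite po1E // UxU.
    rewrite big_split /=; congr (_ + _); rewrite exchange_big /= -sum1_card.
    apply: eq_bigr => e eD; have [eE _] := DE e eD; have [_ tU _] := EU e eE.
    by rewrite sum_eq_mem !inE tx // tU.
  have e2 : #|E| = #|E1| + #|D|.
    by rewrite -sum1_card sumE !sum1_card addnC.
  have e3 : \sum_(y in U) ho y = \sum_(y in U) ho1 y + (if b then ho x else 0).
    rewrite !sumU [in RHS](eq_bigr ho); last by move=> y yU; rewrite ho1y //; have [_ ->] := nx y yU.
    by rewrite /ho1 eqxx andbT; case: (b); rewrite ?addn0 // add0n addnC.
  move: tot; rewrite sumU e1 e2 e3 -modnDml -por modnDml => h.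
  apply/eqP; rewrite -(eqn_modDr (r + (if b then ho x else 0) + #|D|)).
  have -> : \sum_(y in U :\ x) po1 y + (r + (if b then ho x else 0) + #|D|) =
    r + (if b then ho x else 0) + (\sum_(y in U :\ x) po1 y + #|D|) by rewrite addnCA addnA.
  rewrite h; apply/eqP; congr (_ %% _); move: L5; clear; case: (b) => /=;
  by move: #|E'| #|E1| #|D| (ho x); slia.
have adm' : admissible c k M s' t' (U :\ x) E' ho' hi' po1 pi.
  split=> //; last by rewrite L4; apply: leq_trans hle hM.
  move=> y yU; have yU' := UxU y yU; have [h1 h2 h3] := deg y yU'; split=> //.
    rewrite L2 // ho1y ?hi1y; try by have [_ ->] := nx y yU.
    by move: h1 (po1E y yU'); rewrite cutD //; move: (cnt y); clear; lia.
  by rewrite /po1 leq_subRL ?cntpo // -1?addnC ?cntpo //; apply: leq_trans (cntpo y yU'); apply: leq_addl.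
have cU : #|U| = (#|U :\ x|).+1 by rewrite (cardsD1 x) xU.
have [||o' o'P] := outer adm'.
- by move: U3; rewrite cU.
- rewrite cU addSn ltnS leq_add2l; apply: leq_trans L5' _.
  by apply: subset_leq_card; apply: subsetDl.
have [o o1 o2] := L6 o'.
have outE y : out_degree s t (fun e => if e \in D then false else o e) E y = cnt y + out_degree s t o E1 y.
  rewrite /out_degree sumE; congr (_ + _); apply: eq_bigr => e; first by move=> ->.
  by rewrite inE => /andP[/negPf-> _].
exists (fun e => if e \in D then false else o e) => y yU; rewrite outE.
have [->|yx] := eqVneq y x.
  have -> : cnt x = 0 by apply: big1 => e /DE[eE _]; rewrite (negPf (tx eE)).
  rewrite -por -o1 add0n /ho1 eqxx andbT; case: (b); rewrite ?addn0 ?add0n //.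
  by congr (_ %% _); rewrite addnC.
have yUx : y \in U :\ x by rewrite !inE yx.
rewrite addnCA addnC -(ho1y y yx) o2 // -modnDml o'P // modnDml.
by rewrite po1E.
Qed.

End Elimination.

Lemma card_transversal (X Y : finType) (f : X -> Y) (E : {set X}) n : n <= #|f @: E| ->
  exists D : {set X}, [/\ D \subset E, #|D| = n & {in D &, injective f}].
Proof.
elim: n => [|n IHn] nE; first by exists set0; split; rewrite ?sub0set ?cards0 // => x; rewrite inE.
have [D [DE cD Dinj]] := IHn (ltnW nE).
have /subsetPn[y /imsetP[x xE ->] xD] : ~~ (f @: E \subset f @: D).
  by apply: contraL nE => /subset_leq_card h; rewrite -leqNgt (leq_trans h) // -cD leq_imset_card.
have nxD z : z \in D -> f z != f x by move=> zD; apply: contraNneq xD => <-; apply: imset_f.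
have xD' : x \notin D by apply: contra xD; apply: imset_f.
exists (x |: D); split; first by rewrite subUset sub1set xE.
  by rewrite cardsU1 xD' cD.
move=> u v; rewrite !inE => /orP[/eqP->|uD] /orP[/eqP->|vD] //.
- by move=> h; have := nxD v vD; rewrite h eqxx.
- by move=> h; have := nxD u uD; rewrite h eqxx.
- exact: Dinj.
Qed.

Lemma eqn_mod_sum (X : finType) (U : {set X}) (f g : X -> nat) k :
  (forall x, x \in U -> f x = g x %[mod k]) ->
  \sum_(x in U) f x == \sum_(x in U) g x %[mod k].
Proof.
move=> h; apply/eqP; elim/big_rec2: _ => // x a b xU ab.
by rewrite -modnDml h // modnDml -modnDmr ab modnDmr.
Qed.

(** * The induction for modular orientations *)

Section ModularOrientation.
Variables (V X : finType).
Implicit Types (s t : X -> V) (U A : {set V}) (E : {set X}) (o : X -> bool).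

(** Exchanges the names of the two ends where needed, so that [x] is never the second end: the
    normal form in which [x] is eliminated. *)
Definition flip_fst s t x e := if t e == x then t e else s e.
Definition flip_snd s t x e := if t e == x then s e else t e.

Lemma crosses_flip s t x A e : crosses (flip_fst s t x) (flip_snd s t x) A e = crosses s t A e.
Proof. by rewrite /crosses /flip_fst /flip_snd; case: ifP => //; rewrite addbC. Qed.

Lemma admissible_flip c k M s t U E ho hi po pi x :
  admissible c k M s t U E ho hi po pi ->
  admissible c k M (flip_fst s t x) (flip_snd s t x) U E ho hi po pi.
Proof.
have cs A : cut_size (flip_fst s t x) (flip_snd s t x) E A = cut_size s t E A.
  by apply: eq_bigr => e _; rewrite crosses_flip.
case=> EU deg big hM tot; split=> //; try by move=> *; rewrite cs; auto.
move=> e eE; have [h1 h2 h3] := EU e eE; rewrite /flip_fst /flip_snd.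
by case: ifP => //; split=> //; rewrite eq_sym.
Qed.

Lemma orientable_flip k s t U E ho po x :
  orientable k (flip_fst s t x) (flip_snd s t x) U E ho po -> orientable k s t U E ho po.
Proof.
case=> o oP; exists (fun e => if t e == x then ~~ o e else o e) => y yU; rewrite -oP //.
congr (_ %% _); congr (_ + _); apply: eq_bigr => e _; rewrite /flip_fst /flip_snd.
by case: (t e == x); case: (o e).
Qed.

Definition unsaturated M s t U E (ho hi : V -> nat) : Prop :=
  forall A, A \subset U -> 1 < #|A| -> A != U ->
    M < cut_size s t E A + \sum_(y in A) (ho y + hi y).

Definition smaller_orientable c k M s t U E : Prop :=
  forall (s' t' : X -> V) (U' : {set V}) (E' : {set X}) (ho' hi' po' pi' : V -> nat),
  admissible c k M s' t' U' E' ho' hi' po' pi' -> 1 < #|U'| -> #|U'| + #|E'| < #|U| + #|E| ->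
  orientable k s' t' U' E' ho' po'.

(** The complement of [x] has the same edge cut as [x], while its old arcs number at most [M] minus
    those at [x]. *)
Lemma unsaturated_degree c k M s t U E ho hi po pi x :
  admissible c k M s t U E ho hi po pi -> unsaturated M s t U E ho hi ->
  x \in U -> 2 < #|U| -> ho x + hi x < cut_size s t E [set x].
Proof.
case=> EU deg big hM tot uns xU U3.
have cU : #|U| = (#|U :\ x|).+1 by rewrite (cardsD1 x) xU.
have := uns (U :\ x) (subD1set _ _); rewrite -ltnS -cU => /(_ U3).
have neq : U :\ x != U by apply: contraTneq xU => <-; rewrite !inE eqxx.
move=> /(_ neq); have -> : cut_size s t E (U :\ x) = cut_size s t E [set x].
  apply: eq_bigr => e eE; have [h1 h2 _] := EU e eE; rewrite /crosses !inE h1 h2 !andbT.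
  by case: (s e == x); case: (t e == x).
by move: hM; rewrite (big_setD1 x) //=; slia.
Qed.

(** Every neighbour of [x] has an out-arc to spare. More than [c] edges meet [x], fewer than [k] of
    them at any one neighbour, so [4 * k * k <= c] provides 2k + 1 neighbours. Among the [k] numbers
    just below half of the number of edges at [x] some [r] has the right residue; the at most 2k + 1
    edges in excess of 2r come in from distinct neighbours. *)
Lemma orientable_out_only c k s t U E ho hi po pi x : 0 < k -> 4 * k * k <= c ->
  admissible c k (3 * c + 2 * k) s t U E ho hi po pi ->
  unsaturated (3 * c + 2 * k) s t U E ho hi ->
  smaller_orientable c k (3 * c + 2 * k) s t U E ->
  (forall y z, #|[set e in E | ((s e == y) && (t e == z)) || ((s e == z) && (t e == y))]| < k) ->
  x \in U -> 2 < #|U| -> pi x = c -> po x < c + k ->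
  (forall e, e \in E -> s e = x \/ t e = x -> c < po (s e) /\ c < po (t e)) ->
  orientable k s t U E ho po.
Proof.
move=> k0 ck adm uns small mult xU U3 pix pox nbr; apply: (@orientable_flip _ _ _ _ _ _ _ x).
have dlt := unsaturated_degree adm uns xU U3.
have adm' := admissible_flip x adm; case: (adm) => EU deg big hM tot.
set s' := flip_fst s t x in adm' *; set t' := flip_snd s t x in adm' *.
have t'x e : e \in E -> t' e != x.
  move=> eE; have [_ _ st] := EU e eE; rewrite /t' /flip_snd; case: (eqVneq (t e) x) => [tx|//].
  by rewrite -tx.
pose Ex := [set e in E | s' e == x].
have cE : #|Ex| = cut_size s t E [set x].
  rewrite card_set_filter (eq_bigr (fun e => crosses s' t' [set x] e : nat)); last first.
    by move=> e eE; rewrite /crosses !inE (negPf (t'x e eE)) addbF.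
  by apply: eq_bigr => e _; rewrite crosses_flip.
have [dx cpo _] := deg x xU; rewrite -cE in dx dlt.
have mult' y : #|[set e in E | (s' e == x) && (t' e == y)]| < k.
  apply: leq_ltn_trans (mult x y); apply: subset_leq_card; apply/subsetP => e; rewrite !inE.
  rewrite /s' /t' /flip_fst /flip_snd; case: (t e =P x) => [->|_] /andP[-> /andP[]].
    by move=> _ ->; rewrite ?eqxx ?orbT.
  by move=> -> ->.
have nb : 2 * k + 1 <= #|t' @: Ex|.
  have : #|Ex| <= #|t' @: Ex| * k.
    apply: (card_le_fibers (f := t')) => [e eE|y]; first exact: imset_f.
    apply: leq_trans (ltnW (mult' y)); apply: subset_leq_card; apply/subsetP => e.
    by rewrite !inE => /andP[/andP[-> ->] ->].
  move=> h; rewrite leqNgt; apply/negP => h2.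
  have : #|t' @: Ex| * k <= 2 * k * k by rewrite leq_mul2r -(ltnS #|_|) -(addn1 (2 * k)) h2 orbT.
  by move: h dx dlt cpo pix ck; clear; move: #|Ex| (#|_|) => a b; nia.
have [r /andP[r1 r2] rP] := exists_residue (#|Ex|./2 - k) (ho x) (po x) k0.
have kle : 2 * k <= #|Ex|./2.
  have : 4 * k <= 4 * k * k by rewrite -{1}[4 * k]muln1 leq_mul2l k0 orbT.
  by move: dx dlt cpo pix ck; clear; lia.
have r3 : r < #|Ex|./2 by move: r2; rewrite subnK //; move: kle; clear; lia.
have [D [DE cD Dinj]] : exists D : {set X}, [/\ D \subset Ex, #|D| = #|Ex| - 2 * r & {in D &, injective t'}].
  by apply: card_transversal; apply: leq_trans nb; move: r1 r3 kle; clear; lia.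
apply: (@orientable_eliminate V X c k (3 * c + 2 * k) s' t' U E ho hi po pi x adm' xU U3 _ t'x _ small D true r DE Dinj) => //.
- by clear; lia.
- move=> A AU A1 AnU; have := uns A AU A1 AnU; congr (_ < _ + _).
  by apply: eq_bigr => e _; rewrite crosses_flip.
- by rewrite addn0 -/Ex cD subnK //; move: r3; clear; lia.
- move=> e eD; have := subsetP DE e eD; rewrite inE => /andP[eE]; rewrite /s' /t' /flip_fst /flip_snd.
  case: (t e =P x) => tx /eqP sx; first by have [] := nbr e eE (or_intror tx).
  by have [] := nbr e eE (or_introl sx).
- by move=> y; apply: leq_trans (ltnW (mult' y)) _; move: r1 kle; clear; lia.
- by rewrite pix; move: pox; clear; lia.
Qed.

(** Directs [e] from [u] to [w] and removes it. Only residues of the targets matter, so an end whose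
    target is at the minimum [c] in the direction of [e] may trade [k] arcs of the other direction:
    hence the alternatives with c + k. Cuts larger than [M] can afford to lose an edge. *)
Lemma orientable_delete c k M s t U E ho hi po pi e (b : bool) : 0 < k ->
  2 * c + k <= M ->
  admissible c k M s t U E ho hi po pi -> unsaturated M s t U E ho hi ->
  smaller_orientable c k M s t U E ->
  1 < #|U| -> e \in E ->
  (let a := if b then s e else t e in (c < po a) || (c + k <= pi a)) ->
  (let a := if b then t e else s e in (c < pi a) || (c + k <= po a)) ->
  orientable k s t U E ho po.
Proof.
move=> k0 cM adm uns small U2 eE; case: (adm) => EU deg big hM tot.
set u := if b then s e else t e; set w := if b then t e else s e => /= uO wI.
have [sU tU st] := EU e eE.
have [uU wU uw] : [/\ u \in U, w \in U & u != w].
  by rewrite /u /w; case: (b); split=> //; rewrite eq_sym.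
have wu : w != u by rewrite eq_sym.
pose po1 y := if y == u then (if c < po u then (po u).-1 else po u + k - 1)
              else if y == w then (if c < pi w then po w else po w - k) else po y.
pose pi1 y := if y == u then (if c < po u then pi u else pi u - k)
              else if y == w then (if c < pi w then (pi w).-1 else pi w + k - 1) else pi y.
have E1E f : f \in E :\ e -> f \in E /\ f != e by rewrite !inE => /andP[-> ->].
have stuw : (s e = u /\ t e = w) \/ (s e = w /\ t e = u) by rewrite /u /w; case: (b); [left|right].
have cutE y : cut_size s t E [set y] = cut_size s t (E :\ e) [set y] + (u == y) + (w == y).
  have nl : forall f, f \in E -> s f != t f by move=> f /EU[].
  rewrite (cut_size1 y nl) (cut_size1 y (E := E :\ e)); last by move=> f /E1E[/nl].
  rewrite (sum_setD1 _ eE); case: stuw => [[-> ->]|[-> ->]]; slia.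
have adm1 : admissible c k M s t U (E :\ e) ho hi po1 pi1.
  split=> //.
  - by move=> f /E1E[/EU].
  - move=> y yU; have [h1 h2 h3] := deg y yU; move: h1; rewrite cutE /po1 /pi1.
    have [yu|yu] := eqVneq y u.
      move: h2 h3; rewrite yu (negPf wu); move: uO; move: (cut_size _ _ _ _); clear -k0 => q.
      by case: ifP => c1 /= h1 h2 h3 h4; split; move: k0 c1 h1 h2 h3 h4; clear; lia.
    have [yw|yw] := eqVneq y w.
      move: h2 h3; rewrite yw; move: wI; move: (cut_size _ _ _ _); clear -k0 => q.
      by case: ifP => c1 /= h1 h2 h3 h4; split; move: k0 c1 h1 h2 h3 h4; clear; lia.
    by rewrite !addn0.
  - move=> A AU A1 AnU; have := uns A AU A1 AnU; rewrite {1}/cut_size (sum_setD1 _ eE) -/(cut_size s t _ _).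
    by case: (crosses s t A e); move: cM; move: (cut_size _ _ _ _); slia.
  have cE : #|E| = #|E :\ e|.+1 by rewrite (cardsD1 e) eE.
  move: tot; rewrite cE addSn.
  have wUu : w \in U :\ u by rewrite !inE wu.
  rewrite !(sum_setD1 _ uU) !(sum_setD1 _ wUu) /po1 !eqxx (negPf wu).
  rewrite [X in _ -> _ + (_ + X) = _ %[mod _]](eq_bigr po); last first.
    by move=> y; rewrite !inE => /and3P[/negPf-> /negPf-> _].
  move=> h; apply/eqP; rewrite -(eqn_modDl 1) add1n.
  have [h2u h3u] : c <= po u /\ c <= pi u by have [] := deg u uU.
  have [h2w h3w] : c <= po w /\ c <= pi w by have [] := deg w wU.
  (* The new targets sum to the old sum minus 1, up to one [k] more or less; the additional [k] on
     the left avoids negative numbers. *)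
  have [d dP] : exists d, 1 + ((if c < po u then (po u).-1 else po u + k - 1) +
     ((if c < pi w then po w else po w - k) + \sum_(y in U :\ u :\ w) po y)) + k =
     po u + (po w + \sum_(y in U :\ u :\ w) po y) + d * k /\ d <= 2.
    move: uO wI h2u h2w k0; case: ifP => c1; case: ifP => c2 /= i1 i2 i3 i4 i5.
    - by exists 1; split=> //; move: c1; slia.
    - by exists 0; split=> //; move: c1 i2; slia.
    - by exists 2; split=> //; move: i5; slia.
    - by exists 1; split=> //; move: i2 i5; slia.
  rewrite -modnDr dP.1 addnC modnMDl h; apply/eqP; congr (_ %% _); clear; lia.
have [|o oP] := small _ _ _ _ _ _ _ _ adm1 U2.
  by rewrite ltn_add2l (cardsD1 e E) eE.
exists (fun f => if f == e then b else o f) => y yU.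
have -> : out_degree s t (fun f => if f == e then b else o f) E y = (u == y) + out_degree s t o (E :\ e) y.
  rewrite /out_degree (sum_setD1 _ eE) eqxx -/u; congr (_ + _); apply: eq_bigr => f /E1E[_ /negPf-> //].
have := oP y yU; rewrite /po1.
have [h2u h3u] : c <= po u /\ c <= pi u by have [] := deg u uU.
have [h2w h3w] : c <= po w /\ c <= pi w by have [] := deg w wU.
have [->|yu] := eqVneq y u.
  rewrite addnCA => h; apply/eqP; move/eqP: h; rewrite -(eqn_modDl 1) => /eqP->.
  case: ifP => c1; first by rewrite add1n prednK //; apply: leq_trans c1.
  by rewrite addnBA ?addn_gt0 ?k0 ?orbT // add1n subn1 /= modnDr.
rewrite add0n => ->; have [->|//] := eqVneq y w.
case: ifP => c1 //; rewrite -(modnDr (_ - k)) subnK //.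
by move: wI; rewrite c1 /=; apply: leq_trans; apply: leq_addl.
Qed.

(* Induction on #|U| + #|E|: contract a pair joined by k edges or a set with a small cut, or
   orient an edge whose ends have degrees to spare, or lift a vertex that has none. *)
Lemma orientable_admissible c k s t U E ho hi po pi : 0 < k -> 4 * k * k <= c ->
  1 < #|U| -> admissible c k (3 * c + 2 * k) s t U E ho hi po pi ->
  orientable k s t U E ho po.
Proof.
(* [M] limits both the cuts that are contracted and the total number of old arcs. It is large enough
   for an elimination, 2M + 2 >= 3(2c + k), and small enough that two last vertices, of total degree
   at least 4c, are joined by [k] edges: 4c - M >= 2k. *)
move=> k0 ck; set M := 3 * c + 2 * k.
have k4 : 4 * k <= c by apply: leq_trans ck; rewrite -{1}[4 * k]muln1 leq_mul2l k0 orbT.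
have [n] := ubnP (#|U| + #|E|).
elim: n s t U E ho hi po pi => // n IHn s t U E ho hi po pi ltn U2 adm; rewrite ltnS in ltn.
case: (adm) => EU deg big hM tot.
have small s' t' : smaller_orientable c k M s' t' U E.
  by move=> s2 t2 U' E' ho' hi' po' pi' adm' U'2 lt; apply: IHn adm' => //; apply: leq_trans lt _.
have [U3|U3] := leqP #|U| 2.
  have U2' : #|U| = 2 by apply/eqP; rewrite eqn_leq U3.
  apply: orientable_two => //.
  have : \sum_(x in U) (c + c) <= \sum_(x in U) (po x + pi x).
    by apply: leq_sum => x xU; have [_ h1 h2] := deg x xU; apply: leq_add.
  rewrite sum_nat_const U2' (eq_bigr (fun x => cut_size s t E [set x] + (ho x + hi x))); last first.
    by move=> x xU; have [-> _ _] := deg x xU; rewrite addnA.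
  rewrite big_split /= (sum_cut_size EU); move: hM k4; rewrite /M; slia.
have [/existsP[A /and4P[AU A1 AnU dA]]|] := boolP [exists A : {set V}, [&& A \subset U, 1 < #|A|, A != U &
    cut_size s t E A + \sum_(y in A) (ho y + hi y) <= M]].
  have AltU : #|A| < #|U| by apply: proper_card; rewrite properEneq AnU.
  apply: (orientable_contract k0 adm AU A1 AnU); first exact: small.
  move=> ho' hi' rel totA.
  have EAE : [set e in E | (s e \in A) && (t e \in A)] \subset E by apply/subsetP => e; rewrite inE => /andP[].
  apply: (IHn s t A _ ho' hi' po pi) => //.
    by apply: leq_trans ltn; rewrite -addSn leq_add // subset_leq_card.
  split=> //.
  - by move=> e; rewrite inE => /and3P[/EU[_ _ st] -> ->].
  - move=> x xA; have [h1 h2 h3] := deg x (subsetP AU x xA); split=> //.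
    have := rel [set x]; rewrite sub1set xA => /(_ isT); rewrite !big_set1 !addnA => ->.
    by rewrite h1.
  - move=> Y YA Y1 YnA; rewrite rel //; apply: big => //; first exact: subset_trans AU.
    by apply: contraNneq AnU => YU; rewrite eqEsubset AU -YU.
  - apply: leq_trans dA; rewrite -rel //; apply: leq_addl.
rewrite negb_exists => /forallP uns0.
have uns : unsaturated M s t U E ho hi.
  by move=> A AU A1 AnU; have := uns0 A; rewrite AU A1 AnU /= -ltnNge.
have [/existsP[A /and3P[AU /eqP A2 EA]]|] := boolP [exists A : {set V}, [&& A \subset U, #|A| == 2 &
    k <= #|[set e in E | (s e \in A) && (t e \in A)]|]].
  apply: (orientable_contract k0 adm AU); first by rewrite A2.
  - by apply/eqP => AU'; move: U3; rewrite -AU' A2.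
  - exact: small.
  move=> ho' hi' _ totA; apply: orientable_two => //.
  by move=> e; rewrite inE => /and3P[/EU[_ _ st] -> ->].
rewrite negb_exists => /forallP mult0.
have mult y z : #|[set e in E | ((s e == y) && (t e == z)) || ((s e == z) && (t e == y))]| < k.
  have [->|yz] := eqVneq y z.
    rewrite (_ : [set e in E | _] = set0) ?cards0 //; apply/setP => e; rewrite !inE orbb.
    by apply/negP => /and3P[/EU[_ _ st] /eqP sz /eqP tz]; rewrite sz tz eqxx in st.
  have [/andP[yU zU]|] := boolP ((y \in U) && (z \in U)).
    have := mult0 [set y; z]; rewrite cards2 yz eqxx /= subUset !sub1set yU zU /= -ltnNge.
    apply: leq_ltn_trans; apply: subset_leq_card; apply/subsetP => e; rewrite !inE.
    by case/andP=> -> /orP[] /andP[/eqP-> /eqP->]; rewrite !eqxx ?orbT.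
  move=> nU; rewrite (_ : [set e in E | _] = set0) ?cards0 //; apply/setP => e; rewrite !inE.
  apply/negP => /andP[/EU[sU tU _]] /orP[] /andP[/eqP sy /eqP tz]; move: nU;
  by rewrite -sy -tz sU tU.
(* With both targets equal to [c] the degree is 2c, old arcs included, and everything at [x] is
   lifted, with [D] empty and [r] equal to [c]. *)
have [/existsP[x /and3P[xU /eqP pox /eqP pix]]|] := boolP [exists x in U, (po x == c) && (pi x == c)].
  apply: (@orientable_flip _ _ _ _ _ _ _ x).
  have dlt := unsaturated_degree adm uns xU U3.
  have adm' := admissible_flip x adm.
  have t'x e : e \in E -> flip_snd s t x e != x.
    move=> eE; have [_ _ st] := EU e eE; rewrite /flip_snd; case: (eqVneq (t e) x) => [tx|//].
    by rewrite -tx.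
  have cE : #|[set e in E | flip_fst s t x e == x]| = cut_size s t E [set x].
    rewrite card_set_filter (eq_bigr (fun e => crosses (flip_fst s t x) (flip_snd s t x) [set x] e : nat)); last first.
      by move=> e eE; rewrite /crosses !inE (negPf (t'x e eE)) addbF.
    by apply: eq_bigr => e _; rewrite crosses_flip.
  have [dx _ _] := deg x xU; rewrite pox pix in dx.
  apply: (@orientable_eliminate V X c k M _ _ U E ho hi po pi x adm' xU U3 _ t'x _ (small _ _) set0 false c) => //.
  - by rewrite /M; clear; lia.
  - move=> A AU A1 AnU; have := uns A AU A1 AnU; congr (_ < _ + _).
    by apply: eq_bigr => e _; rewrite crosses_flip.
  - by rewrite sub0set.
  - by move=> e; rewrite inE.
  - by rewrite cE cards0; move: dx; clear; lia.
  - by move: dx dlt; clear; lia.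
  - by rewrite addn0 pox.
  - by move=> e; rewrite inE.
  - move=> y; apply: leq_trans (leq_trans (ltnW (mult x y)) _); last by move: k4; clear; lia.
    apply: subset_leq_card; apply/subsetP => e; rewrite !inE.
    rewrite /flip_fst /flip_snd; case: (t e =P x) => [->|_] /andP[-> /andP[]].
      by move=> _ ->; rewrite ?eqxx ?orbT.
    by move=> -> ->.
  - by rewrite pox pix; clear; lia.
rewrite negb_exists => /forallP nZ.
have cM : 2 * c + k <= M by rewrite /M; clear; lia.
have posz y : y \in U -> (c < po y) || (c < pi y).
  move=> yU; have := nZ y; have [_ h1 h2] := deg y yU; rewrite yU /= negb_and.
  by move: h1 h2; clear; lia.
have [/existsP[e /and3P[eE eO eI]]|] := boolP [exists e in E, ((c < po (s e)) || (c + k <= pi (s e))) &&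
    ((c < pi (t e)) || (c + k <= po (t e)))].
  exact: (@orientable_delete c k M s t U E ho hi po pi e true).
rewrite negb_exists => /forallP nD1.
have [/existsP[e /and3P[eE eO eI]]|] := boolP [exists e in E, ((c < po (t e)) || (c + k <= pi (t e))) &&
    ((c < pi (s e)) || (c + k <= po (s e)))].
  exact: (@orientable_delete c k M s t U E ho hi po pi e false).
rewrite negb_exists => /forallP nD2.
have [e0 e0E] : exists e0, e0 \in E.
  have [x xU] : exists x, x \in U by apply/card_gt0P; apply: ltn_trans U2.
  have := unsaturated_degree adm uns xU U3; have [->|/set0Pn[e eE] _] := eqVneq E set0; last by exists e.
  by rewrite /cut_size big_set0.
have [s0U t0U _] := EU e0 e0E.
(* By now no edge can be directed, while each vertex has a surplus in some direction ([posz]). The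
   two failures at [e0] leave one of its ends with a surplus in a single direction, and the failures
   at the other edges of that end force the same direction on its neighbours. *)
have [po_s|po_s] := boolP ((c < pi (s e0)) || (c + k <= po (s e0))); last first.
  have [_ _ h3] := deg _ s0U.
  apply: (@orientable_out_only c k s t U E ho hi po pi (s e0) k0 ck adm uns (small _ _) mult s0U U3).
  - by move: po_s h3; clear; lia.
  - by move: po_s; clear; lia.
  have px : c < po (s e0).
    by move: po_s (posz _ s0U); rewrite negb_or => /andP[/negPf-> _]; rewrite orbF.
  move=> e eE [] h; have [sU tU _] := EU e eE; rewrite h; split=> //.
    move: (nD1 e); rewrite eE /= h px /= negb_or => /andP[/negPf nn _].
    by have := posz _ tU; rewrite nn orbF.
  move: (nD2 e); rewrite eE /= h px /= negb_or => /andP[/negPf nn _].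
  by have := posz _ sU; rewrite nn orbF.
apply: (orientable_swap adm); have adm' := admissible_swap adm.
have [_ _ h3] := deg _ t0U; have [_ h2 _] := deg _ t0U; have [_ h4 h5] := deg _ s0U.
have nOt : ~~ ((c < po (t e0)) || (c + k <= pi (t e0))).
  by have := nD2 e0; rewrite e0E po_s andbT.
have uns' : unsaturated M s t U E hi ho.
  move=> A AU A1 AnU; have := uns A AU A1 AnU; congr (_ < _ + _).
  by apply: eq_bigr => y _; rewrite addnC.
apply: (@orientable_out_only c k s t U E hi ho pi po (t e0) k0 ck adm' uns' (small _ _) mult t0U U3).
- by move: nOt h2; clear; lia.
- by move: nOt; clear; lia.
have px : c < pi (t e0).
  by move: nOt (posz _ t0U); rewrite negb_or => /andP[/negPf-> _].
move=> e eE [] h; have [sU tU _] := EU e eE; rewrite h; split=> //.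
  move: (nD2 e); rewrite eE /= h px /= andbT negb_or => /andP[/negPf nn _].
  by have := posz _ tU; rewrite nn.
move: (nD1 e); rewrite eE /= h px /= andbT negb_or => /andP[/negPf nn _].
by have := posz _ sU; rewrite nn.
Qed.

(** Without old arcs, the targets are moved into the window starting at c = 4k^2, and 8k^2 + k is 2c
    + k. *)
Theorem modular_orientation k s t U E (p : V -> nat) : 0 < k -> 1 < #|U| ->
  (forall e, e \in E -> [/\ s e \in U, t e \in U & s e != t e]) ->
  (forall A, A \subset U -> A != set0 -> A != U -> 8 * k * k + k <= cut_size s t E A) ->
  \sum_(x in U) p x = #|E| %[mod k] ->
  exists o, forall x, x \in U -> out_degree s t o E x = p x %[mod k].
Proof.
move=> k0 U2 EU cut tot; pose c := 4 * k * k.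
have res x : exists q, (c <= q < c + k) && (q == p x %[mod k]).
  have [q q1 q2] := exists_residue c 0 (p x) k0.
  by exists q; rewrite q1 /=; apply/eqP; rewrite -q2 addn0.
have [po poP] := fin_all_exists res.
have cut1 x : x \in U -> 2 * c + k <= cut_size s t E [set x].
  move=> xU; apply: leq_trans (cut _ _ _ _); rewrite ?sub1set //; first by rewrite /c; clear; lia.
    by apply/set0Pn; exists x; rewrite inE.
  by apply/eqP => h; move: U2; rewrite -h cards1.
have [|o oP] := @orientable_admissible c k s t U E (fun=> 0) (fun=> 0) po
   (fun x => cut_size s t E [set x] - po x) k0 (leqnn _) U2.
- split=> //.
  + move=> x xU; have /andP[/andP[h1 h2] _] := poP x; have := cut1 x xU => h3.
    by rewrite !addn0; split; move: h1 h2 h3; clear; lia.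
  + move=> A AU A1 AnU; rewrite big1 // addn0; apply: leq_trans (cut A AU _ AnU).
      by rewrite /c; clear; lia.
    by rewrite -card_gt0 ltnW.
  + by rewrite big1.
  rewrite [X in _ = _ + X %[mod _]]big1 // addn0 -tot.
  by apply/eqP; rewrite eqn_mod_sum // => x xU; have /andP[_ /eqP] := poP x.
exists o => x xU; have := oP x xU; rewrite add0n => ->.
by have /andP[_ /eqP] := poP x.
Qed.

End ModularOrientation.

(** * Equitable edge colourings yield decompositions *)

Lemma card_bigcup_le (I T : finType) (P : {set I}) (A : I -> {set T}) :
  #|\bigcup_(i in P) A i| <= \sum_(i in P) #|A i|.
Proof.
elim/big_rec2: _ => [|i a b iP ab]; first by rewrite cards0.
by apply: leq_trans (leq_card_setU _ _) _; rewrite leq_add2l.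
Qed.

(** * Valuations avoiding forbidden patterns *)

Section Avoidance.
Variables (G : finType) (q k N : nat) (F : {set {set G * 'I_q}}).
Hypotheses (q_gt0 : 0 < q) (k_gt0 : 0 < k) (qkN : N * 2 ^ k <= q ^ k).
Hypothesis Fk : forall P, P \in F -> #|P| = k.
Hypothesis Finj : forall P, P \in F -> {in P &, injective fst}.
Hypothesis FN : forall x, #|[set P in F | x \in fst @: P]| <= N.

Let valuation := {ffun G -> 'I_q}.

Definition matches (P : {set G * 'I_q}) (v : valuation) := [forall y in P, v y.1 == y.2].

Definition avoiding (S : {set G}) : {set valuation} :=
  [set v | [forall P in F, (fst @: P \subset S) ==> ~~ matches P v]].

(** Membership in [H] does not depend on the values in [D], so changing a matching valuation at the
    points of [Q] produces [q ^ #|Q|] distinct members of [H]. *)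
Lemma card_matches (H : {set valuation}) (D : {set G}) (Q : {set G * 'I_q}) :
  (forall v w : valuation, v \in H -> (forall x, x \notin D -> v x = w x) -> w \in H) ->
  fst @: Q \subset D -> {in Q &, injective fst} ->
  #|[set v in H | matches Q v]| * q ^ #|Q| <= #|H|.
Proof.
move=> Hinv; have [n] := ubnP #|Q|; elim: n Q => // n IHn Q; rewrite ltnS => leQ QD Qinj.
have [->|/set0Pn[y yQ]] := eqVneq Q set0.
  by rewrite cards0 muln1; apply: subset_leq_card; apply/subsetP => v; rewrite inE => /andP[].
have cQ : #|Q| = #|Q :\ y|.+1 by rewrite (cardsD1 y) yQ.
have IH : #|[set v in H | matches (Q :\ y) v]| * q ^ #|Q :\ y| <= #|H|.
  apply: IHn; first by rewrite -cQ.
    by apply: subset_trans (imsetS _ (subD1set _ _)) QD.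
  by move=> u v; rewrite !inE => /andP[_ uQ] /andP[_ vQ]; apply: Qinj.
apply: leq_trans (IH); rewrite cQ expnS mulnA leq_mul2r; apply/orP; right.
pose upd (v : valuation) j : valuation := [ffun x => if x == y.1 then j else v x].
have cq : #|[set: 'I_q]| = q by rewrite cardsT card_ord.
rewrite -[X in _ * X <= _]cq -cardsX.
pose f (p : valuation * 'I_q) := upd p.1 p.2.
rewrite -(@card_in_imset _ _ f).
  apply: subset_leq_card; apply/subsetP => w /imsetP[[v j]]; rewrite !inE /= => /andP[/andP[vH /forallP vQ] _] ->.
  apply/andP; split.
    apply: (Hinv v) => // x xP; rewrite ffunE; case: eqP => // xy; move: xP.
    by rewrite xy (subsetP QD _ (imset_f fst yQ)).
  apply/forallP => z; rewrite !inE; apply/implyP => /andP[zy zQ]; rewrite ffunE.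
  case: (z.1 =P y.1) => [zy1|_]; last by have /implyP/(_ zQ) := vQ z.
  by rewrite (Qinj z y zQ yQ zy1) eqxx in zy.
move=> [v i] [w j]; rewrite !inE /= => /andP[/andP[_ /forallP vQ] _] /andP[/andP[_ /forallP wQ] _].
rewrite /f /= => vw; have ij : i = j by move/ffunP/(_ y.1): vw; rewrite !ffunE eqxx.
rewrite ij; congr pair; apply/ffunP => x; have [->|xy] := eqVneq x y.1.
  have /implyP/(_ yQ)/eqP-> := vQ y; by have /implyP/(_ yQ)/eqP-> := wQ y.
by move/ffunP/(_ x): vw; rewrite !ffunE (negPf xy).
Qed.

Lemma avoiding_sub (S T : {set G}) : S \subset T -> avoiding T \subset avoiding S.
Proof.
move=> ST; apply/subsetP => v; rewrite !inE => /forallP h; apply/forallP => P.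
have := h P; case: (P \in F) => //= /implyP h'; apply/implyP => PS.
by apply: h'; apply: subset_trans ST.
Qed.

(* Rosenfeld's counting: the valuations avoiding [S] minus the domain of a pattern are at most
   2^(k-1) times as many as those avoiding [S], and a fraction q^(-k) of them matches it. *)
Lemma card_avoiding (S : {set G}) (x : G) : x \notin S ->
  #|avoiding S| <= 2 * #|avoiding (x |: S)|.
Proof.
have [n] := ubnP #|S|; elim: n S x => // n IHn S x leS xS; rewrite ltnS in leS.
(* The induction hypothesis read backwards: each point taken out of [S] at most doubles the
   count. *)
have shrink (T : {set G}) : T \subset S -> #|avoiding (S :\: T)| <= 2 ^ #|T| * #|avoiding S|.
  have [m] := ubnP #|T|; elim: m T => // m IHm T leT TS; rewrite ltnS in leT.
  have [->|/set0Pn[t tT]] := eqVneq T set0; first by rewrite setD0 cards0 mul1n.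
  have cT : #|T| = #|T :\ t|.+1 by rewrite (cardsD1 t) tT.
  have tS : t \in S := subsetP TS t tT.
  have e : S :\: (T :\ t) = t |: (S :\: T).
    by apply/setP => z; rewrite !inE; case: (eqVneq z t) => [->|_]; rewrite ?tS ?orbF.
  apply: leq_trans (IHn (S :\: T) t _ _) _.
  - apply: leq_trans leS; rewrite -[X in _ < X](cardsID T S) -[X in X < _]add0n ltn_add2r.
    by apply/card_gt0P; exists t; rewrite inE tS tT.
  - by rewrite inE tT.
  rewrite -e cT expnS -mulnA leq_mul2l; apply: IHm; first by rewrite -cT.
  by apply: subset_trans (subD1set _ _) TS.
pose bad := avoiding S :\: avoiding (x |: S).
have badN : #|bad| * q ^ k <= N * 2 ^ k.-1 * #|avoiding S|.
  pose Fx := [set P in F | (x \in fst @: P) && (fst @: P \subset x |: S)].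
  have badU : bad \subset \bigcup_(P in Fx) [set v in avoiding S | matches P v].
    apply/subsetP => v; rewrite inE [v \in avoiding (_ |: _)]inE negb_forall => /andP[/existsP[P]].
    rewrite 2!negb_imply negbK => /and3P[PF PxS mP] vS; apply/bigcupP; exists P; last by rewrite inE vS.
    rewrite inE PF PxS andbT; apply: contraT => xP.
    have PS : fst @: P \subset S.
      apply/subsetP => z zP; have := subsetP PxS z zP; rewrite !inE => /orP[/eqP zx|//].
      by rewrite -zx zP in xP.
    by move: vS; rewrite inE => /forallP/(_ P); rewrite PF PS mP.
  have each P : P \in Fx -> #|[set v in avoiding S | matches P v]| * q ^ k <= 2 ^ k.-1 * #|avoiding S|.
    rewrite inE => /and3P[PF xP PxS].
    pose T := (fst @: P) :\ x.
    have TS : T \subset S.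
      by apply/subsetP => z; rewrite inE => /andP[zx zP]; have := subsetP PxS z zP; rewrite !inE in zx *;
      rewrite (negPf zx).
    have cT : #|T| = k.-1.
      by rewrite -(Fk PF) -(card_in_imset (Finj PF)) [in RHS](cardsD1 x) xP.
    rewrite -cT; apply: leq_trans (shrink T TS).
    rewrite -[k](Fk PF); apply: leq_trans (card_matches (D := fst @: P) _ (subxx _) (Finj PF)).
      rewrite leq_mul2r; apply/orP; right; apply: subset_leq_card; apply/subsetP => v; rewrite !inE.
      by move=> /andP[vS ->]; rewrite andbT; have := subsetP (avoiding_sub (subsetDl S T)) v; rewrite !inE; apply.
    move=> v w; rewrite !inE => /forallP vH vw; apply/forallP => Q; have := vH Q.
    case: (Q \in F) => //= /implyP h; apply/implyP => QST; apply: contra (h QST) => /forallP mQ.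
    apply/forallP => y; apply/implyP => yQ; have := mQ y; rewrite yQ /= vw //.
    apply/negP => yP; have := subsetP QST _ (imset_f fst yQ); rewrite !inE yP andbT negbK.
    by move=> /andP[/eqP yx]; rewrite yx (negPf xS).
  apply: (@leq_trans (\sum_(P in Fx) 2 ^ k.-1 * #|avoiding S|)).
    apply: (@leq_trans (\sum_(P in Fx) #|[set v in avoiding S | matches P v]| * q ^ k)); last first.
      by apply: leq_sum => P; apply: each.
    rewrite -big_distrl /= leq_mul2r; apply/orP; right.
    by apply: leq_trans (subset_leq_card badU) _; apply: card_bigcup_le.
  rewrite sum_nat_const -mulnA leq_mul2r; apply/orP; right.
  apply: leq_trans (FN x); apply: subset_leq_card; apply/subsetP => P.
  by rewrite !inE => /and3P[-> ->].
have split_card : #|avoiding S| = #|avoiding (x |: S)| + #|bad|.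
  by rewrite -(cardsID (avoiding (x |: S)) (avoiding S)) (setIidPr (avoiding_sub (subsetUr _ _))).
suff : 2 * #|bad| <= #|avoiding S| by move: split_card; clear; lia.
rewrite -(leq_pmul2r (_ : 0 < q ^ k)) ?expn_gt0 ?q_gt0 //.
rewrite -mulnA; apply: (@leq_trans (2 * (N * 2 ^ k.-1 * #|avoiding S|))); first by rewrite leq_mul2l.
have -> : 2 * (N * 2 ^ k.-1 * #|avoiding S|) = N * 2 ^ k * #|avoiding S|.
  by rewrite -(prednK k_gt0) expnS /= !mulnA [2 * N]mulnC.
by rewrite [X in _ <= X]mulnC leq_mul2r qkN orbT.
Qed.

Lemma avoid_patterns : exists v : G -> 'I_q, forall P, P \in F ->
  exists2 y, y \in P & v y.1 != y.2.
Proof.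
have pos (S : {set G}) : 0 < #|avoiding S|.
  have [n] := ubnP #|S|; elim: n S => // n IHn S leS.
  have [->|/set0Pn[x xS]] := eqVneq S set0.
    apply/card_gt0P; exists [ffun=> Ordinal q_gt0]; rewrite inE; apply/forallP => P.
    apply/implyP => PF; apply/implyP; rewrite subset0 => /eqP P0.
    have [y yP] : exists y, y \in P by apply/card_gt0P; rewrite (Fk PF).
    by have := imset_f fst yP; rewrite P0 inE.
  have := @card_avoiding (S :\ x) x; rewrite !inE eqxx setD1K // => /(_ isT).
  have := IHn (S :\ x); rewrite (cardsD1 x) xS in leS; move=> /(_ leS); clear.
  by move: #|_| #|_| => a b; lia.
have /card_gt0P[v] := pos setT; rewrite inE => /forallP vP.
exists v => P PF; have := vP P; rewrite PF subsetT /= negb_forall => /existsP[y].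
by rewrite negb_imply => /andP[yP ne]; exists y.
Qed.

End Avoidance.

(** * Groups of copies and disjoint matchings within a group *)

(** As long as more than [2 * D] elements of a fibre remain, a group of exactly [D] is split off,
    which leaves at least [D]. A group is named by one of its members, so [g] takes its values in
    [T]. *)
Lemma blocks (T W : finType) (p : T -> W) (D : nat) : 0 < D ->
  (forall c, D <= #|[set c' | p c' == p c]|) ->
  exists g : T -> T, (forall c c', g c = g c' -> p c = p c') /\
    forall c, D <= #|[set c' | g c' == g c]| <= 2 * D.
Proof.
move=> D0 pD.
suff [g gP] : exists g : T -> T, forall c, c \in [set: T] ->
   [/\ g c \in [set: T], p (g c) = p c & D <= #|[set c' in [set: T] | g c' == g c]| <= 2 * D].
  exists g; split=> [c c' h|c]; have [_ h1 h2] := gP c (in_setT _).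
    by have [_ h3 _] := gP c' (in_setT _); rewrite -h1 h h3.
  by rewrite (_ : [set c' | _] = [set c' in [set: T] | g c' == g c]) //; apply/setP => z; rewrite !inE.
have : forall c, c \in [set: T] -> D <= #|[set c' in [set: T] | p c' == p c]|.
  by move=> c _; apply: leq_trans (pD c) _; apply: subset_leq_card; apply/subsetP => z; rewrite !inE.
move: [set: T] => E; have [n] := ubnP #|E|; elim: n E => // n IHn E leE pE; rewrite ltnS in leE.
have [->|/set0Pn[x xE]] := eqVneq E set0; first by exists id => c; rewrite inE.
pose Fx := [set c in E | p c == p x].
have xF : x \in Fx by rewrite inE xE eqxx.
have [S [SF xS SD rest]] : exists S : {set T}, [/\ S \subset Fx, x \in S, D <= #|S| <= 2 * D &
    (forall c, c \in E :\: S -> p c = p x -> D <= #|Fx :\: S|)].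
  have [small|big] := leqP #|Fx| (2 * D).
    exists Fx; split=> //; first by rewrite small pE.
    by move=> c; rewrite !inE => /andP[+ cE] pc; rewrite cE pc eqxx.
  have [|S' S'F S'D] := @card_subset_eq T (Fx :\ x) D.-1.
    by move: big; rewrite (cardsD1 x) xF; move: #|_ :\ _| D0 => a; clear; lia.
  have xS' : x \notin S' by apply/negP => /(subsetP S'F); rewrite !inE eqxx.
  have cS : #|x |: S'| = D by rewrite cardsU1 xS' S'D /= add1n prednK.
  have SF : x |: S' \subset Fx by rewrite subUset sub1set xF; apply: subset_trans S'F (subD1set _ _).
  exists (x |: S'); split=> //; first exact: setU11.
    by rewrite cS leqnn; move: D0; clear; lia.
  move=> c _ _; rewrite cardsD (setIidPr SF) cS; move: big; clear; lia.
have SE : S \subset E by apply: subset_trans SF _; apply/subsetP => c; rewrite inE => /andP[].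
have cS : 0 < #|S| by case/andP: SD => h _; apply: leq_trans D0 h.
have [||g gP] := IHn (E :\: S).
- by apply: leq_trans leE; rewrite cardsD (setIidPr SE); have := subset_leq_card SE; move: cS; clear; lia.
- move=> c cES; have cE : c \in E by move: cES; rewrite inE => /andP[].
  have [pcx|pcx] := eqVneq (p c) (p x).
    apply: leq_trans (rest c cES pcx) _; apply: subset_leq_card; apply/subsetP => z.
    by rewrite !inE pcx => /and3P[-> -> ->].
  apply: leq_trans (pE c cE) _; apply: subset_leq_card; apply/subsetP => z.
  rewrite !inE => /andP[zE zc]; rewrite zE zc !andbT; apply: contra pcx => /(subsetP SF).
  by rewrite inE => /andP[_ zx]; rewrite -(eqP zc).
exists (fun c => if c \in S then x else g c) => c cE.
have gne z : z \in E -> z \notin S -> g z != x.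
  move=> zE zS; have [|h _ _] := gP z; first by rewrite inE zS.
  by apply: contraTneq h => ->; rewrite inE xS.
have [cS'|cS'] := boolP (c \in S).
  split=> //.
    by have := subsetP SF c cS'; rewrite inE => /andP[_ /eqP].
  rewrite (_ : [set c' in E | _] = S) //; apply/setP => z; rewrite inE.
  have [zS|zS] := boolP (z \in S); first by rewrite (subsetP SE) // eqxx.
  by case: (boolP (z \in E)) => //= zE; apply/negbTE/gne.
have cES : c \in E :\: S by rewrite inE cS'.
have [h1 h2 h3] := gP c cES; split=> //; first by move: h1; rewrite inE => /andP[].
rewrite (_ : [set c' in E | _] = [set c' in E :\: S | g c' == g c]) //; apply/setP => z; rewrite !inE.
case: (boolP (z \in S)) => zS //=; rewrite ?andbF //.
by rewrite eq_sym (negPf (gne c cE cS')) andbF.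
Qed.

(** Hall's condition, by [rado] with cardinality as the rank: up to half of the rows are dominated
    by a single row, and more than half of them meet every column. *)
Lemma dense_matching (T : finType) (C : {set T}) (R : rel T) :
  (forall c, c \in C -> #|C| <= 2 * #|[set d in C | R c d]|) ->
  (forall d, d \in C -> #|C| <= 2 * #|[set c in C | R c d]|) ->
  exists f : T -> T, forall c, c \in C ->
    [/\ f c \in C, R c (f c) & forall c', c' \in C -> f c = f c' -> c = c'].
Proof.
move=> row col.
have [|||J JC|F [F1 F2]] := @rado T T (fun A => #|A|) C (fun c => [set d in C | R c d]).
- by move=> A B; apply: subset_leq_card.
- by move=> A B; rewrite cardsUI.
- move=> c cC; rewrite -card_gt0; have := row c cC.
  have : 0 < #|C| by apply/card_gt0P; exists c.
  by move: #|_| #|_| => a b; lia.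
- have [->|/set0Pn[c cJ]] := eqVneq J set0; first by rewrite cards0.
  have cC := subsetP JC c cJ.
  have [small|big] := leqP (2 * #|J|) #|C|.
    apply: (@leq_trans #|[set d in C | R c d]|).
      by have := row c cC; move: small; move: #|J| #|C| (#|_|) => x y z; lia.
    by apply: subset_leq_card; apply: (bigcup_sup c).
  apply: leq_trans (subset_leq_card JC) _; apply: subset_leq_card; apply/subsetP => d dC.
  have [/existsP[c' /andP[c'J Rd]]|no] := boolP [exists c' in J, R c' d].
    by apply/bigcupP; exists c' => //; rewrite inE dC.
  exfalso; move: big; rewrite ltnNge; apply/negP/negPn.
  have := col d dC; have : #|J| + #|[set c0 in C | R c0 d]| <= #|C|.
    rewrite -(cardsID J C) (setIidPr JC) leq_add2l; apply: subset_leq_card; apply/subsetP => z.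
    rewrite !inE => /andP[zC zd]; rewrite zC andbT; apply: contraL zd => zJ.
    by move: no; rewrite negb_exists => /forallP/(_ z); rewrite zJ.
  by move: #|J| #|C| (#|_|) => x y z; lia.
have pre c : exists d, (c \in C) ==> (F c == [set d]).
  have [cC|] := boolP (c \in C); last by exists c.
  by have [_ /eqP/cards1P[d ->]] := F1 c cC; exists d; rewrite eqxx.
have [f fP] := fin_all_exists pre.
have {}fP c : c \in C -> F c = [set f c] by move=> cC; have := fP c; rewrite cC => /eqP.
exists f => c cC; have [/subsetP h _] := F1 c cC.
have := h (f c); rewrite (fP c cC) inE eqxx => /(_ isT); rewrite inE => /andP[-> ->]; split=> //.
move=> c' cC' ff; apply/eqP; apply: contraT => cc.
have := F2 [set c; c']; rewrite subUset !sub1set cC cC' => /(_ isT).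
rewrite cards2 cc bigcup_setU !big_set1 (fP c cC) (fP c' cC') ff setUid cards1.
by [].
Qed.

(** Forbidding the earlier matchings costs each row and each column at most [q] entries, so at least
    half of the entries remain for a further perfect matching. *)
Lemma disjoint_matchings (T : finType) (C : {set T}) (R : rel T) (a q : nat) :
  (forall c, c \in C -> #|[set d in C | ~~ R c d]| <= a) ->
  (forall d, d \in C -> #|[set c in C | ~~ R c d]| <= a) ->
  2 * (a + q) <= #|C| ->
  exists f : nat -> T -> T, forall j, j < q -> forall c, c \in C ->
    [/\ f j c \in C, R c (f j c), forall c', c' \in C -> f j c = f j c' -> c = c' &
        forall i, i < q -> f i c = f j c -> i = j].
Proof.
move=> row col; elim: q => [|q IHq] hq; first by exists (fun _ => id).
have [|f fP] := IHq; first by apply: leq_trans hq; clear; lia.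
pose R' c d := R c d && [forall j : 'I_q, f j c != d].
have cC (P Q : pred T) : #|[set c in C | P c || Q c]| <= #|[set c in C | P c]| + #|[set c in C | Q c]|.
  apply: leq_trans (leq_card_setU _ _); apply: subset_leq_card; apply/subsetP => z.
  by rewrite !inE => /andP[->].
have half (P : pred T) : #|[set c in C | ~~ P c]| <= a + q -> #|C| <= 2 * #|[set c in C | P c]|.
  have : #|[set c in C | P c]| + #|[set c in C | ~~ P c]| = #|C|.
    rewrite -(cardsID [set c | P c] C); congr (_ + _); apply: eq_card => z; rewrite !inE //.
    by rewrite andbC.
  by move: hq; move: #|_| #|_| #|_| => x y z; lia.
have [g gP] : exists g : T -> T, forall c, c \in C ->
    [/\ g c \in C, R' c (g c) & forall c', c' \in C -> g c = g c' -> c = c'].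
  apply: dense_matching => c cc; apply: half.
    apply: (@leq_trans #|[set d in C | ~~ R c d || [exists j : 'I_q, f j c == d]]|).
      apply: subset_leq_card; apply/subsetP => d; rewrite !inE => /andP[->].
      by rewrite negb_and negb_forall => /orP[->//|/existsP[j]]; rewrite negbK => h;
      apply/orP; right; apply/existsP; exists j.
    apply: leq_trans (cC _ _) _; apply: leq_add; first exact: row.
    apply: (@leq_trans #|[set f j c | j : 'I_q]|).
      by apply: subset_leq_card; apply/subsetP => d; rewrite inE => /andP[_ /existsP[j /eqP <-]]; apply: imset_f.
    by apply: leq_trans (leq_imset_card _ _) _; rewrite card_ord.
  apply: (@leq_trans #|[set d in C | ~~ R d c || [exists j : 'I_q, f j d == c]]|).
    apply: subset_leq_card; apply/subsetP => d; rewrite !inE => /andP[->].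
    by rewrite negb_and negb_forall => /orP[->//|/existsP[j]]; rewrite negbK => h;
    apply/orP; right; apply/existsP; exists j.
  apply: leq_trans (cC _ _) _; apply: leq_add; first exact: col.
  apply: (@leq_trans #|\bigcup_(j in [set: 'I_q]) [set d in C | f j d == c]|).
    apply: subset_leq_card; apply/subsetP => d; rewrite inE => /andP[dC /existsP[j fj]].
    by apply/bigcupP; exists j => //; rewrite inE dC.
  apply: leq_trans (card_bigcup_le _ _) _.
    apply: (@leq_trans (\sum_(j in [set: 'I_q]) 1)); last by rewrite sum1_card cardsT card_ord.
    apply: leq_sum => j _; rewrite leqNgt; apply/negP => /card_gt1P[u [v]].
    rewrite !inE => -[/andP[uC /eqP fu] /andP[vC /eqP fv] uv].
    by have [_ _ h _] := fP j (ltn_ord j) u uC; rewrite (h v vC) ?eqxx ?fu ?fv in uv.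
exists (fun j => if j < q then f j else g) => j jq c cc.
have [gC R'g ginj] := gP c cc; have /andP[Rg /forallP new] := R'g.
have [jq'|jq'] := ltnP j q.
  have [h1 h2 h3 h4] := fP j jq' c cc; split=> // i iq.
  case: ltnP => iq'; first exact: h4.
  by move=> h; have := new (Ordinal jq'); rewrite /= -h eqxx.
have ej : j = q by move: jq jq'; clear; lia.
split=> // i iq; case: ltnP => iq'.
  by move=> h; have := new (Ordinal iq'); rewrite /= h eqxx.
by move=> _; rewrite ej; move: iq iq'; clear; lia.
Qed.

Lemma prod_le_expn (T : finType) (A : {set T}) (F : T -> nat) K :
  (forall c, c \in A -> F c <= K) -> \prod_(c in A) F c <= K ^ #|A|.
Proof. by move=> h; rewrite -prod_nat_const; apply: leq_prod. Qed.

(** A forbidden pattern consists of [k] elements of one [B ev] and a value in [J ev] for each.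
    Within a group, different elements do not share a value for the event, so [k] elements that
    realise it lie in [k] different groups, as a pattern requires. Through one group pass at most
    [L] events, with at most [2 ^ M] subsets and [K ^ k] systems of values for each. *)
Lemma spread_choice (T Ev : finType) (g : T -> T) (q k K L M : nat)
    (B : Ev -> {set T}) (J : Ev -> T -> {set 'I_q}) :
  0 < q -> 0 < k ->
  (forall ev, #|B ev| <= M) ->
  (forall ev c, c \in B ev -> #|J ev c| <= K) ->
  (forall ev c c' j, c \in B ev -> c' \in B ev -> g c = g c' -> j \in J ev c -> j \in J ev c' -> c = c') ->
  (forall x, #|[set ev | [exists c in B ev, (g c == x) && (J ev c != set0)]]| <= L) ->
  L * 2 ^ M * K ^ k * 2 ^ k <= q ^ k ->
  exists v : T -> 'I_q, forall ev, #|[set c in B ev | v (g c) \in J ev c]| < k.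
Proof.
move=> q0 k0 BM JK dist rel num.
pose j0 := Ordinal q0.
pose Phi (A : {set T}) (j : {ffun T -> 'I_q}) : {set T * 'I_q} := [set (g c, j c) | c in A].
pose F := [set P : {set T * 'I_q} | [&& #|P| == k, dinjectiveb fst P &
  [exists ev, [exists A : {set T}, [&& A \subset B ev, #|A| == k &
     [exists j : {ffun T -> 'I_q}, (j \in pfamily j0 (mem A) (fun c => mem (J ev c))) && (P == Phi A j)]]]]]].
have [|||v vP] := @avoid_patterns T q k (L * 2 ^ M * K ^ k) F q0 k0 num.
- by move=> P; rewrite inE => /and3P[/eqP].
- by move=> P; rewrite inE => /and3P[_ /dinjectiveP].
- move=> x; pose Rel := [set ev | [exists c in B ev, (g c == x) && (J ev c != set0)]].
  pose PF ev (A : {set T}) := [set j : {ffun T -> 'I_q} | j \in pfamily j0 (mem A) (fun c => mem (J ev c))].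
  pose As ev := [set A in powerset (B ev) | #|A| == k].
  apply: (@leq_trans #|\bigcup_(ev in Rel) \bigcup_(A in As ev) Phi A @: PF ev A|).
    apply: subset_leq_card; apply/subsetP => P; rewrite !inE => /andP[/and3P[_ _ /existsP[ev /existsP[A]]]].
    move=> /and3P[AB Ak /existsP[j /andP[jF /eqP ->]]] xP.
    have /pfamilyP[_ jJ] := jF.
    apply/bigcupP; exists ev.
      rewrite inE; move: xP => /imsetP[y /imsetP[c cA ->] /= xg].
      apply/existsP; exists c; rewrite (subsetP AB) // -xg eqxx /=.
      by apply/set0Pn; exists (j c); apply: jJ.
    apply/bigcupP; exists A; first by rewrite !inE AB.
    by apply: imset_f; rewrite inE.
  apply: leq_trans (card_bigcup_le _ _) _.
  apply: (@leq_trans (\sum_(ev in Rel) 2 ^ M * K ^ k)); last first.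
    by rewrite sum_nat_const -mulnA leq_mul2r rel orbT.
  apply: leq_sum => ev _; apply: leq_trans (card_bigcup_le _ _) _.
  apply: (@leq_trans (\sum_(A in As ev) K ^ k)).
    apply: leq_sum => A; rewrite !inE => /andP[AB /eqP Ak].
    apply: leq_trans (leq_imset_card _ _) _; rewrite cardsE card_pfamily.
    rewrite -Ak foldrE big_image /=; apply: prod_le_expn => c cA.
    by apply: leq_trans (JK ev c (subsetP AB c cA)).
  rewrite sum_nat_const leq_mul2r; apply/orP; right.
  apply: (@leq_trans #|powerset (B ev)|).
    by apply: subset_leq_card; apply/subsetP => A; rewrite inE => /andP[].
  by rewrite card_powerset leq_exp2l.
exists v => ev; rewrite ltnNge; apply/negP => big.
have [A AB Ak] := card_subset_eq big.
have AB' : A \subset B ev by apply: subset_trans AB _; apply/subsetP => c; rewrite inE => /andP[].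
have AJ c : c \in A -> v (g c) \in J ev c by move=> /(subsetP AB); rewrite inE => /andP[].
pose j : {ffun T -> 'I_q} := [ffun c => if c \in A then v (g c) else j0].
have ginj : {in A &, injective g}.
  move=> c c' cA cA' gg; apply: (dist ev c c' (v (g c))) => //; try exact: (subsetP AB').
    exact: AJ.
  by rewrite gg; apply: AJ.
have PE : Phi A j = [set (g c, v (g c)) | c in A].
  by apply: eq_in_imset => c cA; rewrite ffunE cA.
have [|y yP] := vP (Phi A j).
  rewrite inE; apply/and3P; split.
  - rewrite PE card_in_imset ?Ak // => c c' cA cA' [gg _]; exact: ginj.
  - apply/dinjectiveP => y z; rewrite PE => /imsetP[c cA ->] /imsetP[c' cA' ->] /= gg.
    by rewrite gg.
  apply/existsP; exists ev; apply/existsP; exists A; rewrite AB' Ak eqxx /=.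
  apply/existsP; exists j; rewrite eqxx andbT; apply/pfamilyP; split.
    by apply/supportP => c cA; rewrite ffunE (negPf cA).
  by move=> c cA; rewrite ffunE cA; apply: AJ.
by move: yP; rewrite PE => /imsetP[c cA ->] /=; rewrite eqxx.
Qed.

Section Shuffle.
Variables (T VT V : finType) (P : {set VT}) (F : T -> VT -> V) (g : VT -> T -> T) (t : VT).
Variables (h : T -> V) (g0 : T -> T) (D q k K : nat).
Hypotheses (tP : t \in P) (k_gt1 : 1 < k) (q_gt0 : 0 < q) (K_gt0 : 0 < K).
Hypothesis h_inj : forall c c', F c t = F c' t -> h c = h c' -> c = c'.
Hypothesis h_neq : forall c, h c != F c t.
Hypothesis g_same : forall c c', g t c = g t c' -> F c t = F c' t.
Hypothesis g0_same : forall c c', g0 c = g0 c' -> h c = h c'.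
Hypothesis g_ge : forall c, D <= #|[set c' | g t c' == g t c]|.
Hypothesis g_le : forall s x, s \in P -> #|[set c | g s c == x]| <= 2 * D.
Hypothesis g0_le : forall x, #|[set c | g0 c == x]| <= 2 * D.
Hypothesis spread : forall s s' x w, s \in P -> s' \in P -> s != s' ->
  #|[set c | (g s c == x) && (F c s' == w)]| <= K.
Hypothesis room : 2 * (#|VT| * K + q) <= D.
Hypothesis num : 2 * (#|VT| * ((2 * D) * (2 * D))) * 2 ^ (2 * D) * K ^ k * 2 ^ k <= q ^ k.

(** The copy [c] trades its prospective vertex [h c] for [h (sg c)], where [sg c] belongs to its
    group at [t]. Conflicts within a group are few: for each role, at most one prospective vertex
    already occupies it in a given copy, as [h] is injective on the group, and at most [K] copies
    have a given vertex there, by [spread]. So each group has [q] disjoint matchings free of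
    conflicts, and [spread_choice] selects one for each group. *)
Lemma shuffle : exists sg : T -> T,
  [/\ injective sg, forall c, g t (sg c) = g t c,
      forall c s, s \in P -> h (sg c) != F c s,
      forall s x w, s \in P -> #|[set c | (g s c == x) && (h (sg c) == w)]| <= k &
      forall s x w, s \in P -> #|[set c | (g0 (sg c) == x) && (F c s == w)]| <= k].
Proof.
pose R c d := [forall s in P, h d != F c s].
pose C x := [set c | g t c == x].
have VT0 : 0 < #|VT| by apply/card_gt0P; exists t.
have row x c : c \in C x -> #|[set d in C x | ~~ R c d]| <= #|VT| * K.
  move=> cC; apply: (@leq_trans #|VT|); last by rewrite leq_pmulr.
  apply: (@leq_trans #|\bigcup_(s in P :\ t) [set d in C x | h d == F c s]|).
    apply: subset_leq_card; apply/subsetP => d; rewrite !inE => /andP[dC].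
    rewrite negb_forall => /existsP[s]; rewrite negb_imply negbK => /andP[sP hd].
    apply/bigcupP; exists s; last by rewrite !inE dC.
    rewrite !inE sP andbT; apply: contraTneq hd => ->.
    rewrite (g_same (c' := d)) //; rewrite inE in cC.
    by rewrite (eqP cC) (eqP dC).
  apply: leq_trans (card_bigcup_le _ _) _.
  apply: (@leq_trans (\sum_(s in P :\ t) 1)); last by rewrite sum1_card max_card.
  apply: leq_sum => s _; rewrite leqNgt; apply/negP => /card_gt1P[u [v]].
  rewrite !inE => -[/andP[/eqP uC /eqP fu] /andP[/eqP vC /eqP fv]] /negP; apply; apply/eqP.
  by apply: h_inj; [apply: g_same; rewrite uC vC|rewrite fu fv].
have col x d : d \in C x -> #|[set c in C x | ~~ R c d]| <= #|VT| * K.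
  move=> dC.
  apply: (@leq_trans #|\bigcup_(s in P :\ t) [set c | (g t c == x) && (F c s == h d)]|).
    apply: subset_leq_card; apply/subsetP => c; rewrite !inE => /andP[cC].
    rewrite negb_forall => /existsP[s]; rewrite negb_imply negbK => /andP[sP hd].
    apply/bigcupP; exists s; last by rewrite !inE cC eq_sym.
    rewrite !inE sP andbT; apply: contraTneq hd => ->.
    rewrite (g_same (c' := d)) //; rewrite inE in dC.
    by rewrite (eqP cC) (eqP dC).
  apply: leq_trans (card_bigcup_le _ _) _.
  apply: (@leq_trans (\sum_(s in P :\ t) K)).
    by apply: leq_sum => s; rewrite !inE => /andP[st sP]; apply: spread; rewrite // eq_sym.
  by rewrite sum_nat_const leq_mul2r max_card orbT.
have match_x x : exists f : nat -> T -> T, forall j, j < q -> forall c, c \in C x ->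
    [/\ f j c \in C x, R c (f j c), forall c', c' \in C x -> f j c = f j c' -> c = c' &
        forall i, i < q -> f i c = f j c -> i = j].
  have [C0|/set0Pn[c cC]] := eqVneq (C x) set0.
    by exists (fun _ => id) => j _ c; rewrite C0 inE.
  apply: (disjoint_matchings (row x) (col x)).
  by apply: leq_trans room _; move: cC; rewrite inE => /eqP <-; apply: g_ge.
pose matchings_ok x (f : {ffun 'I_q -> {ffun T -> T}}) := forall (j : 'I_q) c, c \in C x ->
    [/\ f j c \in C x, R c (f j c), forall c', c' \in C x -> f j c = f j c' -> c = c' &
        forall i, f i c = f j c -> i = j].
have [fm fmP] : exists fm : T -> {ffun 'I_q -> {ffun T -> T}}, forall x, matchings_ok x (fm x).
  apply: fin_all_exists => x; have [f fP] := match_x x.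
  exists [ffun j : 'I_q => [ffun c => f j c]] => j c cC.
  have [h1 h2 h3 h4] := fP j (ltn_ord j) c cC; rewrite !ffunE; split=> //.
    by move=> c' cC'; rewrite !ffunE; apply: h3.
  by move=> i; rewrite !ffunE => /(h4 _ (ltn_ord i)) ij; apply: val_inj.
pose f (j : 'I_q) c := fm (g t c) j c.
have cC c : c \in C (g t c) by rewrite inE.
have fg j c : g t (f j c) = g t c.
  by have [h1 _ _ _] := fmP (g t c) j c (cC c); move: h1; rewrite inE => /eqP.
have fR j c : R c (f j c) by have [_ hh _ _] := fmP (g t c) j c (cC c).
have finj j c c' : g t c = g t c' -> f j c = f j c' -> c = c'.
  move=> gg; have [_ _ hh _] := fmP (g t c) j c (cC c); rewrite /f -gg.
  by apply: hh; rewrite inE gg.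
have fdis i j c : f i c = f j c -> i = j.
  by have [_ _ _ hh] := fmP (g t c) j c (cC c); apply: hh.
have hin c c' : g t c = g t c' -> h c = h c' -> c = c' by move=> /g_same; apply: h_inj.
(* an event (b, s, x, w) is the coincidence of a new vertex of the copies in a group with a
   prescribed vertex w: b tells whether x is an old group or a group at the new position *)
pose Ev : finType := (bool * VT * T * V)%type.
pose B (ev : Ev) : {set T} := let: (b, s, x, w) := ev in
  if (s \in P :\ t) then (if b then [set c | g s c == x] else [set d | g0 d == x]) else set0.
pose J (ev : Ev) (c : T) : {set 'I_q} := let: (b, s, x, w) := ev in
  if b then [set j | h (f j c) == w]
  else [set j | [exists d, [&& g t d == g t c, f j d == c & F d s == w]]].
have [|||||v vP] := @spread_choice T Ev (g t) q k K (2 * (#|VT| * ((2 * D) * (2 * D)))) (2 * D) B J q_gt0 (ltnW k_gt1).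
- move=> [[[b s] x] w] /=; case: ifP => [|_]; last by rewrite cards0.
  by rewrite inE => /andP[_ sP]; case: b; [apply: g_le|apply: g0_le].
- move=> [[[b s] x] w] c /=; case: ifP => [|_]; last by rewrite inE.
  rewrite !inE => /andP[st sP]; case: b => cB.
    apply: leq_trans K_gt0; rewrite leqNgt; apply/negP => /card_gt1P[i [j]].
    rewrite !inE => -[/eqP hi /eqP hj] /negP; apply; apply/eqP; apply: (fdis _ _ c).
    by apply: hin; rewrite ?fg // hi hj.
  (* Different matchings send different copies to [c], so the values [j] are counted by copies of
     the group with [w] in role [s], of which there are at most [K]. *)
  pose pre j := [pick d | [&& g t d == g t c, f j d == c & F d s == w]].
  have preP j : j \in [set j | [exists d, [&& g t d == g t c, f j d == c & F d s == w]]] ->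
      exists d, [/\ pre j = Some d, g t d = g t c, f j d = c & F d s = w].
    rewrite inE => /existsP[d dP]; rewrite /pre; case: pickP => [d'|/(_ d)]; last by rewrite dP.
    by move=> /and3P[/eqP ? /eqP ? /eqP ?]; exists d'.
  rewrite -(@card_in_imset _ _ pre).
    apply: leq_trans (@spread _ _ (g t c) w tP sP _); last by rewrite eq_sym.
    have Si : injective (@Some T) by move=> ? ? [].
    rewrite -(card_imset _ Si); apply: subset_leq_card; apply/subsetP => o /imsetP[j /preP[d [-> g1 f1 F1]] ->].
    by apply: imset_f; rewrite inE g1 F1 !eqxx.
  move=> i j /preP[d [-> g1 f1 F1]] /preP[d' [-> g2 f2 F2]] [dd].
  by apply: (fdis _ _ d); rewrite f1 dd f2.
- move=> [[[b s] x] w] c c' j /=; case: ifP => [_|_]; last by rewrite inE.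
  case: b; rewrite !inE => cB cB' gg.
    by move=> /eqP h1 /eqP h2; apply: (finj j) => //; apply: hin; rewrite ?fg // h1 h2.
  by move=> _ _; apply: hin => //; apply: g0_same; rewrite (eqP cB) (eqP cB').
- move=> x.
  (* An event that involves the group [x] is determined by its kind, a role and two members [c], [d]
     of the group, whence the value given to [L]. *)
  pose E1 (s : VT) (c d : T) : {set Ev} := [set (true, s, g s c, h d); (false, s, g0 c, F d s)].
  apply: (@leq_trans #|\bigcup_(s in [set: VT]) \bigcup_(c in C x) \bigcup_(d in C x) E1 s c d|).
    apply: subset_leq_card; apply/subsetP => -[[[b s] y] w]; rewrite inE => /existsP[c] /and3P[].
    rewrite /B /J; case: ifP => [_|_]; last by rewrite inE.
    case: b; rewrite !inE => /eqP gy gx /set0Pn[j]; rewrite inE.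
      move=> /eqP hw; apply/bigcupP; exists s; first by rewrite inE.
      apply/bigcupP; exists c; first by rewrite inE.
      by apply/bigcupP; exists (f j c); rewrite !inE ?fg // gy hw eqxx.
    move=> /existsP[d /and3P[/eqP g1 f1 /eqP F1]]; apply/bigcupP; exists s; first by rewrite inE.
    apply/bigcupP; exists c; first by rewrite inE.
    by apply/bigcupP; exists d; rewrite !inE ?g1 // gy F1 eqxx orbT.
  apply: leq_trans (card_bigcup_le _ _) _.
  apply: (@leq_trans (\sum_(s in [set: VT]) (2 * D) * ((2 * D) * 2))); last first.
    by rewrite sum_nat_const cardsT; move: #|VT| => m; clear; nia.
  apply: leq_sum => s _; apply: leq_trans (card_bigcup_le _ _) _.
  apply: (@leq_trans (\sum_(c in C x) (2 * D) * 2)); last by rewrite sum_nat_const leq_mul2r g_le ?orbT.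
  apply: leq_sum => c _; apply: leq_trans (card_bigcup_le _ _) _.
  apply: (@leq_trans (\sum_(d in C x) 2)); last by rewrite sum_nat_const leq_mul2r g_le ?orbT.
  by apply: leq_sum => d _; rewrite cards2; case: (_ != _).
- exact: num.
pose sg c := f (v (g t c)) c.
have sgg c : g t (sg c) = g t c by rewrite /sg fg.
have sginj : injective sg.
  move=> c c' e; have gg : g t c = g t c' by rewrite -sgg e sgg.
  by apply: (finj (v (g t c))) => //; rewrite -/(sg c) e /sg gg.
exists sg; split=> //.
- by move=> c s sP; have /forallP/(_ s) := fR (v (g t c)) c; rewrite sP.
- move=> s x w sP; have [st|st] := eqVneq s t.
    apply: leq_trans (ltnW k_gt1); rewrite leqNgt st; apply/negP => /card_gt1P[c [c']].
    rewrite !inE => -[/andP[/eqP g1 /eqP h1] /andP[/eqP g2 /eqP h2]] /negP; apply; apply/eqP.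
    by apply: sginj; apply: hin; rewrite ?sgg ?g1 ?g2 // h1 h2.
  have := vP (true, s, x, w); rewrite /= !inE st sP /= => /ltnW; apply: leq_trans.
  by apply: subset_leq_card; apply/subsetP => c; rewrite !inE.
move=> s x w sP; have [st|st] := eqVneq s t.
  apply: leq_trans (ltnW k_gt1); rewrite leqNgt st; apply/negP => /card_gt1P[c [c']].
  rewrite !inE => -[/andP[/eqP g1 /eqP h1] /andP[/eqP g2 /eqP h2]] /negP; apply; apply/eqP.
  apply: sginj; apply: h_inj; last by apply: g0_same; rewrite g1 g2.
  by rewrite (g_same (sgg c)) (g_same (sgg c')) h1 h2.
have := vP (false, s, x, w); rewrite /= !inE st sP /= => /ltnW; apply: leq_trans.
rewrite -(card_imset _ sginj); apply: subset_leq_card; apply/subsetP => d /imsetP[c].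
rewrite !inE => /andP[g1 F1] ->; rewrite g1 /=; apply/existsP; exists c.
by rewrite sgg !eqxx.
Qed.

End Shuffle.

(** * Growing the copies along the tree *)

Lemma connect_crossing (V : finType) (e : rel V) (P : {set V}) (a b : V) :
  connect e a b -> a \in P -> b \notin P -> exists x y, [/\ x \in P, y \notin P & e x y].
Proof.
move=> /connectP[p]; elim: p a => [|z p IHp] a /=; first by move=> _ -> ->.
move=> /andP[az zp] bl aP bP; have [zP|zP] := boolP (z \in P); last by exists a, z.
exact: IHp zp bl zP bP.
Qed.

(** The subtree grows along edges that leave it. A second neighbour of the new vertex would close a
    cycle through a path inside the subtree, which is why the induction keeps the subtree connected
    by its own edges. *)
Lemma tree_ind (V : finType) (e : rel V) (Q : {set V} -> Prop) : is_tree e ->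
  (forall x, Q [set x]) ->
  (forall (P : {set V}) y x, y \in P -> x \notin P -> e y x ->
     (forall z, z \in P -> e z x -> z = y) -> Q P -> Q (x |: P)) ->
  Q setT.
Proof.
case=> [[esym eirr] [V0 [con acy]]] Q1 Qstep.
pose inP (P : {set V}) := [rel u v | [&& e u v, u \in P & v \in P]].
have [x0 _] : exists x : V, x \in V by apply/card_gt0P.
have grow (P : {set V}) : Q P -> P != set0 -> (forall u v, u \in P -> v \in P -> connect (inP P) u v) -> Q setT.
  have [n] := ubnP #|~: P|; elim: n P => // n IHn P ltn QP P0 conP; rewrite ltnS in ltn.
  have [<-//|/eqP PT] := P =P setT.
  have /set0Pn[a aP] := P0.
  have [b bP] : exists b, b \notin P.
    have [/existsP[b bP]|no] := boolP [exists b, b \notin P]; first by exists b.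
    by case/eqP: PT; apply/setP => b; rewrite inE; move: no; rewrite negb_exists => /forallP/(_ b); rewrite negbK.
  have [y [x [yP xP yx]]] := connect_crossing (con a b) aP bP.
  have uniq_nb z : z \in P -> e z x -> z = y.
    move=> zP zx; apply/eqP; apply: contraT => zy.
    have /connectP[p0 p0P lastp0] := conP y z yP zP.
    move: lastp0; case/shortenP: p0P => p pP pU _ lastp.
    have pin : all (mem P) (y :: p).
      rewrite /= yP /=; elim: p y pP {yP yx zy pU lastp} => //= w p IHp y.
      by move=> /andP[/and3P[_ _ wP] wp]; rewrite wP /=; apply: IHp wp.
    have pe : path e y p by apply: sub_path pP => u v /and3P[].
    have sz : 2 < size (x :: y :: p) by case: (p) lastp zy => //= ->; rewrite eqxx.
    have un : uniq (x :: y :: p).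
      rewrite cons_uniq pU andbT; apply/negP => xyp; have /allP/(_ x xyp) := pin.
      by rewrite /= (negPf xP).
    have := acy _ sz un; rewrite /= rcons_path pe -lastp esym yx zx; exact.
  apply: (IHn (x |: P)).
  - apply: leq_trans ltn; apply: proper_card; rewrite properEneq; apply/andP; split.
      apply/eqP => h; have : x \in ~: P by rewrite inE.
      by rewrite -h !inE eqxx.
    by rewrite setCS subsetUr.
  - exact: Qstep uniq_nb QP.
  - by apply/set0Pn; exists x; apply: setU11.
  have sub u v : connect (inP P) u v -> connect (inP (x |: P)) u v.
    apply: connect_sub => a' b' /and3P[h1 h2 h3]; apply: connect1.
    by rewrite /= h1 !inE h2 h3 !orbT.
  have xy1 : connect (inP (x |: P)) x y by apply: connect1; rewrite /= esym yx !inE eqxx yP orbT.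
  have yx1 : connect (inP (x |: P)) y x by apply: connect1; rewrite /= yx !inE eqxx yP orbT.
  move=> u v; rewrite !in_setU1 => /orP[/eqP->|uP] /orP[/eqP->|vP].
  - exact: connect0.
  - exact: connect_trans xy1 (sub _ _ (conP _ _ yP vP)).
  - exact: connect_trans (sub _ _ (conP _ _ uP yP)) yx1.
  - exact: sub (conP _ _ uP vP).
apply: (grow [set x0]) => //; first by apply/set0Pn; exists x0; rewrite inE.
by move=> u v; rewrite !inE => /eqP-> /eqP->; apply: connect0.
Qed.

(** Read backwards in [parameters]: the exponent belonging to [i] vertices is exponential in the one
    belonging to i + 1. The start [M + 2] makes [M * kap i] at most a quarter of D. *)
Fixpoint tower (M j : nat) : nat := if j is j'.+1 then 3 + 4 * 2 ^ tower M j' else M + 2.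

(* [kap i] bounds, for partial copies on [i] tree vertices, the number of copies of a group
   that meet a given vertex in a given role; [q] is the number of disjoint matchings. *)
Lemma parameters M : 0 < M -> exists D q (kap : nat -> nat), [/\ 0 < q, 0 < D &
  forall i, i < M -> [/\ 1 < kap i.+1, 0 < kap i, kap i <= kap i.+1, 2 * (M * kap i + q) <= D &
   2 * (M * ((2 * D) * (2 * D))) * 2 ^ (2 * D) * kap i ^ kap i.+1 * 2 ^ kap i.+1 <= q ^ kap i.+1]].
Proof.
move=> M0.
have towS j : tower M j < tower M j.+1.
  have : tower M j < 2 ^ tower M j by apply: ltn_expl.
  by rewrite /=; move: (2 ^ _) => a; clear; lia.
have tow_le i j : i <= j -> tower M i <= tower M j.
  elim: j => [|j IHj]; first by rewrite leqn0 => /eqP->.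
  by rewrite leq_eqVlt => /orP[/eqP->//|]; rewrite ltnS => /IHj h; apply: leq_trans h (ltnW (towS j)).
pose a := tower M M + M + 3.
pose kap i := 2 ^ (a - tower M (M - i)).
have twolt j : j <= M -> tower M j < a.
  by move=> /tow_le; rewrite /a; clear; lia.
have a3 : M + 3 <= a by rewrite /a; clear; lia.
exists (2 ^ a), (2 ^ (a - 2)), kap; split; rewrite ?expn_gt0 // => i iM.
have tM : tower M (M - i) < a by apply: twolt; clear; lia.
have tM' : tower M (M - i.+1) < a by apply: twolt; clear; lia.
have ES : M - i = (M - i.+1).+1 by move: iM; clear; lia.
have tS : tower M (M - i) = 3 + 4 * 2 ^ tower M (M - i.+1) by rewrite ES.
have M2 : M + 2 <= tower M (M - i) by apply: (tow_le 0).
split.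
- by rewrite /kap -{1}(expn0 2) ltn_exp2l //; move: tM'; clear; lia.
- by rewrite expn_gt0.
- by rewrite /kap leq_exp2l //; apply: leq_sub2l; apply: tow_le; clear; lia.
- have : M * kap i <= 2 ^ (a - 2).
    apply: (@leq_trans (2 ^ M * kap i)); first by rewrite leq_mul2r ltnW ?orbT // ltn_expl.
    by rewrite /kap -expnD leq_exp2l //; move: M2 tM; clear; lia.
  have -> : 2 ^ a = 4 * 2 ^ (a - 2).
    by rewrite -[4]/(2 ^ 2) -expnD; congr (2 ^ _); move: a3; clear; lia.
  by move: (M * kap i) (2 ^ _) => x y; clear; lia.
set k := kap i.+1; set D := 2 ^ a.
(* Let T be the level belonging to [i] and T' the one below. Then [q] is 2^(T - 3) times twice
   [kap i]; as T - 3 = 4 * 2^T' and [k] = 2^(a - T'), the first factor raised to [k] is 2^(4D). Half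
   of this exponent pays for 2^(2D), the other half for the polynomial factor. *)
have qE : 2 ^ (a - 2) = 2 ^ (tower M (M - i) - 3) * (kap i * 2).
  rewrite /kap -[X in _ * (_ * X)]expn1 -!expnD; congr (2 ^ _); move: M2 M0 tM a3.
  by rewrite tS; clear; move: (2 ^ _) => z; lia.
rewrite qE !expnMn -mulnA leq_mul2r; apply/orP; right.
have -> : (2 ^ (tower M (M - i) - 3)) ^ k = 2 ^ (4 * D).
  rewrite -expnM tS addKn; congr (2 ^ _); rewrite -mulnA -expnD; congr (_ * 2 ^ _).
  by move: tM'; clear; lia.
have -> : 4 * D = 2 * D + 2 * D by clear; lia.
rewrite expnD leq_mul2r; apply/orP; right.
have M2M : M <= 2 ^ M by rewrite ltnW // ltn_expl.
apply: (@leq_trans (2 ^ (M + 3 + (a + a)))).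
  rewrite expnD expnD [2 ^ (a + a)]expnD -/D -[2 ^ 3]/8.
  by move: M2M; move: D (2 ^ M) => x y; clear; nia.
rewrite leq_exp2l //.
have aD : 2 * a <= D.
  rewrite /D; have : 1 < a by move: a3; clear; lia.
  elim: (a) => // b IHb; rewrite ltnS; case: b IHb => [//|[|b] IHb] _; first by [].
  have := IHb isT; rewrite [2 ^ b.+3]expnS; move: (2 ^ _) => z; clear; lia.
by move: aD a3; clear; lia.
Qed.

(** The values lie in [option W] because [W] may be empty when [A] is. *)
Lemma equal_card_bijection (T W : finType) (A : {set T}) (B : {set W}) : #|A| = #|B| ->
  exists f : T -> option W, (forall c, c \in A -> exists2 w, f c = Some w & w \in B) /\
    {in A &, injective f}.
Proof.
move=> AB; pose f c := nth None [seq Some w | w <- enum B] (index c (enum A)).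
have idx c : c \in A -> index c (enum A) < size (enum B).
  by move=> cA; rewrite -cardE -AB cardE index_mem mem_enum.
have B0 c : c \in A -> exists w0 : W, w0 \in B.
  by move=> cA; apply/card_gt0P; rewrite -AB; apply/card_gt0P; exists c.
exists f; split=> [c cA|c c' cA cA'].
  have [w0 _] := B0 c cA.
  exists (nth w0 (enum B) (index c (enum A))); first by rewrite /f (nth_map w0) ?idx.
  by rewrite -mem_enum mem_nth ?idx.
have [w0 _] := B0 c cA.
rewrite /f !(nth_map w0) ?idx // => -[] /eqP; rewrite nth_uniq ?idx ?enum_uniq // => /eqP.
move=> ii; have <- : nth c (enum A) (index c (enum A)) = c by rewrite nth_index ?mem_enum.
by rewrite ii nth_index ?mem_enum.
Qed.

Section Decomposition.
Variables (VT : finType) (eT : rel VT) (V : finType).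
Variables (H : VT -> VT -> rel V) (n : VT -> V -> nat) (D : nat).
Hypothesis D_gt0 : 0 < D.
Hypothesis Hsym : forall s t x y, H s t x y = H t s y x.
Hypothesis Hirr : forall s t x, H s t x x = false.
Hypothesis Hn : forall s t x, eT s t -> #|[set y | H s t x y]| = n s x.
Hypothesis nD : forall s x, D <= n s x.

(* [F c s] is the vertex in role [s] of the copy [c], and [g s c] the group of [c] among the
   copies with the same vertex in role [s]. *)
Definition partial_copies (T : finType) (P : {set VT}) (F : T -> VT -> V) (g : VT -> T -> T) (kap : nat) : Prop :=
  [/\ [/\ forall t v, t \in P -> #|[set c | F c t == v]| = n t v,
          forall s t c, s \in P -> t \in P -> eT s t -> H s t (F c s) (F c t),
          forall s t c c', s \in P -> t \in P -> eT s t -> F c s = F c' s -> F c t = F c' t -> c = c' &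
          forall c, {in P &, injective (F c)}],
      forall s c c', s \in P -> g s c = g s c' -> F c s = F c' s,
      forall s c, s \in P -> D <= #|[set c' | g s c' == g s c]|,
      forall s x, s \in P -> #|[set c | g s c == x]| <= 2 * D &
      forall s s' x w, s \in P -> s' \in P -> s != s' -> #|[set c | (g s c == x) && (F c s' == w)]| <= kap].

Lemma fiber_le (T : finType) (g : T -> T) (M : nat) :
  (forall c, #|[set c' | g c' == g c]| <= M) -> forall x, #|[set c | g c == x]| <= M.
Proof.
move=> gM x; have [->|/set0Pn[c]] := eqVneq [set c | g c == x] set0; first by rewrite cards0.
by rewrite inE => /eqP <-.
Qed.

(** Since the counts agree, the copies with [v] in role [t] can be matched arbitrarily with the
    edges coloured (t, t') at [v]; [shuffle] then repairs this attachment. Each copy receives one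
    edge and no edge is left over, so the index type [T] does not change. *)
Lemma extend_copies (T : finType) (P : {set VT}) (F : T -> VT -> V) (g : VT -> T -> T) kap k q t t' :
  symmetric eT -> irreflexive eT ->
  partial_copies P F g kap -> t \in P -> t' \notin P -> eT t t' ->
  (forall z, z \in P -> eT z t' -> z = t) ->
  0 < q -> 1 < k -> 0 < kap -> kap <= k -> 2 * (#|VT| * kap + q) <= D ->
  2 * (#|VT| * ((2 * D) * (2 * D))) * 2 ^ (2 * D) * kap ^ k * 2 ^ k <= q ^ k ->
  exists (F' : T -> VT -> V) (g' : VT -> T -> T), partial_copies (t' |: P) F' g' k.
Proof.
move=> eTsym eTirr [[cnt FH Finj Fninj] gsame gge gle spread] tP t'P tt' uniq_nb q0 k1 kap0 kapk room num.
have irrT : t != t' by apply: contraNneq t'P => <-.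
have eTt' : eT t' t by rewrite eTsym.
have bij v : exists f : T -> option V, (forall c, c \in [set c | F c t == v] ->
    exists2 w, f c = Some w & w \in [set w | H t t' v w]) /\ {in [set c | F c t == v] &, injective f}.
  by apply: equal_card_bijection; rewrite cnt // (Hn _ tt').
have [h hP] : exists h : T -> V, forall c, [/\ H t t' (F c t) (h c) &
     forall c', F c t = F c' t -> h c = h c' -> c = c'].
  have bij' v : exists f : {ffun T -> option V}, (forall c, c \in [set c | F c t == v] ->
    exists2 w, f c = Some w & w \in [set w | H t t' v w]) /\ {in [set c | F c t == v] &, injective f}.
    have [f [f1 f2]] := bij v; exists [ffun c => f c]; split=> [c cv|c c' cv cv'].
      by rewrite ffunE; apply: f1.
    by rewrite !ffunE; apply: f2.
  have [f fP] := fin_all_exists bij'.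
  have defd c : exists w, f (F c t) c == Some w.
    by have [f1 _] := fP (F c t); have [|w fw _] := f1 c; [rewrite inE|exists w; rewrite fw].
  have [h hP] := fin_all_exists defd.
  exists h => c; have [f1 f2] := fP (F c t); split.
    have [|w fw] := f1 c; first by rewrite inE.
    by rewrite inE; have /eqP := hP c; rewrite fw => -[->].
  move=> c' tt hh; apply: f2; rewrite ?inE ?tt // -?tt.
  have /eqP := hP c; have /eqP := hP c'; rewrite -tt hh => -> ->.
  by [].
have hH c : H t t' (F c t) (h c) by have [] := hP c.
have hinj c c' : F c t = F c' t -> h c = h c' -> c = c' by have [_] := hP c; apply.
(* Counted from the other end, each edge coloured (t', t) at [w] is used by exactly one copy. *)
have hcnt w : #|[set c | h c == w]| = n t' w.
  rewrite -(Hn _ eTt') -(@card_in_imset _ _ (fun c => F c t)); last first.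
    by move=> c c'; rewrite !inE => /eqP h1 /eqP h2 ff; apply: hinj; rewrite // h1 h2.
  congr #|pred_of_set _|; apply/setP => v; rewrite inE Hsym; apply/imsetP/idP.
    by move=> [c]; rewrite inE => /eqP <- ->; apply: hH.
  move=> Hvw; have E : [set h c | c in [set c | F c t == v]] = [set y | H t t' v y].
    apply/eqP; rewrite eqEcard; apply/andP; split.
      by apply/subsetP => y /imsetP[c]; rewrite inE => /eqP <- ->; rewrite inE; apply: hH.
    rewrite card_in_imset ?cnt ?(Hn _ tt') //.
    by move=> c c'; rewrite !inE => /eqP h1 /eqP h2; apply: hinj; rewrite h1 h2.
  have : w \in [set y | H t t' v y] by rewrite inE.
  by rewrite -E => /imsetP[c]; rewrite inE => /eqP Fv ->; exists c; rewrite ?inE.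
have hneq c : h c != F c t by apply: contraTneq (hH c) => ->; rewrite Hirr.
have [|g0 [g0same g0D]] := @blocks T V h D D_gt0; first by move=> c; rewrite hcnt.
have g0le : forall x, #|[set c | g0 c == x]| <= 2 * D.
  by apply: fiber_le => c; have /andP[] := g0D c.
have gge_t c : D <= #|[set c' | g t c' == g t c]| by apply: gge.
have gsame_t c c' : g t c = g t c' -> F c t = F c' t by apply: gsame.
have [sg [sginj sgg sgF sp1 sp2]] :=
  @shuffle T VT V P F g t h g0 D q k kap tP k1 q0 kap0 hinj hneq gsame_t g0same gge_t gle g0le spread room num.
have sgt c : F (sg c) t = F c t by apply: gsame_t.
have nt' s : s \in P -> (s == t') = false by move=> sP; apply: contraNF t'P => /eqP <-.
exists (fun c s => if s == t' then h (sg c) else F c s).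
exists (fun s c => if s == t' then g0 (sg c) else g s c).
have onto (A : {set T}) : #|[set c | sg c \in A]| = #|A|.
  rewrite -(card_imset _ sginj); congr #|pred_of_set _|; apply/setP => c.
  have [sg' _ sgK'] := injF_bij sginj.
  apply/imsetP/idP => [[d]|cA]; first by rewrite inE => dA ->.
  by exists (sg' c); rewrite ?inE sgK'.
split.
- split.
  + move=> s v; rewrite in_setU1 => /orP[/eqP->|sP].
      by rewrite eqxx -hcnt -[RHS]onto; apply: eq_card => c; rewrite !inE.
    by rewrite nt' // cnt.
  + move=> s u c; rewrite !in_setU1 => /orP[/eqP->|sP] /orP[/eqP->|uP].
    * by rewrite eTirr.
    * rewrite eqxx nt' // => eu; rewrite (uniq_nb u uP) 1?eTsym // Hsym -sgt; apply: hH.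
    * by rewrite eqxx nt' // => eu; rewrite (uniq_nb s sP eu) -sgt; apply: hH.
    * by rewrite !nt' //; apply: FH.
  + move=> s u c c'; rewrite !in_setU1 => /orP[/eqP->|sP] /orP[/eqP->|uP].
    * by rewrite eTirr.
    * rewrite eqxx nt' // => eu hh ff; apply: sginj; apply: hinj => //; rewrite !sgt.
      by rewrite -(uniq_nb u uP) 1?eTsym.
    * rewrite eqxx nt' // => eu ff hh; apply: sginj; apply: hinj => //; rewrite !sgt.
      by rewrite -(uniq_nb s sP eu).
    * by rewrite !nt' //; apply: Finj.
  + move=> c s u; rewrite !in_setU1 => /orP[/eqP->|sP] /orP[/eqP->|uP] //.
    * by rewrite eqxx nt' // => hh; have := sgF c u uP; rewrite hh eqxx.
    * by rewrite eqxx nt' // => hh; have := sgF c s sP; rewrite hh eqxx.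
    * by rewrite !nt' //; apply: Fninj.
- move=> s c c'; rewrite in_setU1 => /orP[/eqP->|sP]; first by rewrite eqxx; apply: g0same.
  by rewrite !nt' //; apply: gsame.
- move=> s c; rewrite in_setU1 => /orP[/eqP->|sP].
    rewrite (_ : [set c' | _] = [set d | sg d \in [set c' | g0 c' == g0 (sg c)]]).
      by rewrite onto; have /andP[] := g0D (sg c).
    by apply/setP => d; rewrite !inE eqxx.
  by have := gge s c sP; congr (_ <= _); apply: eq_card => d; rewrite !inE nt'.
- move=> s x; rewrite in_setU1 => /orP[/eqP->|sP].
    rewrite (_ : [set c | _] = [set d | sg d \in [set c' | g0 c' == x]]); first by rewrite onto.
    by apply/setP => d; rewrite !inE eqxx.
  by have := gle s x sP; congr (_ <= _); apply: eq_card => d; rewrite !inE nt'.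
move=> s u x w; rewrite !in_setU1 => /orP[/eqP->|sP] /orP[/eqP->|uP]; rewrite ?eqxx //.
- by move=> _; have := sp2 u x w uP; congr (_ <= _); apply: eq_card => d; rewrite !inE nt'.
- by move=> _; have := sp1 s x w sP; congr (_ <= _); apply: eq_card => d; rewrite !inE nt'.
by rewrite !nt' // => su; apply: leq_trans kapk; apply: spread.
Qed.

(** A vertex v forms [n t0 v] one-vertex copies, as many as it has edges in each colour at [t0].
    They index all later copies. *)
Lemma initial_copies (t0 : VT) kap : irreflexive eT -> exists (T : finType) (F : T -> VT -> V) (g : VT -> T -> T),
  partial_copies [set t0] F g kap.
Proof.
move=> eTirr; pose T : finType := {v : V & 'I_(n t0 v)}.
pose F (c : T) (s : VT) := tag c.
have cnt v : #|[set c : T | tag c == v]| = n t0 v.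
  rewrite -[RHS]card_ord -(@card_imset _ _ (fun i : 'I_(n t0 v) => (Tagged (fun v => 'I_(n t0 v)) i : T))).
    apply: eq_card => -[w i]; rewrite inE /=; apply/eqP/imsetP => [wv|[j _ wj]].
      by subst w; exists i.
    by have := congr1 (fun c : T => tag c) wj.
  by move=> i j /eqP; rewrite eq_Tagged => /eqP.
have [|g0 [g0same g0D]] := @blocks T V (fun c => tag c) D D_gt0; first by move=> c; rewrite cnt.
exists T, F, (fun _ => g0); split.
- split=> [t v|s t c|s t c c'|c s s'].
  + by rewrite inE => /eqP ->; rewrite cnt.
  + by rewrite !inE => /eqP-> /eqP->; rewrite eTirr.
  + by rewrite !inE => /eqP-> /eqP->; rewrite eTirr.
  + by rewrite !inE => /eqP-> /eqP->.
- by move=> s c c' _; apply: g0same.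
- by move=> s c _; have /andP[] := g0D c.
- by move=> s x _; apply: fiber_le => c; have /andP[] := g0D c.
by move=> s s' x w; rewrite !inE => /eqP-> /eqP->; rewrite eqxx.
Qed.

(** For an edge st of the tree, the copies with x in role s inject into the edges coloured (s, t) at
    x, and by equality of the counts they exhaust them. Two copies sharing an edge give its ends the
    same roles, since its colour is unique, and hence coincide. *)
Lemma decomposition_of_copies (e : rel V) (T : finType) (F : T -> VT -> V) (g : VT -> T -> T) kap :
  (exists s t, eT s t) -> symmetric eT ->
  (forall s t x y, H s t x y -> eT s t /\ e x y) ->
  (forall x y, e x y -> exists s t, H s t x y) ->
  (forall s t s' t' x y, H s t x y -> H s' t' x y -> s = s' /\ t = t') ->
  partial_copies setT F g kap -> has_decomposition eT e.
Proof.
move=> [s0 [t0 st0]] eTsym HE EH Huniq [[cnt FH Finj Fninj] _ _ _ _].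
pose copy c := [set [set F c p.1; F c p.2] | p in [set q : VT * VT | eT q.1 q.2]].
have FH' s t c : eT s t -> H s t (F c s) (F c t) by apply: FH; rewrite inE.
have onto s t x y : H s t x y -> exists c, F c s = x /\ F c t = y.
  move=> Hxy; have [st _] := HE _ _ _ _ Hxy.
  have E : [set F c t | c in [set c | F c s == x]] = [set y | H s t x y].
    apply/eqP; rewrite eqEcard; apply/andP; split.
      by apply/subsetP => z /imsetP[c]; rewrite inE => /eqP <- ->; rewrite inE; apply: FH'.
    rewrite card_in_imset ?cnt ?(Hn _ st) ?inE //.
    move=> c c'; rewrite !inE => /eqP h1 /eqP h2; apply: (Finj s t); rewrite ?inE //.
    by rewrite h1 h2.
  have : y \in [set y | H s t x y] by rewrite inE.
  by rewrite -E => /imsetP[c]; rewrite inE => /eqP <- ->; exists c.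
have inter c c' E : E \in copy c -> E \in copy c' -> c = c'.
  move=> /imsetP[[s t]]; rewrite inE /= => st -> /imsetP[[s' t']]; rewrite inE /= => st' eqE.
  have Hst := FH' _ _ c st; have Hst' := FH' _ _ c' st'.
  have ne : F c s != F c t by apply: contraTneq Hst => ->; rewrite Hirr.
  have ne' : F c' s' != F c' t' by apply: contraTneq Hst' => ->; rewrite Hirr.
  have : F c s \in [set F c' s'; F c' t'] by rewrite -eqE !inE eqxx.
  have : F c t \in [set F c' s'; F c' t'] by rewrite -eqE !inE eqxx orbT.
  rewrite !inE => /orP[] /eqP h1 /orP[] /eqP h2; try by rewrite h1 h2 eqxx in ne.
    rewrite -h1 -h2 Hsym in Hst'; have [h3 h4] := Huniq _ _ _ _ _ _ Hst Hst'.
    by subst s' t'; apply: (Finj s t); rewrite ?inE.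
  rewrite -h1 -h2 in Hst'; have [h3 h4] := Huniq _ _ _ _ _ _ Hst Hst'.
  by subst s' t'; apply: (Finj s t); rewrite ?inE.
exists [set copy c | c : T]; split; last first.
  move=> E /imsetP[c _ ->]; exists (F c); split=> // s t ff.
  by apply: (Fninj c) => //; rewrite inE.
apply/and3P; split.
- apply/eqP/setP => E; apply/bigcupP/imsetP.
    move=> [_ /imsetP[c _ ->]] /imsetP[[s t]]; rewrite inE /= => st ->.
    exists (F c s, F c t) => //; rewrite inE /=.
    by have [] := HE _ _ _ _ (FH' _ _ c st).
  move=> [[x y]]; rewrite inE /= => exy ->; have [s [t Hst]] := EH x y exy.
  have [c [<- <-]] := onto _ _ _ _ Hst; exists (copy c); first exact: imset_f.
  by apply/imsetP; exists (s, t); rewrite // inE /=; have [] := HE _ _ _ _ Hst.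
- apply/trivIsetP => _ _ /imsetP[c _ ->] /imsetP[c' _ ->] cc.
  rewrite -setI_eq0; apply: contraNT cc => /set0Pn[E]; rewrite inE => /andP[h1 h2].
  by rewrite (inter c c' E h1 h2).
apply/negP => /imsetP[c _ /setP/(_ [set F c s0; F c t0])]; rewrite inE => /esym/imsetP; case.
by exists (s0, t0); rewrite ?inE.
Qed.

End Decomposition.

(* [H s t x y]: the edge xy is coloured by the edge st, with x in the role of s. *)
Definition equitable (VT : finType) (eT : rel VT) (V : finType) (e : rel V)
    (H : VT -> VT -> rel V) (n : VT -> V -> nat) (D : nat) : Prop :=
  [/\ forall s t x y, H s t x y = H t s y x,
      forall s t x, eT s t -> #|[set y | H s t x y]| = n s x /\ D <= n s x,
      forall s t x y, H s t x y -> eT s t /\ e x y,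
      forall x y, e x y -> exists s t, H s t x y &
      forall s t s' t' x y, H s t x y -> H s' t' x y -> s = s' /\ t = t'].

Theorem equitable_decomposition (VT : finType) (eT : rel VT) : is_tree eT ->
  (exists s t, eT s t) ->
  exists D, forall (V : finType) (e : rel V) H n, simple_graph e ->
    equitable eT e H n D -> has_decomposition eT e.
Proof.
move=> treeT edgeT; have [[eTsym eTirr] [VT0 [con _]]] := treeT.
have [D [q [kap [q0 D0 par]]]] := parameters VT0.
exists D => V e H n [esym eirr] [Hsym Hn HE EH Huniq].
have Hn' s t x : eT s t -> #|[set y | H s t x y]| = n s x by move=> st; have [] := Hn s t x st.
have deg s : exists t, eT s t.
  have [a [b ab]] := edgeT; have [->|sa] := eqVneq s a; first by exists b.
  have /connectP[[|z p]] := con s a; first by move=> _ h; rewrite h eqxx in sa.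
  by move=> /= /andP[sz _] _; exists z.
have nD s x : D <= n s x by have [t st] := deg s; have [] := Hn s t x st.
have Hirr s t x : H s t x x = false.
  by apply/negP => /HE[_]; rewrite eirr.
have [T [F [g pc]]] : exists (T : finType) (F : T -> VT -> V) (g : VT -> T -> T),
    partial_copies eT H n D [set: VT] F g (kap #|[set: VT]|).
  apply: (tree_ind treeT (Q := fun P => exists (T : finType) (F : T -> VT -> V) (g : VT -> T -> T),
     partial_copies eT H n D P F g (kap #|P|))).
    by move=> t0; apply: (initial_copies H D0 nD t0 _ eTirr).
  move=> P t t' tP t'P tt' uniq_nb [T [F [g pc]]].
  have PM : #|P| < #|VT|.
    by rewrite -cardsT; apply: proper_card; apply/properP; split; [apply: subsetT|exists t'; rewrite ?inE].
  have [k1 kap0 kk room num] := par _ PM.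
  rewrite cardsU1 t'P add1n; exists T.
  exact: (extend_copies D0 Hsym Hirr Hn' nD eTsym eTirr pc tP t'P tt' uniq_nb q0 k1 kap0 kk room num).
exact: (decomposition_of_copies Hsym Hirr Hn' edgeT eTsym HE EH Huniq pc).
Qed.

(** * Equitable colourings of highly edge-connected graphs *)

(** The fibre of [lb] over x is listed against the word in which each [w] is repeated [f x w]
    times. *)
Lemma prescribed_coloring (X V W : finType) (w0 : W) (E : {set X}) (lb : X -> V) (f : V -> W -> nat) :
  (forall x, \sum_w f x w = \sum_(a in E) (lb a == x)) ->
  exists col : X -> W, forall x w, \sum_(a in E) ((lb a == x) && (col a == w)) = f x w.
Proof.
move=> tot; pose L x := enum [set a in E | lb a == x].
pose s x := flatten [seq nseq (f x w) w | w <- enum W].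
have sumf (G : W -> nat) : sumn [seq G w | w <- enum W] = \sum_w G w.
  by rewrite sumnE big_map big_enum.
have size_s x : size (s x) = size (L x).
  rewrite size_flatten /shape -map_comp (eq_map (g := f x)); last by move=> w; rewrite /= size_nseq.
  by rewrite sumf tot -cardE card_set_filter.
have count_s x w : count_mem w (s x) = f x w.
  rewrite count_flatten -map_comp (eq_map (g := fun v => (v == w) * f x v)); last first.
    by move=> v; rewrite /= count_nseq.
  by rewrite sumf (bigD1 w) //= eqxx mul1n big1 ?addn0 // => v /negPf ->.
exists (fun a => nth w0 (s (lb a)) (index a (L (lb a)))) => x w.
rewrite (eq_bigr (fun a => (lb a == x) * (nth w0 (s x) (index a (L x)) == w))); last first.
  by move=> a _; case: eqP => [->|_]; rewrite ?mul1n.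
rewrite -big_set_filter -big_enum -/(L x) -(big_map (fun a => nth w0 (s x) (index a (L x))) predT (fun v => (v == w) : nat)) /=.
have -> : [seq nth w0 (s x) (index a (L x)) | a <- L x] = s x.
  apply: (@eq_from_nth _ w0) => [|i]; rewrite size_map ?size_s // => iL.
  have [a0 _] : exists a0 : X, a0 \in L x by case: (L x) iL => // a0 l _; exists a0; rewrite mem_head.
  by rewrite (nth_map a0) // index_uniq ?enum_uniq.
by rewrite -count_s -sum1_count [RHS]big_mkcond.
Qed.

(** Hall's condition by double counting in the regular bipartite multigraph whose edge a joins the
    left vertex [bl a] to the right vertex [br a]; the rank used in [rado] is the number of right
    ends. *)
Lemma regular_matching (X Y : finType) (E : {set X}) (bl br : X -> Y) (k : nat) : 0 < k ->
  (forall a, a \in E -> \sum_(b in E) (bl b == bl a) = k) ->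
  (forall a, a \in E -> \sum_(b in E) (br b == br a) = k) ->
  exists2 M : {set X}, M \subset E & forall y,
    \sum_(a in M) (bl a == y) = (y \in bl @: E) /\ \sum_(a in M) (br a == y) = (y \in br @: E).
Proof.
move=> k0 kl kr; pose F y := [set a in E | bl a == y].
have cardE_im (b : X -> Y) : (forall a, a \in E -> \sum_(c in E) (b c == b a) = k) -> #|E| = k * #|b @: E|.
  move=> kb; rewrite -sum1_card (partition_big b (mem (b @: E))) /=; last by move=> a; apply: imset_f.
  rewrite mulnC -sum_nat_const; apply: eq_bigr => _ /imsetP[a aE ->].
  rewrite -[in RHS](kb a aE) big_mkcondr; apply: eq_bigr => c _; by case: (_ == _).
have [||y|J JD|F' [F'1 F'2]] := @rado Y X (fun Q => #|br @: Q|) (bl @: E) F.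
- by move=> A B AB; apply/subset_leq_card/imsetS.
- move=> A B; rewrite imsetU -[X in _ <= X]cardsUI leq_add2l subset_leq_card //.
  by rewrite subsetI !imsetS // (subsetIl, subsetIr).
- by move=> /imsetP[a aE ->]; apply/set0Pn; exists a; rewrite inE aE eqxx.
- set Q := \bigcup_(i in J) F i; have QE : Q \subset E.
    by apply/bigcupsP => y _; apply/subsetP => a; rewrite inE => /andP[].
  have cQ : #|Q| = k * #|J|.
    rewrite -sum1_card (partition_big bl (mem J)) /=; last first.
      by move=> a /bigcupP[y yJ]; rewrite inE => /andP[_ /eqP ->].
    rewrite mulnC -sum_nat_const; apply: eq_bigr => y yJ.
    have /imsetP[a aE ya] := subsetP JD y yJ.
    rewrite -[in RHS](kl a aE) -ya -card_set_filter -sum1_card; apply: eq_bigl => c; rewrite inE.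
    apply/andP/andP => -[h1 h2]; split=> //; first exact: (subsetP QE).
    by apply/bigcupP; exists y; rewrite // inE h1.
  have : #|Q| <= k * #|br @: Q|.
    rewrite -sum1_card (partition_big br (mem (br @: Q))) /=; last by move=> a; apply: imset_f.
    rewrite mulnC -sum_nat_const; apply: leq_sum => _ /imsetP[a aQ ->].
    rewrite -[X in _ <= X](kr a (subsetP QE a aQ)) -card_set_filter -sum1_card.
    rewrite big_mkcond [X in _ <= X]big_mkcond; apply: leq_sum => c _; rewrite inE.
    by case: (boolP (c \in Q)) => [/(subsetP QE)->|].
  by rewrite cQ leq_pmul2l.
set M := \bigcup_(i in bl @: E) F' i in F'2.
have F'in y a : y \in bl @: E -> a \in F' y -> a \in E /\ bl a = y.
  by move=> /F'1[/subsetP h _] /h; rewrite inE => /andP[-> /eqP].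
have ME : M \subset E by apply/bigcupsP => y yE; apply/subsetP => a /(F'in y a yE)[].
have Ml y : \sum_(a in M) (bl a == y) = (y \in bl @: E).
  have [yE|yE] := boolP (y \in bl @: E); last first.
    rewrite big1 // => a /(subsetP ME) aE; case: eqP => // ay.
    by rewrite -ay imset_f in yE.
  have [_ /eqP/cards1P[a aF]] := F'1 y yE.
  have aF' : a \in F' y by rewrite aF set11.
  have [aE ay] := F'in y a yE aF'.
  have aM : a \in M by apply/bigcupP; exists y.
  rewrite (sum_setD1 _ aM) ay eqxx big1 // => c; rewrite !inE => /andP[ca] /bigcupP[z zE cF].
  have [_ cz] := F'in z c zE cF; rewrite cz; case: eqP => // zy.
  by move: cF; rewrite zy aF inE (negPf ca).
have cM : #|M| = #|br @: E|.
  apply/eqP; rewrite -(eqn_pmul2l k0) -(cardE_im br kr) (cardE_im bl kl) eqn_pmul2l //; apply/eqP.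
  rewrite -sum1_card (partition_big bl (mem (bl @: E))) /=; last by move=> a /(subsetP ME); apply: imset_f.
  rewrite -[RHS]sum1_card; apply: eq_bigr => y yE.
  rewrite -[RHS]/(nat_of_bool true) -yE -Ml big_mkcondr; apply: eq_bigr => c _; by case: (_ == _).
have cMr : #|br @: M| = #|M|.
  apply/eqP; rewrite eqn_leq leq_imset_card cM -(leq_pmul2l k0) -(cardE_im br kr) (cardE_im bl kl) leq_pmul2l //.
  exact: F'2.
have imM : br @: M = br @: E by apply/eqP; rewrite eqEcard (imsetS _ ME) cMr cM /=.
exists M => // y; split=> //; rewrite -imM.
have [/imsetP[a aM ->]|yM] := boolP (y \in br @: M).
  rewrite (sum_setD1 _ aM) eqxx big1 // => c; rewrite !inE => /andP[ca cM'].
  have inj : {in M &, injective br} by apply/imset_injP/eqP.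
  by case: (br c =P br a) => // /(inj _ _ cM' aM) h; rewrite h eqxx in ca.
by rewrite big1 // => a aM; case: (br a =P y) => // ay; rewrite -ay imset_f in yM.
Qed.

(** König's edge colouring of regular bipartite multigraphs: perfect matchings are removed one after
    the other. *)
Lemma regular_rainbow (X Y : finType) (k : nat) (E : {set X}) (bl br : X -> Y) :
  (forall a, a \in E -> \sum_(b in E) (bl b == bl a) = k) ->
  (forall a, a \in E -> \sum_(b in E) (br b == br a) = k) ->
  exists c : X -> nat, forall i, i < k -> forall y,
    \sum_(a in E) ((bl a == y) && (c a == i)) = (y \in bl @: E) /\
    \sum_(a in E) ((br a == y) && (c a == i)) = (y \in br @: E).
Proof.
elim: k E => [|k IHk] E kl kr; first by exists (fun=> 0).
have [M ME Mdeg] := regular_matching (ltn0Sn k) kl kr.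
have rest (b : X -> Y) : (forall a, a \in E -> \sum_(c in E) (b c == b a) = k.+1) ->
   (forall y, \sum_(a in M) (b a == y) = (y \in b @: E)) ->
   forall a, a \in E :\: M -> \sum_(c in E :\: M) (b c == b a) = k.
  move=> kb Mb a; rewrite inE => /andP[_ aE]; have := kb a aE.
  by rewrite (big_setID M) /= (setIidPr ME) Mb imset_f // add1n => -[].
have [|| c cP] := IHk (E :\: M).
- by apply: rest => // y; have [] := Mdeg y.
- by apply: rest => // y; have [] := Mdeg y.
exists (fun a => if a \in M then 0 else (c a).+1) => i ik y.
have gen (b : X -> Y) : (forall a, a \in E -> \sum_(c in E) (b c == b a) = k.+1) ->
   (forall y, \sum_(a in M) (b a == y) = (y \in b @: E)) ->
   (forall j, j < k -> \sum_(a in E :\: M) ((b a == y) && (c a == j)) = (y \in b @: (E :\: M))) ->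
   \sum_(a in E) ((b a == y) && ((if a \in M then 0 else (c a).+1) == i)) = (y \in b @: E).
  move=> kb Mb cj; rewrite (big_setID M) /= (setIidPr ME).
  rewrite (eq_bigr (fun a => ((b a == y) && (0 == i)) : nat)); last by move=> a ->.
  rewrite [X in _ + X](eq_bigr (fun a => ((b a == y) && ((c a).+1 == i)) : nat)); last first.
    by move=> a; rewrite inE => /andP[/negPf ->].
  case: i ik => [_|i ik].
    rewrite (eq_bigr (fun a => (b a == y) : nat)); last by move=> a; rewrite andbT.
    by rewrite Mb big1 ?addn0 // => a _; rewrite andbF.
  rewrite big1 ?add0n ?cj //; last by move=> a; rewrite andbF.
  congr nat_of_bool; apply/imsetP/imsetP => -[a aE ay]; first by exists a => //; move: aE; rewrite inE => /andP[].
  have := kb a aE; rewrite (big_setID M) /= (setIidPr ME) Mb imset_f // => -[sum_k].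
  have /eqP : \sum_(c in E :\: M) (b c == b a) != 0 by move: sum_k ik; slia.
  case: (pickP [pred c | (c \in E :\: M) && (b c == b a)]) => [c' /andP[c'E /eqP ba]|none].
    by exists c'; rewrite // ba.
  by case; apply: big1 => c' c'E; have := none c'; rewrite /= c'E => /= ->.
have [Ml Mr] : (forall y, \sum_(a in M) (bl a == y) = (y \in bl @: E)) /\
    (forall y, \sum_(a in M) (br a == y) = (y \in br @: E)) by split=> z; have [] := Mdeg z.
by split; apply: gen => // j jk; have [] := cP j jk y.
Qed.

Lemma card_fiber_le (X V : finType) (E : {set X}) (lb : X -> V) (x : V) :
  \sum_(a in E) (lb a == x) <= #|X|.
Proof. by rewrite -card_set_filter max_card. Qed.

(** Full blocks of [k] elements and one block with the remainder. The index type is large enough for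
    every fibre, so that it need not depend on x. *)
Lemma blocks_of_size (X V : finType) (k : nat) (E : {set X}) (lb : X -> V) : 0 < k ->
  exists b : X -> 'I_#|X|.+1, forall x (j : 'I_#|X|.+1),
    \sum_(a in E) ((lb a == x) && (b a == j)) =
    let N := \sum_(a in E) (lb a == x) in
    if j < N %/ k then k else if j == N %/ k :> nat then N %% k else 0.
Proof.
move=> k0; pose N x := \sum_(a in E) (lb a == x).
apply: (prescribed_coloring ord0) => x; rewrite -/(N x).
have NX : N x %/ k < #|X|.+1 by rewrite ltnS (leq_trans (leq_div _ _)) // card_fiber_le.
rewrite (bigID (fun j : 'I__ => j < N x %/ k)) /=.
rewrite (eq_bigr (fun=> k)); last by move=> j ->.
rewrite [X in _ + X](bigD1 (Ordinal NX)) /=; last by rewrite -leqNgt.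
rewrite ltnn eqxx [X in _ + (_ + X)]big1 ?addn0; last first.
  move=> j /andP[/negPf -> jN]; case: eqP => // jN'.
  by rewrite -val_eqE /= jN' eqxx in jN.
rewrite -(big_ord_widen _ (fun=> k)) ?(ltnW NX) //.
by rewrite sum_nat_const card_ord -divn_eq.
Qed.

(** Each left and each right vertex is split into vertices of degree exactly [k]. In each of the [k]
    perfect matchings of the resulting graph a vertex appears as often as it has parts. *)
Lemma regular_split (X V : finType) (k : nat) (E : {set X}) (lb rb : X -> V) : 0 < k ->
  (forall x, k %| \sum_(a in E) (lb a == x)) -> (forall x, k %| \sum_(a in E) (rb a == x)) ->
  exists c : X -> nat, [/\ forall a, a \in E -> c a < k,
    forall i x, i < k -> \sum_(a in E) ((lb a == x) && (c a == i)) = (\sum_(a in E) (lb a == x)) %/ k &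
    forall i x, i < k -> \sum_(a in E) ((rb a == x) && (c a == i)) = (\sum_(a in E) (rb a == x)) %/ k].
Proof.
move=> k0 kl kr.
have block (b : X -> V) : (forall x, k %| \sum_(a in E) (b a == x)) ->
   exists B : X -> V * 'I_#|X|.+1, [/\ forall a, (B a).1 = b a,
     forall a, a \in E -> \sum_(c in E) (B c == B a) = k &
     forall x j, (x, j) \in B @: E = (j < (\sum_(a in E) (b a == x)) %/ k)].
  move=> kb; have [B BP] := blocks_of_size E b k0.
  have BE x j : \sum_(a in E) ((b a == x) && (B a == j)) = (j < (\sum_(a in E) (b a == x)) %/ k) * k.
    rewrite BP /=; case: ltnP => _; rewrite ?mul1n //.
    by move: (kb x); rewrite /dvdn => /eqP ->; case: eqP.
  have inB x j : (x, j) \in (fun a => (b a, B a)) @: E = (j < (\sum_(a in E) (b a == x)) %/ k).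
    apply/imsetP/idP => [[a aE [-> ->]]|jN].
      have := BE (b a) (B a); case: ltnP => // _.
      by rewrite mul0n (sum_setD1 _ aE) !eqxx.
    have := BE x j; rewrite jN mul1n.
    case: (pickP [pred a | [&& a \in E, b a == x & B a == j]]) => [a /and3P[aE /eqP <- /eqP <-] _|none].
      by exists a.
    by rewrite big1 => [kk|a aE]; [rewrite -kk in k0 | have := none a; rewrite /= aE => /= ->].
  exists (fun a => (b a, B a)); split=> // a aE.
  by rewrite (BE (b a) (B a)) -inB imset_f ?mul1n.
have [B [B1 Bk BE]] := block lb kl; have [B' [B1' Bk' BE']] := block rb kr.
have [c cP] := regular_rainbow Bk Bk'.
have count (b : X -> V) (P : pred X) (Bb : X -> V * 'I_#|X|.+1) x : (forall a, (Bb a).1 = b a) ->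
   (forall j, \sum_(a in E) ((Bb a == (x, j)) && P a) = (j < (\sum_(a in E) (b a == x)) %/ k)) ->
   \sum_(a in E) ((b a == x) && P a) = (\sum_(a in E) (b a == x)) %/ k.
  move=> Bb1 h; set N := _ %/ k.
  have NX : N <= #|X|.+1 by rewrite (leq_trans (leq_div _ _)) // leqW // card_fiber_le.
  rewrite -[RHS]card_ord -sum1_card (big_ord_widen _ (fun=> 1) NX) [RHS]big_mkcond /=.
  transitivity (\sum_j \sum_(a in E) ((Bb a == (x, j)) && P a)); last first.
    by apply: eq_bigr => j _; rewrite h; case: ltnP.
  rewrite exchange_big; apply: eq_bigr => a _.
  case: (P a); last by rewrite andbF big1 // => j _; rewrite andbF.
  rewrite andbT (bigD1 (Bb a).2) //= big1 => [|j /negPf ja].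
    by rewrite addn0 andbT -Bb1 {2}[Bb a]surjective_pairing xpair_eqE eqxx andbT.
  by rewrite andbT [Bb a]surjective_pairing xpair_eqE [_ == j]eq_sym ja andbF.
have ck a : a \in E -> c a < k.
  move=> aE; rewrite ltnNge; apply/negP => kc.
  have e1 : \sum_(i < k) \sum_(b in E) ((B b == B a) && (c b == i)) = k.
    rewrite -[RHS]muln1 -[X in _ = X * _]card_ord -sum_nat_const.
    by apply: eq_bigr => i _; have [-> _] := cP i (ltn_ord i) (B a); rewrite imset_f.
  have := etrans (Bk a aE) (esym e1).
  rewrite exchange_big (sum_setD1 _ aE) (sum_setD1 _ aE) eqxx /= [X in _ = X + _]big1; last first.
    by move=> i _; case: eqP => // ci; move: kc; rewrite ci leqNgt ltn_ord.
  have : \sum_(i in E :\ a) \sum_(i0 < k) ((B i == B a) && (c i == i0)) <= \sum_(i in E :\ a) (B i == B a).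
    apply: leq_sum => b _; case: (_ == _) => /=; last by rewrite big1.
    have [bk|bk] := ltnP (c b) k.
      by rewrite (bigD1 (Ordinal bk)) //= eqxx big1 // => i; rewrite -val_eqE /= eq_sym => /negPf ->.
    by rewrite big1 // => i _; case: eqP => // ci; move: bk; rewrite ci leqNgt ltn_ord.
  by slia.
exists c; split=> // i x ik.
  by apply: (count lb _ B) => // j; have [-> _] := cP i ik (x, j); rewrite BE.
by apply: (count rb _ B') => // j; have [_ ->] := cP i ik (x, j); rewrite BE'.
Qed.

Lemma card_row (V : finType) (S : {set V * V}) x :
  #|[set y | (x, y) \in S]| = \sum_(a in S) (a.1 == x).
Proof.
rewrite -card_set_filter -(card_imset _ (f := fun y => (x, y))); last by move=> y y' [].
apply: eq_card => -[a b]; rewrite inE /=; apply/imsetP/andP.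
  by move=> [y]; rewrite inE => yS [-> ->].
by move=> [aS /eqP ax]; exists b; rewrite ?inE -?ax.
Qed.

Lemma card_column (V : finType) (S : {set V * V}) y :
  #|[set x | (x, y) \in S]| = \sum_(a in S) (a.2 == y).
Proof.
rewrite -card_set_filter -(card_imset _ (f := fun x => (x, y))); last by move=> x x' [].
apply: eq_card => -[a b]; rewrite inE /=; apply/imsetP/andP.
  by move=> [x]; rewrite inE => xS [-> ->].
by move=> [aS /eqP ay]; exists a; rewrite ?inE -?ay.
Qed.

(** An arc xy of colour t will have y in role t and x in the role of a neighbour s of t.
    [regular_split] divides the arcs of colour t into kappa_t classes, one for each s, evenly at
    every tail and every head. So x has [q x] edges in each colour at s, whatever t is, and y has in
    each colour at t a kappa_t-th part of its in-arcs of colour t. *)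
Lemma equitable_of_coloring (VT : finType) (eT : rel VT) (side : pred VT) (V : finType) (e : rel V)
    (O : {set V * V}) (col : V * V -> {t : VT | side t}) (q : V -> nat) (D : nat) :
  simple_graph eT -> (forall s t, eT s t -> side s != side t) ->
  (forall t, exists s, eT s t) -> simple_graph e ->
  (forall x y, e x y = ((x, y) \in O) || ((y, x) \in O)) ->
  (forall x y, ~~ (((x, y) \in O) && ((y, x) \in O))) ->
  (forall x w, \sum_(a in O) ((a.1 == x) && (col a == w)) = #|[set s | eT s (val w)]| * q x) ->
  (forall x, D <= q x) ->
  (forall y w, #|[set s | eT s (val w)]| %| \sum_(a in O) ((a.2 == y) && (col a == w))) ->
  (forall y w, #|[set s | eT s (val w)]| * D <= \sum_(a in O) ((a.2 == y) && (col a == w))) ->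
  exists H n, equitable eT e H n D.
Proof.
move=> [eTsym eTirr] eTside deg [esym eirr] eO Oasym out Dq inn Din.
pose kp t := #|[set s | eT s t]|.
have kp0 t : 0 < kp t by apply/card_gt0P; have [s st] := deg t; exists s; rewrite inE.
pose E w := [set a in O | col a == w].
have sumE w (f : V * V -> V) x : \sum_(a in E w) (f a == x) = \sum_(a in O) ((f a == x) && (col a == w)).
  by rewrite big_set_filter; apply: eq_bigr => a _; rewrite mulnb andbC.
have split w : exists c : V * V -> nat, [/\ forall a, a \in E w -> c a < kp (val w),
    forall i x, i < kp (val w) -> \sum_(a in E w) ((a.1 == x) && (c a == i)) = q x &
    forall i x, i < kp (val w) -> \sum_(a in E w) ((a.2 == x) && (c a == i)) =
       (\sum_(a in O) ((a.2 == x) && (col a == w))) %/ kp (val w)].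
  have [|x|x|c [c1 c2 c3]] := @regular_split _ _ (kp (val w)) (E w) fst snd.
  - exact: kp0.
  - by rewrite sumE out dvdn_mulr.
  - by rewrite sumE inn.
  - exists c; split=> // i x ik; first by rewrite c2 // sumE out mulKn //; apply: kp0.
    by rewrite c3 // sumE.
have [c cP] := fin_all_exists split.
pose nb t := enum [set s | eT s t].
have nbE s t : (s \in nb t) = eT s t by rewrite mem_enum inE.
have sz t : size (nb t) = kp t by rewrite -cardE.
pose G s t x y := [exists w, [&& val w == t, (x, y) \in E w, eT s t & c w (x, y) == index s (nb t)]].
pose H s t x y := G s t x y || G t s y x.
pose n s x := if insub s is Some w then
   (\sum_(a in O) ((a.2 == x) && (col a == w))) %/ kp s else q x.
have GP s t x y : reflect (exists w, [&& val w == t, (x, y) \in E w, eT s t & c w (x, y) == index s (nb t)]) (G s t x y).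
  exact: existsP.
have Gside s t x y : ~~ side t -> G s t x y = false.
  move=> ts; apply: contraNF ts => /GP[w /and4P[/eqP wt _ _ _]]; rewrite -wt; exact: valP.
have Gw s w x y : eT s (val w) -> G s (val w) x y = (((x, y) \in E w) && (c w (x, y) == index s (nb (val w)))).
  move=> st; apply/GP/andP => [[w' /and4P[/eqP/val_inj -> h _ h']]|[h1 h2]] //.
  by exists w; rewrite eqxx h1 st h2.
have GO s t x y : G s t x y -> (x, y) \in O /\ eT s t.
  by move=> /GP[w /and4P[_]]; rewrite inE => /andP[-> _] ->.
have nD s x : D <= n s x.
  rewrite /n; case: insubP => [w _ <-|_]; last exact: Dq.
  by rewrite leq_divRL ?kp0 // mulnC Din.
exists H, n; split.
- by move=> s t x y; rewrite /H orbC.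
- move=> s t x st; split=> //.
  have [ts|ts] := boolP (side t).
    have ss : ~~ side s by have := eTside s t st; rewrite ts; case: (side s).
    pose w : {t | side t} := Sub t ts; have wt : val w = t by [].
    rewrite /n insubN //; have [_ cw _] := cP w; rewrite -(cw (index s (nb t))); last first.
      by rewrite wt -sz index_mem nbE; apply: st.
    rewrite (eq_bigr (fun a => (c w a == index s (nb t)) * (a.1 == x))); last first.
      by move=> a _; rewrite mulnb andbC.
    rewrite -big_set_filter -card_row; apply: eq_card => y; rewrite inE /H (Gside t s) // orbF.
    by rewrite -wt Gw // !inE.
  have ss : side s by have := eTside s t st; rewrite (negPf ts); case: (side s).
  pose w : {t | side t} := Sub s ss; have wt : val w = s by [].
  have ts' : eT t s by rewrite eTsym.
  rewrite /n -wt valK; have [_ _ cw] := cP w; rewrite -(cw (index t (nb s))); last first.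
    by rewrite wt -sz index_mem nbE; apply: ts'.
  rewrite (eq_bigr (fun a => (c w a == index t (nb s)) * (a.2 == x))); last first.
    by move=> a _; rewrite mulnb andbC.
  rewrite -big_set_filter -card_column; apply: eq_card => y; rewrite inE /H (Gside s t) //=.
  by rewrite -wt Gw // !inE.
- move=> s t x y /orP[] /GO[h1 h2]; first by rewrite eO h1.
  by rewrite eTsym h2 eO h1 orbT.
- have EG x y : (x, y) \in O -> exists s t, G s t x y.
    move=> xyO; set w := col (x, y); have xyE : (x, y) \in E w by rewrite inE xyO eqxx.
    have [cw _ _] := cP w; have := cw _ xyE; rewrite -sz => cs.
    have [s0 _] := deg (val w); exists (nth s0 (nb (val w)) (c w (x, y))), (val w).
    by rewrite Gw; [rewrite xyE index_uniq ?eqxx ?enum_uniq | rewrite -nbE mem_nth].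
  move=> x y; rewrite eO => /orP[] /EG[s [t st]]; first by exists s, t; rewrite /H st.
  by exists t, s; rewrite /H st orbT.
have Guniq s t s' t' x y : G s t x y -> G s' t' x y -> s = s' /\ t = t'.
  move=> /GP[w /and4P[/eqP <-]]; rewrite inE => /andP[_ /eqP cw] st /eqP cs.
  move=> /GP[w' /and4P[/eqP <-]]; rewrite inE => /andP[_ /eqP cw'] st' /eqP cs'.
  have ww : w = w' by rewrite -cw cw'.
  rewrite -ww in st' cs' *; split=> //; rewrite -(nth_index s (s := nb (val w)) (x := s)) ?nbE //.
  by rewrite -cs cs' nth_index ?nbE.
have Gasym s t s' t' x y : G s t x y -> G s' t' y x -> False.
  by move=> /GO[h1 _] /GO[h2 _]; have := Oasym x y; rewrite h1 h2.
move=> s t s' t' x y /orP[] h1 /orP[] h2.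
- exact: Guniq h1 h2.
- by have := Gasym _ _ _ _ _ _ h1 h2.
- by have := Gasym _ _ _ _ _ _ h1 h2.
- by have [-> ->] := Guniq _ _ _ _ _ _ h1 h2.
Qed.

(** * Maximum cuts and structure of trees *)

(** The sum is over ordered pairs and counts each edge twice. *)
Lemma edge_cut_size (V : finType) (e : rel V) k (S : {set V}) : simple_graph e -> k_edge_connected k e ->
  S != set0 -> S != setT -> k <= \sum_(p : V * V | e p.1 p.2) crosses fst snd S p.
Proof.
move=> [esym eirr] ke /set0Pn[a aS] ST.
have [b bS] : exists b, b \notin S.
  by apply/existsP; rewrite -negb_forall; apply: contraNN ST => /forallP h; apply/eqP/setP => x; rewrite h inE.
pose F := [set [set p.1; p.2] | p in [set p : V * V | e p.1 p.2 & crosses fst snd S p]].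
have FE : F \subset edges e.
  apply/subsetP => E /imsetP[p]; rewrite inE => /andP[ep _] ->.
  by apply: (imset_f (fun p : V * V => [set p.1; p.2])); rewrite inE.
apply: leq_trans (_ : #|F| <= _); last first.
  apply: leq_trans (leq_imset_card _ _) _; rewrite -sum1_card big_mkcond [X in _ <= X]big_mkcond.
  by apply: leq_sum => p _; rewrite inE; case: (e _ _); case: (crosses _ _ _ _).
rewrite leqNgt; apply/negP => /(ke F FE) con.
have [x [y [xS yS]]] := connect_crossing (con a b) aS bS.
rewrite /rel_of inE => /andP[/negP notF /imsetP[[u v]]]; rewrite inE /= => uv xy.
apply: notF; rewrite xy; apply: (imset_f (fun p : V * V => [set p.1; p.2]) (x := (u, v))); rewrite inE /= uv /crosses /=.
have: x \in [set u; v] by rewrite -xy !inE eqxx.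
have: y \in [set u; v] by rewrite -xy !inE eqxx orbT.
rewrite !inE => /orP[] /eqP yu /orP[] /eqP xu; move: xS yS; rewrite xu yu ?eirr.
- by move=> ->.
- by move=> -> /negPf ->.
- by move=> -> /negPf ->.
- by move=> ->.
Qed.

(** Exchanging the sides of the vertices of [S] does not enlarge the cut, so at least half of the
    edges leaving [S] belong to it. The remaining factor 2 comes from the double counting in
    [edge_cut_size]. *)
Lemma max_cut (V : finType) (e : rel V) k : simple_graph e -> k_edge_connected k e ->
  exists A : {set V}, forall S : {set V}, S != set0 -> S != setT ->
    k <= 4 * #|[set p in [set p : V * V | [&& e p.1 p.2, p.1 \in A & p.2 \notin A]] | crosses fst snd S p]|.
Proof.
move=> sg ke; have [esym eirr] := sg.
pose f (A : {set V}) := \sum_(p : V * V | e p.1 p.2) crosses fst snd A p.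
have [A _ Amax] := @arg_maxnP _ (set0 : {set V}) predT f isT.
exists A => S S0 ST; have dS := edge_cut_size sg ke S0 ST; rewrite -/(f S) in dS.
pose A' := [set x | (x \in A) (+) (x \in S)].
pose both := \sum_(p : V * V | e p.1 p.2) (crosses fst snd A p && crosses fst snd S p).
have eqf : f A' + 2 * both = f A + f S.
  rewrite /f /both big_distrr -!big_split; apply: eq_bigr => p _; rewrite /crosses !inE /=.
  by case: (p.1 \in A); case: (p.2 \in A); case: (p.1 \in S); case: (p.2 \in S).
set X0 := [set p | [&& _, _ & _]]; suff eqb : both = 2 * #|[set p in X0 | crosses fst snd S p]|.
  by have fA : f A' <= f A := Amax A' isT; move: fA eqf dS; rewrite eqb; clear; lia.
rewrite card_set_filter mul2n -addnn.
pose g (p : V * V) := (p.2, p.1); have gK : involutive g by case.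
rewrite {2}(reindex_inj (inv_inj gK)) /both big_mkcond ![\sum_(_ in _) _]big_mkcond -big_split.
apply: eq_bigr => p _; rewrite /= !inE /= /crosses /= [e p.2 p.1]esym.
by case: (e _ _); case: (p.1 \in A); case: (p.2 \in A); case: (p.1 \in S); case: (p.2 \in S).
Qed.

Lemma tree_bipartition (V : finType) (e : rel V) : is_tree e ->
  exists side : pred V, forall x y, e x y -> side x != side y.
Proof.
move=> te; have [[esym eirr] _] := te.
have [side sP] : exists side : pred V, forall x y, x \in [set: V] -> y \in [set: V] -> e x y -> side x != side y.
  apply: (tree_ind te (Q := fun P => exists side : pred V, forall x y, x \in P -> y \in P -> e x y -> side x != side y)).
    by move=> x; exists predT => y z; rewrite !inE => /eqP -> /eqP ->; rewrite eirr.
  move=> P y x yP xP yx uniq_y [side sP]; exists (fun z => if z == x then ~~ side y else side z) => u v.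
  rewrite !in_setU1; case: (u =P x) => [->|_] /=; case: (v =P x) => [->|_] //=; rewrite ?eirr //.
  - by move=> _ vP; rewrite esym => /(uniq_y _ vP) ->; case: (side y).
  - by move=> uP _ /(uniq_y _ uP) ->; case: (side y).
  - exact: sP.
by exists side => x y; apply: sP; rewrite inE.
Qed.

(** The last vertex added in the growth of the tree is a leaf. It supplies the colour with kappa =
    1. *)
Lemma tree_leaf (V : finType) (e : rel V) : is_tree e -> 1 < #|V| -> exists x, #|[set y | e y x]| = 1.
Proof.
move=> te V1; have [[esym eirr] _] := te.
have : 1 < #|[set: V]| -> exists2 x, x \in [set: V] & #|[set y in [set: V] | e y x]| = 1.
  apply: (tree_ind te (Q := fun P : {set V} => 1 < #|P| -> exists2 x, x \in P & #|[set y in P | e y x]| = 1)).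
    by move=> x; rewrite cards1.
  move=> P y x yP xP yx uniq_y _ _; exists x; first by rewrite !inE eqxx.
  rewrite (_ : [set _ in _ | _] = [set y]) ?cards1 //.
  apply/setP => z; rewrite !inE; have [->|zx] := eqVneq z x.
    by rewrite eirr andbF; symmetry; apply: contraNF xP => /eqP ->.
  by apply/andP/eqP => [[zP /uniq_y]|->]; [apply | rewrite yP yx].
rewrite cardsT => /(_ V1)[x _ <-]; exists x; congr #|pred_of_set _|.
by apply/setP => y; rewrite !inE.
Qed.

Lemma card_edges_oriented (V : finType) (e : rel V) (O : {set V * V}) :
  (forall x y, e x y = ((x, y) \in O) || ((y, x) \in O)) ->
  (forall x y, ~~ (((x, y) \in O) && ((y, x) \in O))) -> #|edges e| = #|O|.
Proof.
move=> eO Oasym.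
have -> : edges e = [set [set p.1; p.2] | p in O].
  apply/setP => E; apply/imsetP/imsetP => -[[x y]]; rewrite ?inE /=.
    rewrite eO => /orP[] h ->; first by exists (x, y).
    by exists (y, x) => //=; rewrite setUC.
  by move=> h ->; exists (x, y); rewrite // inE /= eO h.
apply: card_in_imset => -[x y] [u v] xyO uvO /= xy.
have: x \in [set u; v] by rewrite -xy !inE eqxx.
have: y \in [set u; v] by rewrite -xy !inE eqxx orbT.
have: u \in [set x; y] by rewrite xy !inE eqxx.
have: v \in [set x; y] by rewrite xy !inE eqxx orbT.
have := Oasym x y; rewrite !inE xyO /= => yxO vxy uxy yuv xuv.
have [xu|xu] := eqVneq x u.
  by subst u; move: vxy yuv; case: (v =P y) => [->|] //= vy; rewrite orbF => /eqP vx; subst v; rewrite orbb => /eqP yx; rewrite yx.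
move: xuv uxy; rewrite (negPf xu) [u == x]eq_sym (negPf xu) /= => /eqP xv /eqP uy.
by rewrite xv -uy uvO in yxO.
Qed.

(** * Correcting in-degrees by cherries *)

Definition cherry_arcs (V : finType) (C : {set V * V * V}) : {set V * V} :=
  [set p | [exists c in C, cherry_uses p c]].

(** An arbitrary summand [F] is allowed because numbers of tails and of heads in a given colour are
    both such sums over the arcs. *)
Lemma sum_cherry_arcs (V W : finType) (C : {set V * V * V}) (cL cR : V * V * V -> W) :
  (forall c, c \in C -> c.1.2 != c.2) ->
  (forall e c c', c \in C -> c' \in C -> cherry_uses e c -> cherry_uses e c' -> c = c') ->
  W -> exists col : V * V -> W, forall F : V * V -> W -> nat,
    \sum_(p in cherry_arcs C) F p (col p) =
    \sum_(c in C) (F (c.1.1, c.1.2) (cL c) + F (c.1.1, c.2) (cR c)).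
Proof.
move=> ne uniq_c w0; pose col p := if [pick c in C | cherry_uses p c] is Some c then
  (if p == (c.1.1, c.1.2) then cL c else cR c) else w0.
have colE p c : c \in C -> cherry_uses p c -> col p = if p == (c.1.1, c.1.2) then cL c else cR c.
  move=> cC pc; rewrite /col; case: pickP => [c' /andP[c'C pc']|/(_ c)]; last by rewrite cC pc.
  by rewrite (uniq_c p c c').
exists col => F.
transitivity (\sum_(p in cherry_arcs C) \sum_(c in C | cherry_uses p c) F p (col p)).
  apply: eq_bigr => p; rewrite inE => /existsP[c /andP[cC pc]].
  by rewrite (big_pred1 c) // => c' /=; apply/andP/eqP => [[h1 h2]|->] //; apply: (uniq_c p).
rewrite (exchange_big_dep (mem C)) /=; last by move=> p c _ /andP[].
apply: eq_bigr => c cC.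
have L : cherry_uses (c.1.1, c.1.2) c by rewrite /cherry_uses eqxx.
have R : cherry_uses (c.1.1, c.2) c by rewrite /cherry_uses eqxx orbT.
have LR : ((c.1.1, c.2) == (c.1.1, c.1.2)) = false.
  by rewrite xpair_eqE eqxx eq_sym (negPf (ne c cC)).
have inQ p : cherry_uses p c -> p \in cherry_arcs C.
  by move=> pc; rewrite inE; apply/existsP; exists c; rewrite cC pc.
rewrite (bigD1 (c.1.1, c.1.2)) /=; last by rewrite inQ // cC L.
rewrite (bigD1 (c.1.1, c.2)) /=; last by rewrite inQ // LR cC R.
rewrite big1 ?addn0 => [|p]; first by rewrite (colE _ c) // (colE _ c) // eqxx LR.
move=> /andP[/andP[/and3P[_ _ /orP[] /eqP ->]]]; by rewrite eqxx.
Qed.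

Section SideColoring.
Variables (W : finType) (kap : W -> nat) (w0 : W) (m D : nat).
Hypotheses (m0 : 0 < m) (kap0 : forall w, 0 < kap w) (kapm : forall w, kap w <= m) (kap_w0 : kap w0 = 1).

(* Both arcs of a cherry with bulk label [w] get colour [w]; a cherry with switch label [w]
   has one arc of colour [w] and one of colour [w0]. *)
Definition bulk_labels := m * D.
Definition switch_labels := 8 * m * m + m.
Definition cherry_labels : finType := (W * 'I_(bulk_labels + switch_labels))%type.
(** The first term is what [packing] asks for with one class per label and bundles of size [4 * m].
    The others serve the third clause of [side_colorable]: of N cherries at a centre at most S = N /
    (4m) + 1 are selected, and m (m + D + 2S) stays below the 2N arcs of all these cherries. *)
Definition cherry_bound := 2 * #|cherry_labels| * (4 * m) + m * m + m * D + 2 * m + 1.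

(* [g] counts the in-arcs outside [Q]: the arcs of [Q] can be coloured so as to correct their
   number modulo [kap], with the out-degrees [cnt] fixed in advance. *)
Definition side_colorable (V : finType) (B : {set V}) (P : {set V * V}) : Prop :=
  exists (Q : {set V * V}) (cnt : V -> W -> nat),
   [/\ Q \subset P,
      forall x, \sum_w cnt x w = \sum_(p in Q) (p.1 == x),
      forall x, x \notin B -> m * (m + D + \sum_w cnt x w) <= \sum_(p in P) (p.1 == x) &
      forall g : V -> W -> nat,
        (forall w, kap w %| \sum_(y in B) g y w + \sum_(x | x \notin B) cnt x w) ->
        exists col : V * V -> W,
          [/\ forall x w, \sum_(p in Q) ((p.1 == x) && (col p == w)) = cnt x w,
              forall y w, y \in B -> kap w %| g y w + \sum_(p in Q) ((p.2 == y) && (col p == w)) &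
              forall y w, y \in B -> kap w * D <= \sum_(p in Q) ((p.2 == y) && (col p == w))]].

Variables (V : finType) (B : {set V}) (P : {set V * V}) (C : {set V * V * V}).
Hypothesis PB : forall p, p \in P -> p.1 \notin B /\ p.2 \in B.
Hypothesis CP : forall c, c \in C -> [/\ (c.1.1, c.1.2) \in P, (c.1.1, c.2) \in P & c.1.2 != c.2].
Hypothesis C_uniq : forall e c c', c \in C -> c' \in C -> cherry_uses e c -> cherry_uses e c' -> c = c'.
Hypothesis C_cut : forall Y : {set V}, Y \subset B -> Y != set0 -> Y != B ->
  cherry_bound <= #|[set c in C | crosses (@lift_left V) (@lift_right V) Y c]|.
Hypothesis C_centre : forall a, a \notin B -> cherry_bound <= #|[set c in C | c.1.1 == a]|.

Definition has_label (lab : V * V * V -> option cherry_labels) (w : W)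
    (I : pred 'I_(bulk_labels + switch_labels)) (c : V * V * V) : bool :=
  if lab c is Some (w', i) then (w' == w) && I i else false.

(** The cherries with a common centre are cut into bundles of [4 * m], of which at most one member
    is selected, so only a small part of the arcs at a centre is committed. Each label yields a
    connected multigraph on [B], whence the bound on cuts. *)
Lemma label_cherries : exists lab : V * V * V -> option cherry_labels,
  [/\ forall c, lab c -> c \in C,
      forall a, a \notin B -> \sum_(c in [set c | lab c]) (c.1.1 == a) <=
        (\sum_(c in C) (c.1.1 == a)) %/ (4 * m) + 1 &
      forall w I (Y : {set V}), Y \subset B -> Y != set0 -> Y != B ->
        #|I| <= \sum_(c | has_label lab w I c) crosses (@lift_left V) (@lift_right V) Y c].
Proof.
have M0 : 0 < 4 * m by rewrite muln_gt0.
have [blk blkP] := blocks_of_size C (fun c => c.1.1) M0.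
have [||c cC||bi|lab [lab1 lab2 lab3]] :=
  @packing V _ _ (@lift_left V) (@lift_right V) B C (fun c => (c.1.1, blk c)) #|cherry_labels| (4 * m) cherry_bound.
- exact: M0.
- by rewrite /cherry_bound; lia.
- by have [/PB[_ /= h1] /PB[_ /= h2] _] := CP cC.
- exact: C_cut.
- case: bi => x j; rewrite card_set_filter; apply: leq_trans (_ : \sum_(c in C) ((c.1.1 == x) && (blk c == j)) <= _).
    by apply: leq_sum => c _; rewrite xpair_eqE.
  rewrite blkP /=; case: ltnP => // _; case: eqP => // _; rewrite ltnW // ltn_mod //.
exists (fun c => omap enum_val (lab c)).
have lab1' c l : omap enum_val (lab c) = Some l -> lab c = Some (enum_rank l).
  by case: (lab c) => //= i [<-]; rewrite enum_valK.
split=> [c|a aB|w I Y YB Y0 YnB].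
- by case lc: (lab c) => [l|] // _; apply: lab1 lc.
- set N := \sum_(c in C) _; rewrite -card_set_filter.
  apply: leq_trans (_ : #|[set j : 'I_#|{: V * V * V}|.+1 | j < N %/ (4 * m) + 1]| <= _); last first.
    have [le|lt] := leqP (N %/ (4 * m) + 1) #|{: V * V * V}|.+1.
      by rewrite -sum1dep_card -(big_ord_widen _ (fun=> 1) le) sum1_card card_ord.
    by apply: leq_trans (max_card _) _; rewrite card_ord ltnW.
  have injb : {in [set c in [set c | omap enum_val (lab c)] | c.1.1 == a] &, injective blk}.
    move=> c c'; rewrite !inE => /andP[lc /eqP ca] /andP[lc' /eqP ca'] bb.
    apply: lab2; rewrite ?ca ?ca' ?bb //; by [case: (lab c) lc | case: (lab c') lc'].
  rewrite -(card_in_imset injb); apply/subset_leq_card/subsetP => j /imsetP[c].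
  rewrite !inE => /andP[lc /eqP ca] jc; rewrite addn1 ltnS.
  have cC : c \in C by case lc': (lab c) lc => [l|] // _; apply: lab1 lc'.
  have := blkP a j; rewrite /= -/N (sum_setD1 _ cC) ca jc !eqxx /=.
  by case: ltngtP.
- apply: leq_trans (_ : \sum_(i in I) \sum_(c | has_label (fun c => omap enum_val (lab c)) w (pred1 i) c)
     crosses (@lift_left V) (@lift_right V) Y c <= _).
    rewrite -sum1_card; apply: leq_sum => i iI.
    have [c] := lab3 (enum_rank (w, i)) Y YB Y0 YnB; rewrite inE => /eqP lc cY.
    by rewrite (bigD1 c) ?cY // /has_label /= lc /= enum_rankK !eqxx.
  rewrite (exchange_big_dep (has_label (fun c => omap enum_val (lab c)) w I)) /=; last first.
    move=> i c iI; rewrite /has_label; case: (omap _ _) => // -[w' i'] /andP[-> /eqP ->]; exact: iI.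
  apply: leq_sum => c; rewrite /has_label; case: (omap _ _) => // -[w' i'] /andP[ww i'I].
  rewrite (eq_bigl (pred1 i')) ?big_pred1_eq // => i /=; rewrite ww /=.
  by apply/andP/eqP => [[_ /eqP]|->]; rewrite ?eqxx.
Qed.

(** For a colour w other than [w0], the lifted switch cherries of w are connected enough, thanks to
    [switch_labels], to be oriented modulo kappa_w; the tail of the oriented edge receives w, its
    other end [w0]. The bulk cherries secure the lower bound on the in-degrees. Whatever happens to
    [w0] is harmless, as its kappa is 1. *)
Lemma side_coloring : B != set0 -> B != setT -> side_colorable B P.
Proof.
move=> B0 BT; have [a aB] : exists a, a \notin B.
  by apply/existsP; rewrite -negb_forall; apply: contraNN BT => /forallP h; apply/eqP/setP => x; rewrite h inE.
have B1 : 1 < #|B|.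
  have : 0 < #|[set c in C | c.1.1 == a]| by apply: leq_trans (C_centre aB); rewrite /cherry_bound addn1.
  move=> /card_gt0P[c]; rewrite inE => /andP[cC _]; have [/PB[_ h1] /PB[_ h2] h3] := CP cC.
  by apply/card_gt1P; exists c.1.2, c.2.
have [lab [labC lab_centre lab_many]] := label_cherries.
set Sel := [set c | lab c] in lab_centre.
have SelC : Sel \subset C by apply/subsetP => c; rewrite inE => /labC.
pose bulk_i : pred 'I_(bulk_labels + switch_labels) := fun i => i < bulk_labels.
pose switch_i : pred 'I_(bulk_labels + switch_labels) := fun i => ~~ (i < bulk_labels).
have card_bulk : #|bulk_i| = bulk_labels.
  rewrite -sum1_card -(big_ord_widen _ (fun=> 1)) ?leq_addr //.
  by rewrite sum1_card card_ord.
have card_switch : #|switch_i| = switch_labels.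
  apply/eqP; rewrite -(eqn_add2l #|bulk_i|) (cardC bulk_i) card_ord card_bulk //.
pose top c := if lab c is Some (w, i) then w else w0.
pose bot c := if lab c is Some (w, i) then (if bulk_i i then w else w0) else w0.
pose blk w c := has_label lab w bulk_i c.
pose swt w := [set c in Sel | has_label lab w switch_i c].
pose cnt x w := \sum_(c in Sel) (c.1.1 == x) * ((top c == w) + (bot c == w)).
have Selne c : c \in Sel -> c.1.2 != c.2 by move=> /(subsetP SelC)/CP[].
have SelU e c c' : c \in Sel -> c' \in Sel -> cherry_uses e c -> cherry_uses e c' -> c = c'.
  by move=> /(subsetP SelC) h /(subsetP SelC); apply: C_uniq.
have arcsP (C' : {set V * V * V}) : C' \subset C -> cherry_arcs C' \subset P.
  move=> /subsetP C'C; apply/subsetP => p; rewrite inE => /existsP[c /andP[/C'C/CP[h1 h2 _]]].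
  by move=> /orP[] /eqP ->.
have cntE x : \sum_w cnt x w = 2 * \sum_(c in Sel) (c.1.1 == x).
  rewrite exchange_big big_distrr; apply: eq_bigr => c _ /=.
  have one (z : W) : \sum_w (z == w) = 1 by rewrite (bigD1 z) //= eqxx big1 // => w; rewrite eq_sym => /negPf ->.
  by rewrite -big_distrr big_split /= !one mulnC.
exists (cherry_arcs Sel), cnt; split; first exact: arcsP.
- move=> x; have [col colP] := sum_cherry_arcs (fun=> w0) (fun=> w0) Selne SelU w0.
  by rewrite cntE (colP (fun p _ => p.1 == x)) big_split /= addnn -mul2n.
- move=> x xB; set N := \sum_(c in C) (c.1.1 == x).
  have N2 : 2 * N <= \sum_(p in P) (p.1 == x).
    have [|col0 sumC] := @sum_cherry_arcs V _ C (fun=> w0) (fun=> w0) _ C_uniq w0; first by move=> c /CP[].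
    have := sumC (fun p _ => p.1 == x); rewrite /= big_split /= addnn -mul2n => <-.
    by rewrite [X in _ <= X](big_setID (cherry_arcs C)) /= (setIidPr (arcsP C (subxx C))) leq_addr.
  have Nb : cherry_bound <= N by rewrite /N -card_set_filter; apply: C_centre.
  have := lab_centre x xB; rewrite cntE -/N; move: Nb N2; rewrite /cherry_bound.
  set S := \sum_(c in Sel) _; move: (leq_trunc_div N (4 * m)); move: (N %/ (4 * m)) => d; move: S => S.
  move: (\sum_(p in P) _) (N) (2 * #|_| * (4 * m)) m0; clear=> T N' Z m0 dN ZN NT Sd.
  have h1 : m * S <= m * (d + 1) by rewrite leq_mul2l Sd orbT.
  move: dN ZN NT; nia.
move=> g gP.
pose lL := @lift_left V; pose lR := @lift_right V.
pose bd y w := \sum_(c in Sel) blk w c * ((lL c == y) + (lR c == y)).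
have labelE w c : w != w0 -> (top c == w) + (bot c == w) = 2 * blk w c + has_label lab w switch_i c.
  move=> ww; rewrite /top /bot /blk /has_label /switch_i /bulk_i; case: (lab c) => [[w' i]|]; last by rewrite eq_sym (negPf ww).
  by case: (i < _); case: (w' =P w) => //= _; rewrite ?(eq_sym w0) ?(negPf ww).
have has_Sel w I c : has_label lab w I c -> c \in Sel.
  by rewrite /has_label inE; case: (lab c).
have orient w : exists o, forall y, y \in B -> kap w %| g y w + bd y w + out_degree lL lR o (swt w) y.
  have [->|ww] := eqVneq w w0; first by exists (fun=> true) => y _; rewrite kap_w0 dvd1n.
  have Esw c : c \in swt w -> c \in C by rewrite inE => /andP[/(subsetP SelC)].
  (* A selected cherry brings to [B] as many arcs of colour w as it contributes to [cnt] at its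
     centre: two if it is a bulk cherry of w, one if it is a switch cherry of w. *)
  have tot : kap w %| \sum_(y in B) (g y w + bd y w) + #|swt w|.
    have := gP w; congr (_ %| _); rewrite big_split -addnA; congr (_ + _) => /=.
    rewrite exchange_big [X in _ = X + _]exchange_big card_set_filter -big_split; apply: eq_bigr => c cS /=.
    have [/PB[/= c1 c2] /PB[/= _ c3] _] := CP (subsetP SelC c cS).
    rewrite -big_distrl -[in RHS]big_distrr big_split /= !sum_eq_mem c2 c3 labelE // mulnC [RHS]addnC.
    rewrite (bigD1 c.1.1) //= eqxx big1 ?addn0 ?mul1n; last by move=> x /andP[_]; rewrite eq_sym => /negPf ->.
    by rewrite muln1 addnC mulnC.
  (* The factor [(kap w).-1] stands for -1 modulo [kap w]. *)
  have [|//|c /Esw/CP[/PB[_ c1] /PB[_ c2] c3]|A AB A0 AnB||o oP] :=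
    @modular_orientation _ _ (kap w) lL lR B (swt w) (fun y => (kap w).-1 * (g y w + bd y w)).
  - exact: kap0.
  - by [].
  - have := lab_many w switch_i A AB A0 AnB; rewrite card_switch => h.
    apply: leq_trans (leq_trans h _); first by rewrite leq_add // leq_mul // leq_mul.
    rewrite /cut_size big_mkcond [X in _ <= X]big_mkcond leq_sum // => c _.
    by rewrite inE; case: ifP => // hc; rewrite (has_Sel _ _ _ hc).
  - rewrite -big_distrr /=; apply/eqP; rewrite -(eqn_modDr (\sum_(y in B) (g y w + bd y w))).
    rewrite -mulSnr prednK // modnMr eq_sym; rewrite addnC; exact: tot.
  exists o => y yB; rewrite /dvdn -modnDmr oP // modnDmr -mulSn prednK // modnMr //.
have [o oP] := fin_all_exists orient.
pose cL c := if o (top c) c then top c else bot c.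
pose cR c := if o (top c) c then bot c else top c.
have [col colP] := sum_cherry_arcs cL cR Selne SelU w0.
have headE y w : \sum_(p in cherry_arcs Sel) ((p.2 == y) && (col p == w)) =
   \sum_(c in Sel) (((lL c == y) && (cL c == w)) + ((lR c == y) && (cR c == w))).
  exact: (colP (fun p u => (p.2 == y) && (u == w))).
exists col; split.
- move=> x w; rewrite (colP (fun p u => (p.1 == x) && (u == w))) /=; apply: eq_bigr => c _.
  by rewrite /cL /cR; case: (c.1.1 == x); case: (o _ _); rewrite //= mul1n // addnC.
- move=> y w yB; have [->|ww] := eqVneq w w0; first by rewrite kap_w0 dvd1n.
  have := oP w y yB; congr (_ %| _); rewrite -addnA; congr (_ + _); rewrite headE.
  rewrite /out_degree big_set_filter -big_split; apply: eq_bigr => c _ /=.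
  rewrite /cL /cR /top /bot /blk /has_label /switch_i /bulk_i; case: (lab c) => [[w' i]|]; last first.
    by rewrite !if_same (eq_sym w0) (negPf ww) !andbF.
  have [->|/negPf w'w] := eqVneq w' w; case: (i < _) => /=; rewrite ?if_same ?eqxx ?w'w ?andbF ?andbT ?mul1n ?mul0n ?addn0 //=.
    by case: (o w c); rewrite (eq_sym w0) (negPf ww) eqxx ?andbF ?andbT ?addn0.
  by case: (o w' c); rewrite (eq_sym w0) (negPf ww) w'w !andbF.
move=> y w yB; apply: leq_trans (_ : bd y w <= _); last first.
  rewrite headE; apply: leq_sum => c _; rewrite /blk /has_label /cL /cR /top /bot /bulk_i.
  case: (lab c) => [[w' i]|] //; case: (i < _); rewrite ?andbF // if_same.
  by case: (w' =P w) => // _; rewrite !andbT mul1n.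
have yB' : [set y] \subset B by rewrite sub1set.
have y0 : [set y] != set0 by apply/set0Pn; exists y; rewrite inE.
have ynB : [set y] != B by apply: contraTneq B1 => <-; rewrite cards1.
have := lab_many w bulk_i [set y] yB' y0 ynB; rewrite card_bulk /bulk_labels => h.
apply: leq_trans (leq_trans h _); first by rewrite leq_mul2r kapm orbT.
rewrite /bd big_mkcond [X in _ <= X]big_mkcond leq_sum // => c _; rewrite /blk.
case: ifP => // hc; rewrite (has_Sel _ _ _ hc) mul1n /crosses !inE.
by case: (_ == _); case: (_ == _).
Qed.

End SideColoring.

(** * The oriented colouring of the whole graph *)

Section OrientedColoring.
Variables (W : finType) (kap : W -> nat) (w0 : W) (m D : nat).
Hypotheses (m0 : 0 < m) (kap0 : forall w, 0 < kap w) (kapm : \sum_w kap w = m) (kap_w0 : kap w0 = 1).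

Let kap_le w : kap w <= m.
Proof. by rewrite -kapm (bigD1 w) //= leq_addr. Qed.

Let K1 := cherry_bound W m D.

Lemma side_colorable_of_packing (V : finType) (B : {set V}) (P : {set V * V}) (cl : bool -> 'I_K1 -> {set V * V}) :
  B != set0 -> B != setT -> (forall p, p \in P -> p.1 \notin B /\ p.2 \in B) ->
  (forall b i, cl b i \subset P) -> (forall b i b' i', (b, i) != (b', i') -> [disjoint cl b i & cl b' i']) ->
  (forall b i, cut_connected fst snd setT (cl b i)) ->
  side_colorable kap m D B P.
Proof.
move=> B0 BT PB clP dis con.
have [C [C1 C2 C3 C4]] : exists C : {set V * V * V},
   [/\ forall c, c \in C -> [/\ (c.1.1, c.1.2) \in P, (c.1.1, c.2) \in P & c.1.2 != c.2],
       forall e c c', c \in C -> c' \in C -> cherry_uses e c -> cherry_uses e c' -> c = c',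
       forall Y : {set V}, Y \subset B -> Y != set0 -> Y != B ->
         K1 <= #|[set c in C | crosses (@lift_left V) (@lift_right V) Y c]| &
       forall a, a \notin B -> K1 <= #|[set c in C | c.1.1 == a]|].
  apply: (cherries (S := cl true) (J := cl false) B0 PB) => //; first by move=> i j; apply: dis.
  by move=> i j ij; rewrite !dis // xpair_eqE.
exact: (side_coloring m0 kap0 kap_le kap_w0 PB C1 C2 C3 C4).
Qed.

Definition swap (V : Type) (p : V * V) : V * V := (p.2, p.1).

Lemma swapK (V : Type) : involutive (@swap V). Proof. by case. Qed.

Lemma crosses_swap (V : finType) (S : {set V}) p : crosses fst snd S (swap p) = crosses fst snd S p.
Proof. by rewrite /crosses addbC. Qed.

(** Of the classes packed into the maximum cut, 8m^2 + m stay in [P0], with all unlabelled edges,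
    for an orientation modulo [m]; each side gets [K1] pairs to be lifted by [cherries]. Packing [r]
    classes takes cuts of size 2r and the maximum cut costs a factor 4, hence 8r. The heads of [P1]
    lie outside [A], those of [P2] in [A], each on the side whose in-degrees they correct. *)
Lemma cut_packing : exists K, forall (V : finType) (e : rel V), simple_graph e -> 1 < #|V| ->
  k_edge_connected K e -> exists (A : {set V}) (P0 P1 P2 : {set V * V}),
  [/\ forall x y, (x, y) \in P0 -> [/\ x \in A, y \notin A & e x y],
      forall x y, x \in A -> y \notin A -> ((x, y) \in P0) + ((x, y) \in P1) + ((y, x) \in P2) = e x y :> nat,
      side_colorable kap m D (~: A) P1 /\ (forall x y, (x, y) \in P1 -> x \in A /\ y \notin A),
      side_colorable kap m D A P2 /\ (forall x y, (x, y) \in P2 -> x \notin A /\ y \in A) &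
      forall S : {set V}, S != set0 -> S != setT -> 8 * m * m + m <= cut_size fst snd P0 S].
Proof.
pose K0 := 8 * m * m + m.
pose Lt : finType := ('I_K0 + bool * (bool * 'I_K1))%type; pose r := #|Lt|.
exists (8 * r) => V e sg V1 ke; have [esym eirr] := sg.
have K00 : 0 < K0 by rewrite /K0 addn_gt0 m0 orbT.
have r0 : 0 < r by rewrite /r /Lt card_sum card_ord addn_gt0 K00.
have [A Acut] := max_cut sg ke; set X0 := [set p | [&& _, _ & _]] in Acut.
have X0cut (S : {set V}) : S != set0 -> S != setT -> 2 * r <= #|[set p in X0 | crosses fst snd S p]|.
  by move=> S0 ST; have := Acut S S0 ST; clear; lia.
have [[x0 y0] X0xy] : exists p, p \in X0.
  have [x _] : exists x, x \in [set: V] by apply/card_gt0P; rewrite cardsT ltnW.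
  have xT : [set x] != setT by apply: contraTneq V1 => xT; rewrite -cardsT -xT cards1.
  have x0 : [set x] != set0 by apply/set0Pn; exists x; rewrite inE.
  have h : 0 < #|[set p in X0 | crosses fst snd [set x] p]|.
    by apply: leq_trans (X0cut _ x0 xT); rewrite muln_gt0.
  by have /card_gt0P[p] := h; rewrite inE => /andP[pX _]; exists p.
move: X0xy; rewrite inE /= => /and3P[_ x0A y0A].
have [|||S _|i|lab [lab1 _ lab3]] := @packing V _ _ fst snd setT X0 id r 1 (2 * r).
- by [].
- by rewrite muln1.
- by move=> p _; rewrite !inE.
- exact: X0cut.
- rewrite -(cards1 i); apply/subset_leq_card/subsetP => p; rewrite !inE => /andP[_ /eqP ->].
  by rewrite eqxx.
pose cl (l : Lt) := [set p | lab p == Some (enum_rank l)].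
have clX l : cl l \subset X0 by apply/subsetP => p; rewrite inE => /eqP /lab1.
have dis l l' : l != l' -> [disjoint cl l & cl l'].
  move=> ll; rewrite -setI_eq0; apply: contraNT ll => /set0Pn[p]; rewrite !inE => /andP[/eqP -> /eqP[h]].
  by rewrite (enum_rank_inj h).
have clcon l : cut_connected fst snd setT (cl l) by apply: lab3.
pose kind b p := [exists l : bool * 'I_K1, p \in cl (inr (b, l))].
pose P1 := [set p | kind true p]; pose P2 := [set p | kind false (swap p)].
pose P0 := [set p in X0 | ~~ kind true p & ~~ kind false p].
have kindX b p : kind b p -> p \in X0 by move=> /existsP[l]; apply/subsetP.
have kind_excl p : ~~ (kind true p && kind false p).
  apply/negP => /andP[/existsP[l pl] /existsP[l' pl']].
  have := dis (inr (true, l)) (inr (false, l')) isT; rewrite -setI_eq0 => /eqP/setP/(_ p).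
  by rewrite in_set0 in_setI pl pl'.
exists A, P0, P1, P2; split.
- by move=> x y; rewrite !inE /= => /andP[/and3P[-> -> ->]].
- move=> x y xA yA; rewrite !inE /= xA yA /= andbT.
  have := kind_excl (x, y); have /implyP := @kindX true (x, y); have /implyP := @kindX false (x, y).
  rewrite !inE /= xA yA /= andbT /swap /=.
  by case: (kind true _); case: (kind false _); case: (e x y).
- split; last by move=> x y; rewrite inE => /kindX; rewrite inE /= => /and3P[_ -> ->].
  apply: (side_colorable_of_packing (cl := fun b i => cl (inr (true, (b, i))))).
  + by apply/set0Pn; exists y0; rewrite inE.
  + by apply: contraTneq x0A => /setP/(_ x0); rewrite !inE => ->.
  + by move=> p; rewrite inE => /kindX; rewrite !inE => /and3P[_ -> ->].
  + by move=> b i; apply/subsetP => p pc; rewrite inE; apply/existsP; exists (b, i).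
  + by move=> b i b' i' ne; apply: dis; rewrite -[_ == _]/((true, (b, i)) == (true, (b', i'))) xpair_eqE eqxx.
  + by move=> b i; apply: clcon.
- split; last by move=> x y; rewrite inE => /kindX; rewrite inE /= => /and3P[_ -> ->].
  apply: (side_colorable_of_packing (cl := fun b i => [set p | swap p \in cl (inr (false, (b, i)))])).
  + by apply/set0Pn; exists x0.
  + by apply: contraNneq y0A => ->; rewrite inE.
  + by move=> p; rewrite inE => /kindX; rewrite !inE => /and3P[_ -> ->].
  + by move=> b i; apply/subsetP => p; rewrite [in X in X -> _]inE => pc; rewrite inE; apply/existsP; exists (b, i).
  + move=> b i b' i' ne; have := dis (inr (false, (b, i))) (inr (false, (b', i'))) _.
    rewrite -!setI_eq0 => /(_ ne)/eqP/setP h; apply/eqP/setP => p; have := h (swap p).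
    by rewrite !inE.
  + move=> b i S SU S0 ST; have [p pc pS] := clcon (inr (false, (b, i))) S SU S0 ST.
    by exists (swap p); rewrite ?crosses_swap // inE swapK.
move=> S S0 ST; rewrite -/K0 -[K0]card_ord -sum1_card.
apply: leq_trans (_ : \sum_(i : 'I_K0) \sum_(p in P0) (p \in cl (inl i)) * crosses fst snd S p <= _).
  apply: leq_sum => i _; have [p pc pS] := clcon (inl i) S (subsetT S) S0 ST.
  have pP0 : p \in P0.
    have nk b : ~~ kind b p.
      apply/negP => /existsP[l pl]; have := dis (inl i) (inr (b, l)) isT; rewrite -setI_eq0 => /eqP/setP/(_ p).
      by rewrite in_set0 in_setI pc pl.
    by rewrite !inE !nk !andbT; have := subsetP (clX _) p pc; rewrite inE.
  by rewrite (bigD1 p) //= pc pS.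
rewrite exchange_big; apply: leq_sum => p _; rewrite -big_distrl /=.
rewrite -[X in _ <= X]mul1n leq_mul2r; apply/orP; right.
case: (pickP [pred i : 'I_K0 | p \in cl (inl i)]) => [i /= pi|none]; last by rewrite big1 // => i _; have := none i => /= ->.
rewrite (bigD1 i) //= pi big1 // => j ji.
have : [disjoint cl (inl i) & cl (inl j)] by apply: dis; apply: contraNneq ji => -[->].
by rewrite -setI_eq0 => /eqP/setP/(_ p); rewrite in_set0 in_setI pi /= => ->.
Qed.
End OrientedColoring.

Lemma sum_indicator (X : finType) (S : {set X}) (F : X -> nat) :
  \sum_(p in S) F p = \sum_p (p \in S) * F p.
Proof. by rewrite big_mkcond; apply: eq_bigr => p _; case: ifP; rewrite ?mul1n. Qed.

Lemma sum_heads_tails (V : finType) (S : {set V * V}) (c : pred (V * V)) (B B' : {set V}) :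
  (forall p, p \in S -> (p.2 \in B) = (p.1 \in B')) ->
  \sum_(y in B) \sum_(p in S) ((p.2 == y) && c p) = \sum_(x in B') \sum_(p in S) ((p.1 == x) && c p).
Proof.
move=> SB; rewrite exchange_big [RHS]exchange_big; apply: eq_bigr => p pS /=.
case: (c p); last by rewrite !big1 // => x _; rewrite andbF.
under eq_bigr => y _ do rewrite andbT.
by under [RHS]eq_bigr => y _ do rewrite andbT; rewrite !sum_eq_mem SB.
Qed.

(** Only [P0] is oriented with care, so that each out-degree becomes a multiple m q of [m] and
    splits into the numbers kappa_w q. The arcs of [Q1] and [Q2] commit themselves to the numbers
    [cnt] before their colours are known; this lets all other arcs be coloured first and [Q1], [Q2]
    respond to the in-degrees that result. *)
Lemma oriented_coloring (W : finType) (kap : W -> nat) (w0 : W) (m D : nat) : 0 < m ->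
  (forall w, 0 < kap w) -> \sum_w kap w = m -> kap w0 = 1 ->
  exists K, forall (V : finType) (e : rel V), simple_graph e -> 1 < #|V| ->
  k_edge_connected K e -> m %| #|edges e| -> exists (O : {set V * V}) (col : V * V -> W) (q : V -> nat),
  [/\ forall x y, ((x, y) \in O) + ((y, x) \in O) = e x y :> nat,
      forall x w, \sum_(p in O) ((p.1 == x) && (col p == w)) = kap w * q x,
      forall x, D <= q x,
      forall y w, kap w %| \sum_(p in O) ((p.2 == y) && (col p == w)) &
      forall y w, kap w * D <= \sum_(p in O) ((p.2 == y) && (col p == w))].
Proof.
move=> m0 kap0 kapm kap_w0; have [K KP] := cut_packing D m0 kap0 kapm kap_w0.
exists K => V e sg V1 ke dv; have [esym eirr] := sg.
have [A [P0 [P1 [P2 [P0A part [sc1 P1A] [sc2 P2A] P0cut]]]]] := KP V e sg V1 ke.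
have [Q1 [cnt1 [Q1P1 sum1 bd1 col1P]]] := sc1; have [Q2 [cnt2 [Q2P2 sum2 bd2 col2P]]] := sc2.
have P0F x y : ~~ ((x \in A) && (y \notin A)) -> ((x, y) \in P0) = false.
  by apply: contraNF => /P0A[-> -> _].
have P1F x y : ~~ ((x \in A) && (y \notin A)) -> ((x, y) \in P1) = false.
  by apply: contraNF => /P1A[-> ->].
have P2F x y : ~~ ((x \notin A) && (y \in A)) -> ((x, y) \in P2) = false.
  by apply: contraNF => /P2A[-> ->].
pose I := [set p : V * V | [&& e p.1 p.2, (p.1 \in A) == (p.2 \in A) & enum_rank p.1 < enum_rank p.2]].
have IF x y : (x \in A) != (y \in A) -> ((x, y) \in I) = false.
  by move=> h; rewrite inE /= (negPf h) andbF.
pose deg (S : {set V * V}) x := \sum_(p in S) (p.1 == x).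
pose O0 o := [set p | (p \in P0) && o p || (swap p \in P0) && ~~ o (swap p)].
pose O o := I :|: (P1 :|: (P2 :|: O0 o)).
have disj o p : (p \in I) + (p \in P1) + (p \in P2) + (p \in O0 o) = (p \in O o) :> nat.
  case: p => x y; rewrite [X in _ = nat_of_bool X]in_setU [_ \in P1 :|: _]in_setU [_ \in P2 :|: _]in_setU.
  rewrite [_ \in O0 o]inE /swap /=; have [xA|xA] := boolP (x \in A); have [yA|yA] := boolP (y \in A).
  - by rewrite !P0F ?P1F ?P2F ?xA ?yA //=; case: (_ \in I).
  - rewrite IF ?P2F ?(P0F y x) ?xA ?(negPf yA) //=; have := part x y xA yA.
    by case: (_ \in P1); case: (_ \in P0); case: (o _); case: (e x y) => //; lia.
  - rewrite IF ?P1F ?(P0F x y) ?yA ?(negPf xA) //=; have := part y x yA xA.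
    by case: (_ \in P2); case: (_ \in P0); case: (o _); case: (e y x) => //; lia.
  - by rewrite !P0F ?P1F ?P2F ?(negPf xA) ?(negPf yA) //=; case: (_ \in I).
have eO_cross o x y : x \in A -> y \notin A -> ((x, y) \in O o) + ((y, x) \in O o) = e x y :> nat.
  move=> xA yA; rewrite -!disj -part // !IF ?xA ?(negPf yA) // [(y, x) \in P1]P1F ?(negPf yA) //.
  rewrite [(x, y) \in P2]P2F ?xA // ![_ \in O0 o]inE /swap /= [(y, x) \in P0]P0F ?(negPf yA) //=.
  by case: (o _); rewrite ?andbT ?andbF ?orbF; lia.
have I_edge x y : (x \in A) == (y \in A) -> ((x, y) \in I) + ((y, x) \in I) = e x y :> nat.
  move=> xy; rewrite !inE /= [e y x]esym [(y \in A) == _]eq_sym xy; case exy: (e x y) => //=.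
  case: (ltngtP (enum_rank x) (enum_rank y)) => // /val_inj /enum_rank_inj exx.
  by rewrite exx eirr in exy.
have O_same o x y : (x \in A) == (y \in A) -> ((x, y) \in O o) = ((x, y) \in I).
  move=> /eqP xy; have n1 : ~~ ((x \in A) && (y \notin A)) by rewrite xy; case: (y \in A).
  have n2 : ~~ ((x \notin A) && (y \in A)) by rewrite xy; case: (y \in A).
  have n3 : ~~ ((y \in A) && (x \notin A)) by rewrite xy; case: (y \in A).
  by rewrite in_setU in_setU in_setU P1F // P2F // [_ \in O0 o]inE /swap /= !P0F // orbF.
have eO o x y : ((x, y) \in O o) + ((y, x) \in O o) = e x y :> nat.
  have [xy|xy] := boolP ((x \in A) == (y \in A)).
    by rewrite !O_same ?I_edge // eq_sym.
  have [xA|xA] := boolP (x \in A); first by apply: eO_cross; rewrite xA in xy.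
  by rewrite addnC esym; apply: eO_cross; rewrite ?(negPf xA) // in xy *; case: (y \in A) xy.
have swap_inj := inv_inj (@swapK V).
have sumO o F : \sum_(p in O o) F p = \sum_(p in I) F p + \sum_(p in P1) F p + \sum_(p in P2) F p +
    \sum_(p in P0) F (if o p then p else swap p).
  rewrite !sum_indicator -!big_split /=.
  transitivity (\sum_p ((p \in I) * F p + (p \in P1) * F p + (p \in P2) * F p + ((p \in P0) && o p) * F p) +
     \sum_(p : V * V) ((swap p \in P0) && ~~ o (swap p)) * F p).
    rewrite -big_split; apply: eq_bigr => p _ /=; rewrite -(disj o).
    have -> : (p \in O0 o) = ((p \in P0) && o p) + ((swap p \in P0) && ~~ o (swap p)) :> nat.
      rewrite inE; case: p => x y; have [/P0A[xA yA _]|_] //= := boolP ((x, y) \in P0).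
      by rewrite [_ \in P0]P0F ?(negPf yA) // orbF addn0.
    by rewrite !mulnDl !addnA.
  rewrite [X in _ + X](reindex_inj swap_inj) -big_split; apply: eq_bigr => p _; rewrite swapK /=.
  by case: (p \in P0); case: (o p); rewrite //= ?addn0 ?mul0n ?addn0.
have cardO o : #|edges e| = #|O o|.
  by apply: card_edges_oriented => x y; rewrite -?(eqn_add2l 0); have := eO o x y; case: (_ \in O o); case: (_ \in O o); case: (e x y).
pose before x := deg I x + deg P1 x + deg P2 x.
have [|||S _ S0 ST||o oP] := @modular_orientation _ _ m fst snd setT P0 (fun x => m.-1 * before x).
- exact: m0.
- by rewrite cardsT.
- move=> [x y] /P0A[xA yA _]; rewrite !inE; split=> //=; by apply: contraNneq yA => <-.
- exact: P0cut.
- have : m %| \sum_x before x + #|P0|.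
    have := dv; rewrite (cardO (fun=> true)) -sum1_card sumO; congr (_ %| _).
    rewrite !sum1_card; congr (_ + _).
    have degE S : \sum_x deg S x = #|S|.
      rewrite exchange_big -sum1_card; apply: eq_bigr => p _.
      by rewrite (bigD1 p.1) //= eqxx big1 // => x; rewrite eq_sym => /negPf ->.
    by rewrite !big_split /= !degE.
  move=> dvb; rewrite /= -big_distrr /=; apply/eqP.
  have -> : \sum_(x in setT) before x = \sum_x before x by apply: eq_bigl => x; rewrite inE.
  rewrite -(eqn_modDr (\sum_x before x)) -mulSnr prednK // modnMr eq_sym addnC; exact: dvb.
have {}sumO := sumO o; have {}eO := eO o; have {}disj := disj o; have {}O_same := O_same o.
set O' := O o in sumO eO disj O_same; clear cardO eO_cross.
have degO x : deg O' x = before x + out_degree fst snd o P0 x.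
  rewrite /deg sumO; congr (_ + _); apply: eq_bigr => p _; by case: (o p).
have degm x : m %| deg O' x.
  rewrite degO; apply/eqP; rewrite -modnDmr oP ?inE // modnDmr -mulSn prednK // modnMr //.
pose q x := deg O' x %/ m; pose z x := deg I x %/ m.
have mq x : m * q x = deg O' x by rewrite mulnC divnK.
pose cnt x w := cnt1 x w + cnt2 x w.
have Qdeg x : x \in A -> forall w, cnt2 x w = 0.
  move=> xA w; have : \sum_w cnt2 x w = 0.
    rewrite sum2 big1 // => -[a b] /(subsetP Q2P2)/P2A[/= aA _].
    by case: (a =P x) => // ax; rewrite ax xA in aA.
  by move/eqP; rewrite sum_nat_eq0 => /forallP/(_ w)/eqP.
have Qdeg' x : x \notin A -> forall w, cnt1 x w = 0.
  move=> xA w; have : \sum_w cnt1 x w = 0.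
    rewrite sum1 big1 // => -[a b] /(subsetP Q1P1)/P1A[/= aA _].
    by case: (a =P x) => // ax; rewrite -ax aA in xA.
  by move/eqP; rewrite sum_nat_eq0 => /forallP/(_ w)/eqP.
(* Room for what follows: [m] exceeds the remainder of [deg I x] modulo [m], which will be charged
   to [w0], and [D] is the required lower bound on [q]. *)
have qbound x : z x + m + D + \sum_w cnt x w <= q x.
  have hm : m * (m + D + \sum_w cnt x w) <= deg P1 x + deg P2 x.
    have [xA|xA] := boolP (x \in A).
      rewrite (eq_bigr (cnt1 x)) => [|w _]; last by rewrite /cnt Qdeg // addn0.
      by apply: leq_trans (bd1 x _) (leq_addr _ _); rewrite inE xA.
    rewrite (eq_bigr (cnt2 x)) => [|w _]; last by rewrite /cnt Qdeg'.
    by apply: leq_trans (bd2 x xA) (leq_addl _ _).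
  have zm : m * z x <= deg I x by rewrite mulnC leq_trunc_div.
  rewrite -(leq_pmul2l m0) mq degO /before; move: hm zm; move: (\sum_w _) (out_degree _ _ _ _ _) => S T.
  by rewrite -!addnA !mulnDr; slia.
have zq x : z x <= q x by apply: leq_trans (qbound x); rewrite -!addnA leq_addr.
have cnt_le x w : cnt x w <= \sum_w cnt x w by rewrite [X in _ <= X](bigD1 w) //= leq_addr.
(* Arcs inside a side of the cut are coloured in multiples of kappa_w, with the remainder in colour
   [w0], so that they respect the congruence for the total over a side. *)
pose fI x w := kap w * z x + (w == w0) * (deg I x %% m).
have fq x w : fI x w + cnt x w <= kap w * q x.
  have h1 := qbound x; have h2 := cnt_le x w; have h3 := ltn_pmod (deg I x) m0.
  apply: leq_trans (_ : kap w * (z x + m + cnt x w) <= _); last first.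
    by rewrite leq_mul2l; apply/orP; right; move: h1 h2; slia.
  rewrite /fI -!addnA mulnDr leq_add2l.
  apply: leq_trans (_ : 1 * (m + cnt x w) <= _); last by rewrite leq_mul2r kap0 orbT.
  by rewrite mul1n leq_add2r; case: (w == w0); rewrite ?mul1n ?mul0n // ltnW.
have [|colI colIP] := @prescribed_coloring _ _ _ w0 I fst fI.
  move=> x; rewrite big_split -big_distrl /= kapm (bigD1 w0) //= eqxx big1 => [|w /negPf -> //].
  by rewrite addn0 mul1n mulnC -divn_eq.
pose Y := O' :\: (I :|: (Q1 :|: Q2)).
have split4 p : (p \in O') = (p \in I) + (p \in Q1) + (p \in Q2) + (p \in Y) :> nat.
  have := disj p; rewrite /Y in_setD !in_setU.
  have /implyP := subsetP Q1P1 p; have /implyP := subsetP Q2P2 p.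
  by case: (p \in I); case: (p \in Q1); case: (p \in Q2); case: (p \in P1); case: (p \in P2); case: (p \in O'); case: (p \in O0 o).
have YO p : p \in Y -> [/\ p \in O', p \notin I, p \notin Q1 & p \notin Q2].
  by rewrite /Y in_setD !in_setU !negb_or => /andP[/and3P[-> -> ->]].
have sum4 (F1 F2 F3 F4 : V * V -> nat) : \sum_(p in I) F1 p + \sum_(p in Q1) F2 p + \sum_(p in Q2) F3 p + \sum_(p in Y) F4 p =
   \sum_(p in O') (if p \in I then F1 p else if p \in Q1 then F2 p else if p \in Q2 then F3 p else F4 p).
  rewrite !sum_indicator -!big_split; apply: eq_bigr => p _ /=; rewrite split4.
  have := split4 p.
  by case: (p \in I); case: (p \in Q1); case: (p \in Q2); case: (p \in Y); case: (p \in O') => //=; rewrite ?mul1n ?mul0n ?addn0.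
have [|colY colYP] := @prescribed_coloring _ _ _ w0 Y fst (fun x w => kap w * q x - (fI x w + cnt x w)).
  move=> x; have := sum4 (fun p => p.1 == x) (fun p => p.1 == x) (fun p => p.1 == x) (fun p => p.1 == x).
  rewrite [RHS](eq_bigr (fun p => (p.1 == x) : nat)); last by move=> p _; rewrite !if_same.
  rewrite -/(deg O' x) -mq -kapm -sum1 -sum2 -/(deg I x).
  have -> : deg I x = \sum_w fI x w.
    rewrite /deg (eq_bigr (fun p => \sum_w ((p.1 == x) && (colI p == w)))).
      by rewrite exchange_big; apply: eq_bigr => w _; rewrite colIP.
    move=> p _; rewrite (bigD1 (colI p)) //= eqxx andbT big1 ?addn0 // => w.
    by rewrite eq_sym => /negPf ->; rewrite andbF.
  rewrite big_distrl /= => h; apply/eqP; rewrite -(eqn_add2l (\sum_w (fI x w + cnt x w))) -big_split /=.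
  rewrite (eq_bigr (fun w => kap w * q x)); last by move=> w _; rewrite subnKC.
  by rewrite -h !big_split /= !addnA.
pose g y w := \sum_(p in I) ((p.2 == y) && (colI p == w)) + \sum_(p in Y) ((p.2 == y) && (colY p == w)).
(* Arcs of [I] with head in [B] have their tail in [B], those of [Y] outside. Per tail the former
   number [kap w * z x], the latter together with [cnt x w] number kappa_w (q x - z x), for every
   colour other than [w0]. *)
have gcond (B : {set V}) : (forall p, p \in I -> (p.2 \in B) = (p.1 \in B)) ->
    (forall p, p \in Y -> (p.2 \in B) = (p.1 \in ~: B)) ->
    forall w, kap w %| \sum_(y in B) g y w + \sum_(x | x \notin B) cnt x w.
  move=> IB YB w; have [->|ww] := eqVneq w w0; first by rewrite kap_w0 dvd1n.
  rewrite big_split /= (sum_heads_tails _ IB) (sum_heads_tails _ YB) -addnA dvdn_add //.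
    by apply: dvdn_sum => x _; rewrite colIP /fI (negPf ww) addn0 dvdn_mulr.
  have -> : \sum_(x | x \notin B) cnt x w = \sum_(x in ~: B) cnt x w by apply: eq_bigl => x; rewrite inE.
  rewrite -big_split; apply: dvdn_sum => x _ /=; rewrite colYP.
  have -> : kap w * q x - (fI x w + cnt x w) + cnt x w = kap w * (q x - z x).
    by have := fq x w; rewrite /fI (negPf ww) addn0 mulnBr; clear; lia.
  by rewrite dvdn_mulr.
have IA p : p \in I -> (p.2 \in A) = (p.1 \in A) by rewrite inE => /and3P[_ /eqP -> _].
have YA p : p \in Y -> (p.2 \in A) = (p.1 \notin A).
  move=> /YO[pO /negPf pI _ _]; case: p pO pI => x y pO pI /=.
  have : (x \in A) != (y \in A) by apply: contraFN pI => xy; rewrite -O_same.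
  by case: (x \in A); case: (y \in A).
have [|col1 [tail1 div1 low1]] := col1P g.
  move=> w; have -> : \sum_(x | x \notin ~: A) cnt1 x w = \sum_(x | x \notin ~: A) cnt x w.
    by apply: eq_bigr => x; rewrite inE negbK => xA; rewrite /cnt Qdeg // addn0.
  by apply: gcond => p pS; rewrite !inE ?(IA p pS) ?(YA p pS) ?negbK.
have [|col2 [tail2 div2 low2]] := col2P g.
  move=> w; have -> : \sum_(x | x \notin A) cnt2 x w = \sum_(x | x \notin A) cnt x w.
    by apply: eq_bigr => x xA; rewrite /cnt Qdeg'.
  by apply: gcond => p pS; rewrite ?inE ?(IA p pS) ?(YA p pS).
pose col p := if p \in I then colI p else if p \in Q1 then col1 p else if p \in Q2 then col2 p else colY p.
have colE (F : V * V -> W -> nat) : \sum_(p in O') F p (col p) =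
   \sum_(p in I) F p (colI p) + \sum_(p in Q1) F p (col1 p) + \sum_(p in Q2) F p (col2 p) + \sum_(p in Y) F p (colY p).
  by rewrite sum4; apply: eq_bigr => p _; rewrite /col; case: ifP => // _; case: ifP => // _; case: ifP.
have headE y w : \sum_(p in O') ((p.2 == y) && (col p == w)) = g y w +
    \sum_(p in Q1) ((p.2 == y) && (col1 p == w)) + \sum_(p in Q2) ((p.2 == y) && (col2 p == w)).
  by rewrite (colE (fun p u => (p.2 == y) && (u == w))) /g; slia.
have Q1A y w : y \in A -> \sum_(p in Q1) ((p.2 == y) && (col1 p == w)) = 0.
  move=> yA; rewrite big1 // => -[a b] /(subsetP Q1P1)/P1A[/= _ bA].
  by case: (b =P y) => // by'; rewrite by' yA in bA.
have Q2A y w : y \notin A -> \sum_(p in Q2) ((p.2 == y) && (col2 p == w)) = 0.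
  move=> yA; rewrite big1 // => -[a b] /(subsetP Q2P2)/P2A[/= _ bA].
  by case: (b =P y) => // by'; rewrite -by' bA in yA.
exists O', col, q; split=> //.
- move=> x w; rewrite (colE (fun p u => (p.1 == x) && (u == w))) colIP tail1 tail2 colYP.
  by rewrite -(addnA (fI x w)) -/(cnt x w) subnKC.
- by move=> x; apply: leq_trans (qbound x); rewrite addnAC leq_addl.
- move=> y w; rewrite headE; have [yA|yA] := boolP (y \in A); first by rewrite Q1A // addn0 div2.
  by rewrite Q2A // addn0 div1 // inE.
- move=> y w; rewrite headE; have [yA|yA] := boolP (y \in A).
    by rewrite Q1A // addn0; apply: leq_trans (low2 y w yA) (leq_addl _ _).
  by rewrite Q2A // addn0; apply: leq_trans (low1 y w _) (leq_addl _ _); rewrite inE.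
Qed.

(** * Degenerate cases and conclusion *)

Lemma decomposition_no_edges (VT : finType) (eT : rel VT) (V : finType) (e : rel V) :
  edges e = set0 -> has_decomposition eT e.
Proof.
move=> e0; exists set0; split=> [|H]; last by rewrite inE.
rewrite e0; apply/and3P; split; rewrite ?inE //; first by rewrite /cover big_set0.
by apply/trivIsetP => A B; rewrite inE.
Qed.

Lemma edges_small (V : finType) (e : rel V) : irreflexive e -> #|V| <= 1 -> edges e = set0.
Proof.
move=> eirr /card_le1_eqP V1; apply/setP => E; rewrite inE; apply/negP => /imsetP[[s t]].
by rewrite inE /= (V1 s t) ?eirr.
Qed.

(** Each edge is counted at its end on the chosen side, so the kappa_t add up to m. *)
Lemma card_edges_side (V : finType) (e : rel V) (side : pred V) : symmetric e ->
  (forall x y, e x y -> side x != side y) ->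
  #|edges e| = \sum_(w : {x | side x}) #|[set s | e s (val w)]|.
Proof.
move=> esym eside; pose O := [set p : V * V | e p.1 p.2 && side p.2].
rewrite (@card_edges_oriented _ _ O) => [|x y|x y].
- rewrite -sum1_card (partition_big snd side) /=; last by move=> p; rewrite inE => /andP[].
  rewrite (reindex_omap (val : {x | side x} -> V) insub) /=; last by move=> x sx; rewrite insubT.
  apply: eq_big => [w|w _]; first by rewrite valK eqxx (valP w).
  rewrite sum1dep_card.
  rewrite -[RHS](card_imset _ (f := fun s => (s, val w))); last by move=> s s' [].
  apply: eq_card => -[s t]; rewrite !inE /=; apply/andP/imsetP => [[/andP[st tw] /eqP tw']|[s']].
    by exists s; rewrite ?inE -?tw'.
  by rewrite inE => sw [-> ->]; rewrite sw (valP w) eqxx.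
- rewrite !inE /= [e y x]esym; case exy: (e x y) => //=.
  by have := eside x y exy; case: (side x); case: (side y).
- rewrite !inE /= [e y x]esym; case exy: (e x y) => //=.
  by have := eside x y exy; case: (side x); case: (side y).
Qed.

Theorem theorem1 :
  forall (VT : finType) (eT : rel VT), is_tree eT ->
  exists kT : nat,
    forall (V : finType) (e : rel V), simple_graph e ->
      k_edge_connected kT e ->
      #|edges eT| %| #|edges e| ->
      has_decomposition eT e.
Proof.
move=> VT eT treeT; have [[eTsym eTirr] [VT0 [con acy]]] := treeT.
have [VT1|VT1] := leqP #|VT| 1.
  (* A tree with one vertex has m = 0, and divisibility by 0 says that the graph has no edges. *)
  exists 0 => V e sg _; rewrite edges_small // cards0 dvd0n => /eqP/cards0_eq.
  exact: decomposition_no_edges.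
have [side0 side0P] := tree_bipartition treeT; have [l leaf] := tree_leaf treeT VT1.
(* The chosen side is that of the leaf [l], which gives a colour [w0] with kappa = 1. *)
pose side x := side0 x == side0 l.
have sideP s t : eT s t -> side s != side t.
  by move=> /side0P; rewrite /side; case: (side0 s); case: (side0 t); case: (side0 l).
have sl : side l by rewrite /side.
pose w0 : {t | side t} := Sub l sl.
have deg t : exists s, eT s t.
  have [a [b [_ _ ab]]] := card_gt1P VT1.
  have [z zt] : exists z, z != t by have [at'|at'] := eqVneq a t; [exists b; rewrite -at' eq_sym | exists a].
  have /connectP[[|y p]] := con t z; first by move=> _ h; rewrite h eqxx in zt.
  by move=> /= /andP[ty _] _; exists y; rewrite eTsym.
pose kap (w : {t | side t}) := #|[set s | eT s (val w)]|.
have kap0 w : 0 < kap w by have [s st] := deg (val w); apply/card_gt0P; exists s; rewrite inE.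
have edgeT : exists s t, eT s t by have [s st] := deg l; exists s, l.
have [D DP] := equitable_decomposition treeT edgeT.
have mE : \sum_w kap w = #|edges eT| by rewrite (card_edges_side eTsym sideP).
have m0 : 0 < #|edges eT| by rewrite -mE (bigD1 w0) //= addn_gt0 kap0.
have [K KP] := oriented_coloring (w0 := w0) D m0 kap0 mE leaf.
exists K => V e sg ke dv; have [esym eirr] := sg.
have [V1|V1] := leqP #|V| 1.
  exact/decomposition_no_edges/edges_small.
have [O [col [q [eO out Dq inn Din]]]] := KP V e sg V1 ke dv.
have [|x y|H [n eq]] := @equitable_of_coloring _ _ side _ e O col q D (conj eTsym eTirr) sideP deg sg _ _ out Dq inn Din.
- by move=> x y; have := eO x y; case: (_ \in O); case: (_ \in O) => //; case: (e x y).
- by have := eO x y; case: (_ \in O); case: (_ \in O) => //; case: (e x y).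
exact: (DP V e H n sg eq).
Qed.
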